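(* For every fixed positive integer $k$, the following problem is decidable non-deterministically using logarithmic work-space (i.e. it lies in NL): given a list $Q=(q_1,\ldots,q_k)$ of $k$ sequences of bins with pallet symbols and a positive integer $p$, decide whether there is a processing of $Q$ with at most $p$ stack-up places.
   Context: A bin $b$ carries a pallet symbol $\mathit{plt}(b)$ (a positive integer). In an instance, all bins are pairwise distinct, and for every pallet symbol occurring, the sequences together contain at least two bins destined for it. A subsequence of $q=(b_1,\ldots,b_n)$ is a suffix $q'=(b_j,\ldots,b_n)$ (possibly empty), and $q-q'=(b_1,\ldots,b_{j-1})$. A configuration is $(Q,Q')$ with $Q'=(q'_1,\ldots,q'_k)$, each $q'_j$ a subsequence of $q_j$. A pallet $t$ is open in $(Q,Q')$ if some bin for $t$ lies in some $q'_i$ and some bin for $t$ lies in some $q_j-q'_j$. A transformation step removes the first bin of one nonempty $q'_i$. A processing of $Q$ is a sequence of transformation steps transforming $(Q,Q)$ into the configuration with all sequences empty; it uses at most $p$ stack-up places if every configuration along it has at most $p$ open pallets. *)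

(* Defs.v *)
From Stdlib Require List.
From mathcomp Require Import all_boot.
Set Implicit Arguments. Unset Strict Implicit. Unset Printing Implicit Defensive.

(* A bin is a pair (name, pallet symbol); plt b = b.2. *)
Definition bin := (nat * nat)%type.
Definition plt (b : bin) : nat := b.2.

Definition valid_instance (Q : seq (seq bin)) : bool :=
  [&& uniq (flatten Q),
      all (fun b => 0 < plt b) (flatten Q) &
      all (fun b => 1 < count (fun b' => plt b' == plt b) (flatten Q)) (flatten Q)].

(* A configuration (Q, Q') is represented by Q' (Q fixed); q_j - q'_j is
   the prefix of q_j of length size q_j - size q'_j. *)
Definition removed (q q' : seq bin) : seq bin := take (size q - size q') q.

Definition is_open (Q Q' : seq (seq bin)) (t : nat) : bool :=
  has (fun i => has (fun b => plt b == t) (nth [::] Q' i)) (iota 0 (size Q)) &&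
  has (fun j => has (fun b => plt b == t) (removed (nth [::] Q j) (nth [::] Q' j)))
      (iota 0 (size Q)).

(* number of open pallets (every open pallet occurs in Q) *)
Definition num_open (Q Q' : seq (seq bin)) : nat :=
  count (is_open Q Q') (undup (map plt (flatten Q))).

Definition tstep (C1 C2 : seq (seq bin)) : bool :=
  has (fun i => (nth [::] C1 i != [::]) &&
                (C2 == set_nth [::] C1 i (behead (nth [::] C1 i))))
      (iota 0 (size C1)).

Definition processable (Q : seq (seq bin)) (p : nat) : Prop :=
  exists cs : seq (seq (seq bin)),
    [&& path tstep Q cs,
        last Q cs == nseq (size Q) [::] &
        all (fun C => num_open Q C <= p) (Q :: cs)].

Inductive sym := B0 | B1 | Comma | Semi | Bar.

Definition bitsym (b : bool) : sym := if b then B1 else B0.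

Fixpoint bits_aux (fuel n : nat) : seq sym :=
  match fuel with
  | 0 => [:: bitsym (odd n)]
  | f.+1 => if n < 2 then [:: bitsym (odd n)]
            else rcons (bits_aux f n./2) (bitsym (odd n))
  end.
Definition enc_nat (n : nat) : seq sym := bits_aux n n.

Definition enc_bin (b : bin) : seq sym := enc_nat b.1 ++ Comma :: enc_nat b.2.
Definition enc_seq (q : seq bin) : seq sym :=
  flatten (map (fun b => rcons (enc_bin b) Semi) q).
Definition enc_inst (Q : seq (seq bin)) (p : nat) : seq sym :=
  flatten (map (fun q => rcons (enc_seq q) Bar) Q) ++ enc_nat p.

Definition stackup_lang (k : nat) (w : seq sym) : Prop :=
  exists (Q : seq (seq bin)) (p : nat),
    [/\ size Q = k, valid_instance Q, 0 < p, w = enc_inst Q p & processable Q p].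

Inductive dir := DL | DS | DR.
Definition move (d : dir) (x : nat) : nat :=
  match d with DL => x.-1 | DS => x | DR => x.+1 end.

Record NTM (A : Type) := {
  st : finType;
  wk : finType;
  blank : wk;
  start : st;
  acc : pred st;
  (* input symbol (None = end marker), work symbol ->
     possible (new state, written work symbol, input move, work move) *)
  delta : st -> option A -> wk -> seq (st * wk * dir * dir)
}.

Record cfg (A : Type) (M : NTM A) := Cfg {
  cstate : st M;
  ipos : nat;           (* 0 = left end marker, 1..n input, n+1 right end marker *)
  tape : seq (wk M);
  wpos : nat
}.

Definition read (A : Type) (w : seq A) (i : nat) : option A :=
  if i is i'.+1 then nth None (map Some w) i' else None.

Definition init (A : Type) (M : NTM A) : cfg M := Cfg (start M) 0 [::] 0.

Inductive step (A : Type) (M : NTM A) (w : seq A) : cfg M -> cfg M -> Prop :=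
| StepI (C : cfg M) q a di dw :
    Stdlib.Lists.List.In (q, a, di, dw) (delta (cstate C) (read w (ipos C))
                               (nth (blank M) (tape C) (wpos C))) ->
    step w C (Cfg q (minn (size w).+1 (move di (ipos C)))
                  (set_nth (blank M) (tape C) (wpos C) a)
                  (move dw (wpos C))).

Inductive reach (A : Type) (M : NTM A) (w : seq A) : cfg M -> cfg M -> Prop :=
| reach_refl C : reach w C C
| reach_step C1 C2 C3 : step w C1 C2 -> reach w C2 C3 -> reach w C1 C3.

Definition in_NL (A : Type) (L : seq A -> Prop) : Prop :=
  exists (M : NTM A) (c : nat),
    forall w : seq A,
      (L w <-> exists C, reach w (init M) C /\ acc (cstate C)) /\
      (forall C, reach w (init M) C ->
         wpos C <= c * trunc_log 2 (size w + 2) + c).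

(* Main.v *)
Require Import Defs.
From HB Require Import structures.
From mathcomp Require Import all_boot zify.
From Stdlib Require List.
From Stdlib Require Import FunctionalExtensionality.
From Stdlib Require Import Relation_Operators Operators_Properties.
Set Implicit Arguments. Unset Strict Implicit. Unset Printing Implicit Defensive.

(* A regular expression over tape actions is a nondeterministic machine
   (Thompson's construction), and its runs compute the relation it denotes.
   One pass over the input w counts its length in binary and so lays out about
   log |w| cells of work tape; each cell holds one bit of each of a fixed number
   of registers, and a sweep over the cells guesses, tests or increments a
   register. Regular programs over registers therefore define languages in NL.

   The program for the stack-up problem guesses the starts of the k sequences,
   checks the format and validity of the instance, and then searches for a
   processing with one position per sequence and the number f of free places,
   initially at most p, as its only data. Removing a bin affects only its own
   pallet t: if rem (rest) is 1 or 0 according to whether another bin for t was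
   removed before (remains after) the step, then t is open before the step iff
   rem = 1 and after it iff rest = 1, so that f' + rest = f + rem. *)

(** * Nondeterministic programs over tape actions *)

(** The space bound concerns every reachable configuration, including those of branches that get
    stuck later. Hence a program is specified twice: by the relation it computes and by an invariant
    of all configurations on the way.

    The registers hold values below [B], the number of values that fit on a track, and |w| < [B].
    Positions therefore fit, but p does not: written in binary, its value can be exponential in |w|.
    Since at most |w| pallets can be open at once, it is enough to guess a number of places F <= |w|
    and to compare it with the bits of p.

    No set of removed bins or open pallets is ever stored. Whether another bin for t was removed or
    remains is recomputed at each step by a scan of the input that compares each bin with the
    current positions. The test is needed in both outcomes, so it must be certified positively as
    well as negatively.

    Membership asks only for some Q and p that encode to w, so a successful run has to yield one
    such pair, and unique decoding never enters. *)

Lemma In_mem (T : eqType) (x : T) (s : seq T) : List.In x s <-> x \in s.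
Proof.
elim: s => [|y s IH] //=; rewrite in_cons IH; split.
  by case=> [->|->]; rewrite ?eqxx ?orbT.
by case/orP=> [/eqP ->|->]; [left|right].
Qed.

Notation star := clos_refl_trans.

Section Programs.
Variables (A : Type) (T : finType) (b0 : T).

Record act := Act {
  guard : option A -> T -> T -> bool;
  inmove : dir;
  tpmove : dir
}.

Inductive prog :=
| PAct of act
| PSeq of prog & prog
| PAlt of prog & prog
| PStar of prog.

Definition mcfg := (nat * seq T * nat)%type.

(* Tapes are kept long enough to contain the work head, so that writing the
   symbol just read leaves a configuration unchanged. *)
Definition pad (t : seq T) (p : nat) : seq T := set_nth b0 t p (nth b0 t p).

Definition asem (w : seq A) (a : act) (c c' : mcfg) : Prop :=
  exists2 y, guard a (read w c.1.1) (nth b0 c.1.2 c.2) y &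
    c' = (minn (size w).+1 (move (inmove a) c.1.1),
          pad (set_nth b0 c.1.2 c.2 y) (move (tpmove a) c.2),
          move (tpmove a) c.2).

Fixpoint sem (w : seq A) (e : prog) : mcfg -> mcfg -> Prop :=
  match e with
  | PAct a => asem w a
  | PSeq e1 e2 => fun c c' => exists2 c1, sem w e1 c c1 & sem w e2 c1 c'
  | PAlt e1 e2 => fun c c' => sem w e1 c c' \/ sem w e2 c c'
  | PStar e1 => star _ (sem w e1)
  end.

(* Every configuration met by a partial run, including runs that get stuck,
   satisfies I. *)
Fixpoint safe (w : seq A) (I : mcfg -> Prop) (e : prog) (c : mcfg) : Prop :=
  match e with
  | PAct a => forall c', asem w a c c' -> I c'
  | PSeq e1 e2 => safe w I e1 c /\ forall c1, sem w e1 c c1 -> safe w I e2 c1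
  | PAlt e1 e2 => safe w I e1 c /\ safe w I e2 c
  | PStar e1 => forall c1, star _ (sem w e1) c c1 -> safe w I e1 c1
  end.

(** * The automaton of a program *)

Fixpoint pst (e : prog) : finType :=
  match e with
  | PAct _ => bool
  | PSeq e1 e2 => (pst e1 + pst e2)%type
  | PAlt e1 e2 => (bool + (pst e1 + pst e2))%type
  | PStar e1 => option (pst e1)
  end.

(** An alternative has fresh end points, so a run inside one branch cannot slip into the other. A
    star has one fresh state as both end points; being there means that a whole number of iterations
    is complete. *)
Fixpoint src (e : prog) : pst e :=
  match e with
  | PAct _ => false
  | PSeq e1 e2 => inl (src e1)
  | PAlt e1 e2 => inl false
  | PStar e1 => None
  end.

Fixpoint dst (e : prog) : pst e :=
  match e with
  | PAct _ => true
  | PSeq e1 e2 => inr (dst e2)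
  | PAlt e1 e2 => inl true
  | PStar e1 => None
  end.

(** Replaces the silent arcs of the construction, since every machine step must write and move. *)
Definition skip : act := Act (fun _ x y => y == x) DS DS.

Definition skip_if (b : bool) : option act := if b then Some skip else None.

Fixpoint trans (e : prog) : pst e -> pst e -> option act :=
  match e with
  | PAct a => fun s s' => if ~~ s && s' then Some a else None
  | PSeq e1 e2 => fun s s' =>
      match s, s' with
      | inl s, inl s' => trans s s'
      | inl s, inr s' => skip_if ((s == dst e1) && (s' == src e2))
      | inr s, inr s' => trans s s'
      | _, _ => None
      end
  | PAlt e1 e2 => fun s s' =>
      match s, s' with
      | inl false, inr (inl s') => skip_if (s' == src e1)
      | inl false, inr (inr s') => skip_if (s' == src e2)
      | inr (inl s), inl true => skip_if (s == dst e1)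
      | inr (inr s), inl true => skip_if (s == dst e2)
      | inr (inl s), inr (inl s') => trans s s'
      | inr (inr s), inr (inr s') => trans s s'
      | _, _ => None
      end
  | PStar e1 => fun s s' =>
      match s, s' with
      | None, Some s' => skip_if (s' == src e1)
      | Some s, None => skip_if (s == dst e1)
      | Some s, Some s' => trans s s'
      | _, _ => None
      end
  end.

(** Exactly what makes [skip] the identity: the input position is not clipped by [minn], and writing
    under the work head does not lengthen the tape. *)
Definition good (w : seq A) (c : mcfg) :=
  (c.1.1 <= (size w).+1) && (c.2 < size c.1.2).

Definition estep (w : seq A) e (x y : pst e * mcfg) : Prop :=
  exists2 a, trans x.1 y.1 = Some a & asem w a x.2 y.2.

Lemma set_nth_id (t : seq T) p : p < size t -> set_nth b0 t p (nth b0 t p) = t.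
Proof.
move=> lt; apply: (@eq_from_nth _ b0) => [|i _].
  by rewrite size_set_nth (maxn_idPr lt).
by rewrite nth_set_nth /=; case: eqP => [->|].
Qed.

Lemma nth_pad t p i : nth b0 (pad t p) i = nth b0 t i.
Proof. by rewrite nth_set_nth /=; case: eqP => [->|]. Qed.

Lemma asem_good w a c c' : asem w a c c' -> good w c'.
Proof.
by case=> y _ -> /=; rewrite /good /= geq_minl /= size_set_nth leq_maxl.
Qed.

Lemma sem_good w e c c' : good w c -> sem w e c c' -> good w c'.
Proof.
elim: e c c' => [a|e1 IH1 e2 IH2|e1 IH1 e2 IH2|e IH] c c' gc /=.
- exact: asem_good.
- by case=> c1 /(IH1 _ _ gc) gc1 /(IH2 _ _ gc1).
- by case=> [/(IH1 _ _ gc)|/(IH2 _ _ gc)].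
- by move=> H; elim/clos_refl_trans_ind_left: c' / H gc => // y z _ IHy /IH + gc; apply; apply: IHy.
Qed.

Lemma asem_skip w c c' : good w c -> asem w skip c c' <-> c' = c.
Proof.
case: c => [[i t] p] /andP[/= gi gp]; split.
  case=> y /eqP /= -> -> /=; rewrite set_nth_id // /pad set_nth_id //.
  by rewrite (minn_idPr gi).
move=> ->; exists (nth b0 t p) => //=.
by rewrite set_nth_id // /pad set_nth_id // (minn_idPr gi).
Qed.

Lemma skip_ifP (b : bool) a : skip_if b = Some a -> b /\ a = skip.
Proof. by case: b => //= -[<-]. Qed.

Lemma star_map (S S' : Type) (R : S -> S -> Prop) (R' : S' -> S' -> Prop) f x y :
  (forall a b, R a b -> R' (f a) (f b)) -> star _ R x y -> star _ R' (f x) (f y).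
Proof.
move=> RR'; elim=> [a b /RR'|a|a b c _ H1 _]; [exact: rt_step|exact: rt_refl|].
exact: rt_trans.
Qed.

(** Runs of the components are carried over by the injections of their state sets and joined by
    [skip] arcs. *)
Lemma run_sem w e c c' : good w c -> sem w e c c' ->
  star _ (estep w (e := e)) (src e, c) (dst e, c').
Proof.
have skipT e' s s' c0 : good w c0 -> trans s s' = Some skip ->
    star _ (estep w (e := e')) (s, c0) (s', c0).
  by move=> gc ts; apply: rt_step; exists skip => //; apply/asem_skip.
elim: e c c' => [a|e1 IH1 e2 IH2|e1 IH1 e2 IH2|e IH] c c' gc /=.
- by move=> ac; apply: rt_step; exists a.
- case=> c1 s1 s2; have gc1 := sem_good gc s1.
  apply: rt_trans (_ : star _ _ (inl (dst e1), c1) _).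
    by apply: (star_map (f := fun x => (inl x.1, x.2)) _ (IH1 _ _ gc s1)).
  apply: rt_trans (_ : star _ _ (inr (src e2), c1) _).
    by apply: (skipT (PSeq e1 e2)) => //=; rewrite /skip_if !eqxx.
  by apply: (star_map (f := fun x => (inr x.1, x.2)) _ (IH2 _ _ gc1 s2)).
- case=> sc; have gc1 := sem_good gc sc.
    apply: rt_trans (_ : star _ _ (inr (inl (src e1)), c) _).
      by apply: (skipT (PAlt e1 e2)) => //=; rewrite /skip_if !eqxx.
    apply: rt_trans (_ : star _ _ (inr (inl (dst e1)), c') _); last first.
      by apply: (skipT (PAlt e1 e2)) => //=; rewrite /skip_if !eqxx.
    by apply: (star_map (f := fun x => (inr (inl x.1), x.2)) _ (IH1 _ _ gc sc)).
  apply: rt_trans (_ : star _ _ (inr (inr (src e2)), c) _).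
    by apply: (skipT (PAlt e1 e2)) => //=; rewrite /skip_if !eqxx.
  apply: rt_trans (_ : star _ _ (inr (inr (dst e2)), c') _); last first.
    by apply: (skipT (PAlt e1 e2)) => //=; rewrite /skip_if !eqxx.
  by apply: (star_map (f := fun x => (inr (inr x.1), x.2)) _ (IH2 _ _ gc sc)).
- move=> H; elim/clos_refl_trans_ind_left: c' / H; first exact: rt_refl.
  move=> y z Hcy IHy syz; apply: rt_trans IHy _.
  have gy : good w y by apply: (@sem_good w (PStar e) c).
  have gz := sem_good gy syz.
  apply: rt_trans (_ : star _ _ (Some (src e), y) _).
    by apply: (skipT (PStar e)) => //=; rewrite /skip_if !eqxx.
  apply: rt_trans (_ : star _ _ (Some (dst e), z) _); last first.
    by apply: (skipT (PStar e)) => //=; rewrite /skip_if !eqxx.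
  by apply: (star_map (f := fun x => (Some x.1, x.2)) _ (IH _ _ gy syz)).
Qed.

(** The converse needs an invariant for unfinished runs: it records, for each state, which
    components have been completed between [c] and the current configuration. *)
Fixpoint runinv (w : seq A) (e : prog) (c : mcfg) : pst e -> mcfg -> Prop :=
  match e with
  | PAct a => fun s c1 => if s then asem w a c c1 else c1 = c
  | PSeq e1 e2 => fun s c1 =>
      match s with
      | inl s => runinv w c s c1
      | inr s => exists2 c2, sem w e1 c c2 & runinv w c2 s c1
      end
  | PAlt e1 e2 => fun s c1 =>
      match s with
      | inl false => c1 = c
      | inl true => sem w e1 c c1 \/ sem w e2 c c1
      | inr (inl s) => runinv w c s c1
      | inr (inr s) => runinv w c s c1
      end
  | PStar e1 => fun s c1 =>
      match s with
      | None => star _ (sem w e1) c c1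
      | Some s => exists2 c2, star _ (sem w e1) c c2 & runinv w c2 s c1
      end
  end.

Lemma runinv_src w e c : runinv w c (src e) c.
Proof. by elim: e c => //= e _ c; apply: rt_refl. Qed.

Lemma runinv_dst w e c c1 : runinv w c (dst e) c1 -> sem w e c c1.
Proof. by elim: e c c1 => //= e1 _ e2 IH2 c c1 [c2 H /IH2]; exists c2. Qed.

Lemma runinv_step w e c s c1 s' c2 : good w c1 ->
  runinv w c s c1 -> estep (e := e) w (s, c1) (s', c2) -> runinv w c s' c2.
Proof.
move=> gc1; elim: e c s s' => [a|e1 IH1 e2 IH2|e1 IH1 e2 IH2|e IH] c s s' /= I0 [a'] /=.
- by case: s s' I0 => [] [] //= -> [<-].
- case: s s' I0 => [s|s] [s'|s'] //= I0.
  + by move=> tr aa; apply: IH1 I0 _; exists a'.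
  + case/skip_ifP => /andP[/eqP e1' /eqP ->] -> /(asem_skip _ gc1) ->.
    by rewrite e1' in I0; exists c1; [apply: runinv_dst|apply: runinv_src].
  + by case: I0 => c3 H I0 tr aa; exists c3 => //; apply: IH2 I0 _; exists a'.
- case: s s' I0 => [[]|[s|s]] [[]|[s'|s']] //= I0.
  + by case/skip_ifP => /eqP -> -> /(asem_skip _ gc1) ->; rewrite I0; apply: runinv_src.
  + by case/skip_ifP => /eqP -> -> /(asem_skip _ gc1) ->; rewrite I0; apply: runinv_src.
  + case/skip_ifP => /eqP e' -> /(asem_skip _ gc1) ->; rewrite e' in I0.
    by left; apply: runinv_dst.
  + by move=> tr aa; apply: IH1 I0 _; exists a'.
  + case/skip_ifP => /eqP e' -> /(asem_skip _ gc1) ->; rewrite e' in I0.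
    by right; apply: runinv_dst.
  + by move=> tr aa; apply: IH2 I0 _; exists a'.
- case: s s' I0 => [s|] [s'|] //= I0.
  + by case: I0 => c3 H I0 tr aa; exists c3 => //; apply: IH I0 _; exists a'.
  + case/skip_ifP => /eqP e' -> /(asem_skip _ gc1) ->; rewrite e' in I0.
    by case: I0 => c3 H /runinv_dst H'; apply: rt_trans H _; apply: rt_step.
  + case/skip_ifP => /eqP -> -> /(asem_skip _ gc1) ->; exists c1 => //.
    exact: runinv_src.
Qed.

Lemma sem_safe w I e c c1 : I c -> safe w I e c -> sem w e c c1 -> I c1.
Proof.
elim: e c c1 => [a|e1 IH1 e2 IH2|e1 IH1 e2 IH2|e IH] c c1 Ic /=.
- by move=> H /H.
- by case=> s1 s2 [c2 h1 h2]; apply: IH2 (s2 _ h1) h2; apply: IH1 h1.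
- by case=> s1 s2 [h|h]; [apply: IH1 h|apply: IH2 h].
- move=> s H; elim/clos_refl_trans_ind_left: c1 / H (Ic) => // y z Hy IHy h _.
  exact: (IH _ _ (IHy Ic) (s _ Hy) h).
Qed.

(** A configuration inside an unfinished component is covered because [safe] speaks of partial runs
    too. *)
Lemma runinv_safe w I e c s c1 : I c -> safe w I e c ->
  runinv w (e := e) c s c1 -> I c1.
Proof.
elim: e c s => [a|e1 IH1 e2 IH2|e1 IH1 e2 IH2|e IH] c s Ic /=.
- by case: s => [H /H|_ ->].
- case: s => [s|s] [s1 s2]; first exact: IH1.
  by case=> c2 h1; apply: IH2 (s2 _ h1); apply: sem_safe h1.
- case: s => [[]|[s|s]] [s1 s2].
  + by case=> h; [apply: sem_safe s1 h|apply: sem_safe s2 h].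
  + by move->.
  + exact: IH1.
  + exact: IH2.
- move=> sf; case: s => [s [c2 h]|h].
    by apply: IH (sf _ h); apply: (@sem_safe w I (PStar e)) h.
  exact: (@sem_safe w I (PStar e)) h.
Qed.

(** * From automata to machines *)

Definition ntm_of (e : prog) : NTM A :=
  @Build_NTM A (pst e) T b0 (src e) (fun s => s == dst e)
    (fun s x u => List.flat_map (fun s' =>
       if trans s s' is Some a then
         List.map (fun y => (s', y, inmove a, tpmove a))
           (List.filter (guard a x u) (enum T))
       else nil) (enum (pst e))).

Lemma ntm_of_delta e (s s' : pst e) x (u y : T) di dw :
  List.In (s', y, di, dw) (@delta _ (ntm_of e) s x u) <->
  exists a, [/\ trans s s' = Some a, guard a x u y, inmove a = di & tpmove a = dw].
Proof.
split.
  case/List.in_flat_map => s1 [_]; case tr: trans => [a|] // /List.in_map_iff[y1 [[<- <- <- <-]]].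
  by case/List.filter_In => _ g; exists a.
case=> a [tr g <- <-]; apply/List.in_flat_map; exists s'; split.
  by apply/In_mem; rewrite mem_enum.
rewrite tr; apply/List.in_map_iff; exists y; split=> //; apply/List.filter_In.
by split=> //; apply/In_mem; rewrite mem_enum.
Qed.

(** Tapes are compared cell by cell only: [pad] may append blanks to the tape of the program that
    the tape of the machine lacks. *)
Definition matches e (C : cfg (ntm_of e)) (x : pst e * mcfg) : Prop :=
  [/\ cstate C = x.1, ipos C = x.2.1.1, wpos C = x.2.2 &
      nth b0 (tape C) =1 nth b0 x.2.1.2].

Lemma matches_step w e (C C' : cfg (ntm_of e)) x : matches C x ->
  step w C C' -> exists2 x', matches C' x' & estep w x x'.
Proof.
case: x => s [[i t] p] [/= es ei ep et] stC.
case: stC es ei ep et => {C'} -[q0 i0 t0 p0] q a di dw /= H es ei ep et; subst.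
case/ntm_of_delta: H => ac [tr g <- <-].
eexists (q, _); last first.
  exists ac => //; exists a => //=; rewrite -?et; exact: g.
split=> //= j; rewrite /= nth_pad !nth_set_nth /=.
by case: eqP => // _; rewrite et.
Qed.

Lemma step_matches w e (C : cfg (ntm_of e)) x x' : matches C x ->
  estep w x x' -> exists2 C', matches C' x' & step w C C'.
Proof.
case: C => q i t p; case: x => s [[i0 t0] p0] [/= -> -> -> et].
case: x' => s' c' [a /= tr [y /= g ->]].
rewrite -et in g.
eexists; last first.
  apply: (@StepI _ (ntm_of e) w (@Cfg _ (ntm_of e) s i0 t p0) s' y (inmove a) (tpmove a)) => /=.
  by apply/(@ntm_of_delta e); exists a; split.
split=> //= j; rewrite nth_pad !nth_set_nth /=.
by case: eqP => // _; rewrite et.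
Qed.

(** The machine starts with an empty tape; the single blank makes this configuration [good]. *)
Definition minit : mcfg := (0, [:: b0], 0).

Lemma in_NL_prog (L : seq A -> Prop) (e : prog) (c : nat) :
  (forall w, L w <-> exists c', sem w e minit c') ->
  (forall w, safe w (fun x => x.2 <= c * trunc_log 2 (size w + 2) + c) e minit) ->
  in_NL L.
Proof.
move=> Le sf; exists (ntm_of e), c => w.
have m0 : matches (init (ntm_of e)) (src e, minit) by split=> //= -[|[|]].
have g0 : good w minit by [].
(* Every reachable configuration of the machine matches one satisfying [runinv]. This yields both
   the space bound and the soundness of acceptance. *)
have fwd C : reach w (init (ntm_of e)) C ->
    exists2 x, matches C x & good w x.2 /\ runinv w minit x.1 x.2.
  have: exists2 x, matches (init (ntm_of e)) x & good w x.2 /\ runinv w minit x.1 x.2.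
    by exists (src e, minit) => //; split=> //; apply: runinv_src.
  move=> + R; elim: R => // C1 C2 C3 s12 _ IH [x mx [gx rx]]; apply: IH.
  have [x' mx' xx'] := matches_step mx s12.
  exists x' => //; split; last first.
    by case: x x' mx mx' gx rx xx' => [s c1] [s' c2] mx mx' gx rx xx'; apply: runinv_step rx xx'.
  by case: xx' => a _; apply: asem_good.
split=> [|C /fwd[x [_ _ -> _] [_ rx]]]; last exact: runinv_safe (sf w) rx.
split=> [/Le[c' sc']|[C [/fwd[x [ex _ _ _] [_ rx]] /= aC]]]; last first.
  apply/Le; exists x.2; apply: runinv_dst.
  by move: rx; rewrite -ex (eqP aC).
have := run_sem g0 sc'; move: m0; move: (init _) (src e, minit) => C x m0 H.
have [C' [rC' mC']] : exists C', reach w C C' /\ matches C' (dst e, c').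
  elim: (clos_rt_rt1n _ _ _ _ H) C m0 => [x0|x0 y z xy _ IH] C m0; first by exists C; split=> //; constructor.
  have [C1 mC1 st1] := step_matches m0 xy.
  have [C' [rC' mC']] := IH _ mC1.
  by exists C'; split=> //; apply: reach_step st1 rC'.
exists C'; split=> //.
by case: mC' => /= ->.
Qed.

End Programs.

(** * Register programs *)

Definition upd (v : nat -> nat) (x a : nat) : nat -> nat :=
  fun y => if y == x then a else v y.

Section Registers.
Variable A : Type.

(* In RSym x p, register x is a position of the input counted from 0, and p is
   given None at position |w|. *)
Inductive rprog :=
| RGuess of nat
| REq of nat & nat
| RZero of nat
| RInc of nat
| RDec of nat
| RSym of nat & (option A -> bool)
| RSeq of rprog & rprog
| RAlt of rprog & rprog
| RStar of rprog.

(** Overflow in [RInc] and underflow in [RDec] have no result instead of wrapping around; on the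
    tape they are the runs in which no cell stops the carry. *)
Fixpoint rsem (w : seq A) (B : nat) (P : rprog) : (nat -> nat) -> (nat -> nat) -> Prop :=
  match P with
  | RGuess x => fun v v' => exists2 a, a < B & v' = upd v x a
  | REq x y => fun v v' => v x = v y /\ v' = v
  | RZero x => fun v v' => v x = 0 /\ v' = v
  | RInc x => fun v v' => (v x).+1 < B /\ v' = upd v x (v x).+1
  | RDec x => fun v v' => 0 < v x /\ v' = upd v x (v x).-1
  | RSym x p => fun v v' => [/\ v x <= size w, p (read w (v x).+1) & v' = v]
  | RSeq P1 P2 => fun v v' => exists2 v1, rsem w B P1 v v1 & rsem w B P2 v1 v'
  | RAlt P1 P2 => fun v v' => rsem w B P1 v v' \/ rsem w B P2 v v'
  | RStar P1 => star _ (rsem w B P1)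
  end.

Fixpoint rbound (P : rprog) : nat :=
  match P with
  | RGuess x | RZero x | RInc x | RDec x | RSym x _ => x.+1
  | REq x y => maxn x.+1 y.+1
  | RSeq P1 P2 | RAlt P1 P2 => maxn (rbound P1) (rbound P2)
  | RStar P1 => rbound P1
  end.

End Registers.

(** * Compiling register programs to tape programs *)

Section Compile.
Variables (A : Type) (M : nat).

Notation col := {ffun 'I_M.+1 -> bool}.
Notation T := (option (option col)).
Notation blk := (None : T).
Notation Lm := (Some None : T).
Notation cell c := (Some (Some c) : T).
Notation P := (prog A T).
Notation asem := (asem blk).
Notation sem := (sem blk).

Definition pa (g : option A -> T -> T -> bool) (di dt : dir) : P := PAct (Act g di dt).

Definition on_col (G : rel col) (x y : T) : bool :=
  match x, y with Some (Some c), Some (Some c') => G c c' | _, _ => false end.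

Definition colact G : P := pa (fun _ => on_col G) DS DR.
Definition offleft : P := pa (fun _ x y => (x == Lm) && (y == x)) DS DR.
Definition atend : P := pa (fun _ x y => (x == blk) && (y == x)) DS DL.
Definition rewind : P :=
  PSeq (PStar (pa (fun _ x y => (x != Lm) && (y == x)) DS DL))
       (pa (fun _ x y => (x == Lm) && (y == x)) DS DS).
(** [colact] acts on cells only and [atend] on a blank only, so the star is forced to process every
    cell. *)
Definition sweep G : P :=
  PSeq offleft (PSeq (PStar (colact G)) (PSeq atend rewind)).

Definition flipc (x : 'I_M.+1) (c : col) : col := [ffun y => (y == x) (+) c y].
Definition flip (b : bool) x : rel col := fun c c' => (c x == b) && (c' == flipc x c).
(** Adds one for b = [true] and subtracts one for b = [false], as the least significant bit is
    leftmost: bits equal to b are flipped up to and including the first different one. If there is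
    no such bit, the run dies. *)
Definition carry b x : P :=
  PSeq offleft (PSeq (PStar (colact (flip b x))) (PSeq (colact (flip (~~ b) x)) rewind)).

(* Track hd mirrors the input head: the head is at cell hd + 1. *)
Definition hd : 'I_M.+1 := ord_max.
(** The guard stops the head at the right end marker. In [headL] the decrement fails at 0 before the
    head could reach the left end marker. So the mirror never loses step. *)
Definition headR : P := PSeq (pa (fun a x y => isSome a && (y == x)) DR DS) (carry true hd).
Definition headL : P := PSeq (carry false hd) (pa (fun _ x y => y == x) DL DS).

(** For [RSym] the input head wanders at random, and the branch survives only if its mirror then
    equals register x. *)
Fixpoint compile (Q : rprog A) : P :=
  match Q with
  | RGuess x => sweep (fun c c' => [forall y, (y != inord x) ==> (c' y == c y)])
  | REq x y => sweep (fun c c' => (c' == c) && (c (inord x) == c (inord y)))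
  | RZero x => sweep (fun c c' => (c' == c) && ~~ c (inord x))
  | RInc x => carry true (inord x)
  | RDec x => carry false (inord x)
  | RSym x p =>
      PSeq (PStar (PAlt headR headL))
        (PSeq (sweep (fun c c' => (c' == c) && (c hd == c (inord x))))
              (pa (fun a x y => p a && (y == x)) DS DS))
  | RSeq P1 P2 => PSeq (compile P1) (compile P2)
  | RAlt P1 P2 => PAlt (compile P1) (compile P2)
  | RStar P1 => PStar (compile P1)
  end.

Definition tapeof (cols : seq col) : seq T := Lm :: rcons [seq cell c | c <- cols] blk.
Definition conf i cols : mcfg T := (i, tapeof cols, 0).
(** A zipper for a tape during a sweep: [s] lies to the left of the head, [cols] is still to be
    processed. *)
Definition zip_at i (s : seq T) (cols : seq col) : mcfg T :=
  (i, s ++ rcons [seq cell c | c <- cols] blk, size s).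

Section Sem.
Variables (w : seq A) (i : nat).
Hypothesis le_i : i <= (size w).+1.

Lemma pa_stay g t p c' : p < size t ->
  sem w (pa g DS DS) (i, t, p) c' <->
  exists2 y, g (read w i) (nth blk t p) y & c' = (i, set_nth blk t p y, p).
Proof.
move=> lt.
have E y : pad blk (set_nth blk t p y) p = set_nth blk t p y.
  by rewrite /pad set_nth_id // size_set_nth leq_max ltnSn.
split; case=> y /= gy ->; exists y; rewrite ?gy //= ?E ?(minn_idPr le_i) //.
Qed.

Lemma set_nth_cat (s : seq T) x u y : set_nth blk (s ++ x :: u) (size s) y = s ++ y :: u.
Proof. by elim: s => //= a s ->. Qed.

Lemma pa_right g s x y0 u c' :
  sem w (pa g DS DR) (i, s ++ x :: y0 :: u, size s) c' <->
  exists2 y, g (read w i) x y & c' = (i, rcons s y ++ y0 :: u, size (rcons s y)).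
Proof.
have E y : pad blk (set_nth blk (s ++ x :: y0 :: u) (size s) y) (size s).+1 = rcons s y ++ y0 :: u.
  rewrite set_nth_cat cat_rcons /pad set_nth_id //.
  by rewrite size_cat /=; lia.
split; case=> y /= gy ->; exists y => /=; move: gy;
  by rewrite /= ?nth_cat ?ltnn ?subnn /= ?(minn_idPr le_i) ?E ?size_rcons.
Qed.

Lemma pa_left_same (g : option A -> T -> bool) t p c' : p < size t ->
  sem w (pa (fun a x y => g a x && (y == x)) DS DL) (i, t, p) c' <->
  g (read w i) (nth blk t p) /\ c' = (i, t, p.-1).
Proof.
move=> lt.
have E : pad blk (set_nth blk t p (nth blk t p)) p.-1 = t.
  by rewrite set_nth_id // /pad set_nth_id //; apply: leq_ltn_trans lt; apply: leq_pred.
split.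
  by case=> y /= /andP[gy /eqP ->] ->; rewrite E (minn_idPr le_i).
by case=> gy ->; exists (nth blk t p) => /=; rewrite ?gy ?eqxx // E (minn_idPr le_i).
Qed.

Lemma rewindP t p c' : p < size t -> nth blk t 0 = Lm ->
  (forall j, 0 < j <= p -> nth blk t j != Lm) ->
  sem w rewind (i, t, p) c' <-> c' = (i, t, 0).
Proof.
move=> lt t0 tj; split.
  case=> c1 H.
  have {H} [p' lep' ->] : exists2 p', p' <= p & c1 = (i, t, p').
    elim/clos_refl_trans_ind_left: c1 / H => [|y z _ [p' lep' ->]]; first by exists p.
    move=> /(@pa_left_same (fun _ x => x != Lm)) []; first exact: leq_ltn_trans lt.
    by move=> _ ->; exists p'.-1 => //; apply: leq_trans lep'; apply: leq_pred.
  case/pa_stay; first exact: leq_ltn_trans lt.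
  move=> y /andP[/eqP E /eqP ->] ->.
  have p0 : p' = 0.
    by case: p' lep' E => // p' lep' E; move: (tj p'.+1 lep'); rewrite E eqxx.
  by rewrite E p0 -t0 set_nth_id // (leq_ltn_trans _ lt).
move=> ->; exists (i, t, 0); last first.
  apply/pa_stay; first exact: leq_ltn_trans lt.
  exists Lm; first by rewrite t0 !eqxx.
  by rewrite -t0 set_nth_id // (leq_ltn_trans _ lt).
elim: p lt tj => [|p IH] lt tj; first exact: rt_refl.
apply: rt_trans (IH _ _); [apply: rt_step|exact: ltnW|by move=> j /andP[j0 jp]; apply: tj; rewrite j0 ltnW].
by apply/(@pa_left_same (fun _ x => x != Lm)) => //; split=> //; apply: tj; rewrite /= leqnn.
Qed.

Lemma colactP G s cols c' :
  sem w (colact G) (zip_at i s cols) c' <->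
  exists c c1 cols1, [/\ cols = c :: cols1, G c c1 & c' = zip_at i (rcons s (cell c1)) cols1].
Proof.
split.
  case: cols => [|c cols] /=.
    by case=> y /=; rewrite nth_cat ltnn subnn.
  have [y0 [u E]] : exists y0 u, rcons [seq cell c | c <- cols] blk = y0 :: u.
    by case: cols => [|a l]; do 2 eexists.
  rewrite /zip_at /= E => /pa_right[[[c1|]|] //= g ->].
  by exists c, c1, cols; split=> //; rewrite /zip_at E.
case=> c [c1 [cols1 [-> g ->]]].
have [y0 [u E]] : exists y0 u, rcons [seq cell c | c <- cols1] blk = y0 :: u.
  by case: cols1 => [|a l]; do 2 eexists.
by rewrite /zip_at /= E; apply/pa_right; exists (cell c1).
Qed.

Lemma colstarP G s cols c' :
  sem w (PStar (colact G)) (zip_at i s cols) c' <->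
  exists s1 s1' s2, [/\ cols = s1 ++ s2, all2 G s1 s1' &
                       c' = zip_at i (s ++ [seq cell c | c <- s1']) s2].
Proof.
split.
  move=> H; elim/clos_refl_trans_ind_left: c' / H => [|y z _ [s1 [s1' [s2 [E g ->]]]]].
    by exists [::], [::], cols; rewrite cats0.
  case/colactP=> c [c1 [cols1 [E2 gc ->]]].
  exists (rcons s1 c), (rcons s1' c1), cols1; split.
  - by rewrite E E2 cat_rcons.
  - by elim: s1 s1' g {E} => [|a s1 IH] [|a' s1'] //=; rewrite ?gc // => /andP[-> /IH].
  - by rewrite map_rcons rcons_cat.
case=> s1 [s1' [s2 [-> + ->]]].
elim: s1 s s1' => [|c s1 IH] s [|c1 s1'] //=.
  by rewrite cats0 => _; apply: rt_refl.
case/andP=> g gs; apply: rt_trans (_ : star _ _ (zip_at i (rcons s (cell c1)) (s1 ++ s2)) _).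
  by apply: rt_step; apply/colactP; exists c, c1, (s1 ++ s2).
by have := IH (rcons s (cell c1)) s1' gs; rewrite cat_rcons.
Qed.

Lemma offleftP cols c' :
  sem w offleft (conf i cols) c' <-> c' = zip_at i [:: Lm] cols.
Proof.
rewrite /conf /zip_at /tapeof.
have [y0 [u E]] : exists y0 u, rcons [seq cell c | c <- cols] blk = y0 :: u.
  by case: cols => [|a l]; do 2 eexists.
rewrite E; split.
  by move/(@pa_right _ [::]) => [y /andP[_ /eqP ->] ->].
move=> ->; apply/(@pa_right _ [::]); exists Lm => //.
Qed.

Lemma nth_tapeof cols j : 0 < j -> nth blk (tapeof cols) j != Lm.
Proof.
case: j => // j _; rewrite /= nth_rcons size_map.
case: ltnP => [lt|_]; last by case: ifP.
by case: cols lt => // c0 cols lt; rewrite (nth_map c0).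
Qed.

Lemma rewind_conf cols p c' : p < (size cols).+2 ->
  sem w rewind (i, tapeof cols, p) c' <-> c' = conf i cols.
Proof.
move=> lt; apply: rewindP => //=; first by rewrite size_rcons size_map.
by move=> j /andP[j0 _]; apply: nth_tapeof.
Qed.

Lemma zip_at_tapeof s1 s2 :
  zip_at i (Lm :: [seq cell c | c <- s1]) s2 = (i, tapeof (s1 ++ s2), (size s1).+1).
Proof. by rewrite /zip_at /tapeof /= -rcons_cat map_cat size_map. Qed.

Lemma sweepP G cols c' :
  sem w (sweep G) (conf i cols) c' <->
  exists2 cols', all2 G cols cols' & c' = conf i cols'.
Proof.
split.
  case=> c1 /offleftP -> [c2 /colstarP[s1 [s1' [s2 [E g ->]]]]] [c3 H1].
  rewrite /= zip_at_tapeof in H1.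
  case: s2 E H1 => [|c s2] E; last first.
    move/(@pa_left_same (fun _ x => x == blk)) => [].
      by rewrite /= size_rcons size_map size_cat /=; lia.
    by rewrite /= nth_rcons size_map size_cat /= addnS ltnS leq_addr map_cat /= nth_cat size_map ltnn subnn.
  move/(@pa_left_same (fun _ x => x == blk)) => [].
    by rewrite /= size_rcons size_map size_cat /=; lia.
  rewrite cats0 => _ -> /rewind_conf -> //; exists s1' => //.
  by rewrite E cats0.
case=> cols' g ->; exists (zip_at i [:: Lm] cols); first exact/offleftP.
exists (zip_at i ([:: Lm] ++ [seq cell c | c <- cols']) [::]).
  by apply/colstarP; exists cols, cols', [::]; rewrite cats0.
rewrite /= zip_at_tapeof cats0; exists (i, tapeof cols', size cols'); last exact/rewind_conf.
apply/(@pa_left_same (fun _ x => x == blk)); first by rewrite /= size_rcons size_map.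
by rewrite /= nth_rcons size_map ltnn eqxx.
Qed.

(** The function computed by [carry]; it is [None] when all bits equal b, that is, on overflow or
    underflow. *)
Fixpoint carry_cols (b : bool) (x : 'I_M.+1) (cols : seq col) : option (seq col) :=
  match cols with
  | [::] => None
  | c :: s => if c x == b then omap (cons (flipc x c)) (carry_cols b x s)
              else Some (flipc x c :: s)
  end.

Lemma all2_flip b x s s' : all2 (flip b x) s s' -> s' = map (flipc x) s.
Proof. by elim: s s' => [|c s IH] [|c' s'] //= /andP[/andP[_ /eqP ->] /IH ->]. Qed.

Lemma carry_colsP b x cols cols' : carry_cols b x cols = Some cols' <->
  exists s1 c s2, [/\ cols = s1 ++ c :: s2, all (fun c : col => c x == b) s1, c x == ~~ b &
                     cols' = map (flipc x) s1 ++ flipc x c :: s2].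
Proof.
split.
  elim: cols cols' => [|c s IH] cols' //=; case: ifP => [cb|ncb].
    case E: carry_cols => [s'|] //= [<-]; have [s1 [c1 [s2 [-> h1 h2 ->]]]] := IH _ E.
    by exists (c :: s1), c1, s2; split=> //=; rewrite cb.
  by move=> [<-]; exists [::], c, s; split=> //; case: (c x) (b) ncb => [] [].
case=> s1 [c [s2 [-> + cb ->]]]; elim: s1 => [|a s1 IH] /=.
  by move=> _; case: ifP => //; rewrite (eqP cb); case: (b).
by case/andP=> -> h; rewrite IH.
Qed.

Lemma carryP b x cols c' :
  sem w (carry b x) (conf i cols) c' <->
  exists2 cols', carry_cols b x cols = Some cols' & c' = conf i cols'.
Proof.
split.
  case=> c1 /offleftP -> [c2 /colstarP[s1 [s1' [s2 [E g ->]]]]] [c3].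
  case/colactP=> c [c4 [cols1 [E2 /andP[/= cx /eqP ->] ->]]].
  rewrite (all2_flip g).
  rewrite -map_rcons zip_at_tapeof.
  move/rewind_conf => -> ; last by rewrite size_rcons size_cat size_rcons; lia.
  exists (map (flipc x) s1 ++ flipc x c :: cols1).
    apply/carry_colsP; exists s1, c, cols1; split=> //; first by rewrite E E2.
    elim: (s1) (s1') g => //= a s IH [|a' s'] //= /andP[/andP[-> _] /=].
    exact: IH.
  by rewrite cat_rcons.
case=> cols' /carry_colsP[s1 [c [s2 [-> h1 h2 ->]]]] ->.
exists (zip_at i [:: Lm] (s1 ++ c :: s2)); first exact/offleftP.
exists (zip_at i ([:: Lm] ++ [seq cell c | c <- map (flipc x) s1]) (c :: s2)).
  apply/colstarP; exists s1, (map (flipc x) s1), (c :: s2); split=> //.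
  by elim: (s1) h1 => //= a s IH /andP[ax /IH ->]; rewrite /flip ax eqxx.
exists (zip_at i (rcons ([:: Lm] ++ [seq cell c | c <- map (flipc x) s1]) (cell (flipc x c))) s2).
  by apply/colactP; exists c, (flipc x c), s2; split=> //; rewrite /flip h2 eqxx.
rewrite /= -(map_rcons (fun c : col => cell c)) zip_at_tapeof; apply/rewind_conf.
  by rewrite size_rcons size_map size_cat size_rcons size_map; lia.
by rewrite cat_rcons.
Qed.

End Sem.
End Compile.

(** * Register values on tracks, and correctness of the compilation *)

Section Correctness.
Variables (A : Type) (M : nat).

Notation col := {ffun 'I_M.+1 -> bool}.
Notation T := (option (option col)).
Notation blk := (None : T).
Notation Lm := (Some None : T).
Notation cell c := (Some (Some c) : T).
Notation sem := (sem blk).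
Notation hd := (@hd M).

Fixpoint trackval (x : 'I_M.+1) (cols : seq col) : nat :=
  match cols with
  | [::] => 0
  | c :: s => c x + (trackval x s).*2
  end.

Lemma val_lt x cols : trackval x cols < 2 ^ size cols.
Proof. by elim: cols => //= c s IH; rewrite expnS; case: (c x); lia. Qed.

Lemma val_ext x y cols cols' : all2 (fun c c' : col => c x == c' y) cols cols' <->
  size cols = size cols' /\ trackval x cols = trackval y cols'.
Proof.
elim: cols cols' => [|c s IH] [|c' s'] //=; try by split=> // -[].
split.
  by case/andP=> /eqP -> /IH [-> ->].
case=> [[es]] ev.
have [e1 e2] : c x = c' y /\ trackval x s = trackval y s'.
  by move: ev; case: (c x) (c' y) => [] [] /= ?; split=> //; lia.
by rewrite e1 eqxx; apply/IH.
Qed.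

Lemma carry_cols_size b (x : 'I_M.+1) cols cols' : carry_cols b x cols = Some cols' -> size cols' = size cols.
Proof.
elim: cols cols' => //= c s IH cols'; case: ifP => _; last by case=> <-.
by case E: carry_cols => [s'|] //= [<-] /=; rewrite (IH _ E).
Qed.

Lemma carry_cols_other b (x y : 'I_M.+1) cols cols' : y != x ->
  carry_cols b x cols = Some cols' -> trackval y cols' = trackval y cols.
Proof.
move=> yx; elim: cols cols' => //= c s IH cols'; case: ifP => _; last first.
  by case=> <- /=; rewrite ffunE (negbTE yx).
by case E: carry_cols => [s'|] //= [<-] /=; rewrite (IH _ E) ffunE (negbTE yx).
Qed.

Lemma carry_cols_inc (x : 'I_M.+1) cols cols' :
  carry_cols true x cols = Some cols' -> trackval x cols' = (trackval x cols).+1.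
Proof.
elim: cols cols' => //= c s IH cols'; case cx: (c x) => /=; last first.
  by case=> <- /=; rewrite ffunE eqxx cx.
by case E: carry_cols => [s'|] //= [<-] /=; rewrite (IH _ E) ffunE eqxx cx /=; lia.
Qed.

Lemma carry_cols_dec (x : 'I_M.+1) cols cols' :
  carry_cols false x cols = Some cols' -> trackval x cols = (trackval x cols').+1.
Proof.
elim: cols cols' => //= c s IH cols'; case cx: (c x) => /=.
  by case=> <- /=; rewrite ffunE eqxx cx.
by case E: carry_cols => [s'|] //= [<-] /=; rewrite (IH _ E) ffunE eqxx cx /=; lia.
Qed.

Lemma carry_cols_inc_None (x : 'I_M.+1) cols :
  carry_cols true x cols = None -> all (fun c : col => c x) cols /\ (trackval x cols).+1 = 2 ^ size cols.
Proof.
elim: cols => //= c s IH; case cx: (c x) => //=.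
by case E: carry_cols => [s'|] //= _; have [-> e] := IH E; rewrite expnS; split=> //; lia.
Qed.

Lemma carry_cols_dec_None (x : 'I_M.+1) cols : carry_cols false x cols = None -> trackval x cols = 0.
Proof.
elim: cols => //= c s IH; case cx: (c x) => //=.
by case E: carry_cols => [s'|] //= _; rewrite (IH E).
Qed.

Lemma all2_test (p : pred col) cols cols' :
  all2 (fun c c' : col => (c' == c) && p c) cols cols' <-> cols' = cols /\ all p cols.
Proof.
elim: cols cols' => [|c s IH] [|c' s'] //=; try by split=> // -[].
split; first by case/andP=> /andP[/eqP -> ->] /IH[-> ->].
by case=> [[-> ->]] /andP[pc ps]; rewrite eqxx pc; apply/IH.
Qed.

Lemma all_eq_val x y cols : all (fun c : col => c x == c y) cols <-> trackval x cols = trackval y cols.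
Proof.
have -> : all (fun c : col => c x == c y) cols = all2 (fun c c' : col => c x == c' y) cols cols.
  by elim: cols => //= c s ->.
by rewrite val_ext; split=> [[]|].
Qed.

Lemma all_zero_val x cols : all (fun c : col => ~~ c x) cols <-> trackval x cols = 0.
Proof.
elim: cols => //= c s IH; split; first by case/andP=> /negbTE -> /IH ->.
by case: (c x) => //= e; apply/IH; lia.
Qed.

Lemma guess_other x cols cols' :
  all2 (fun c c' : col => [forall y, (y != x) ==> (c' y == c y)]) cols cols' ->
  size cols' = size cols /\ forall y, y != x -> trackval y cols' = trackval y cols.
Proof.
elim: cols cols' => [|c s IH] [|c' s'] //= /andP[/forallP h /IH[-> e]]; split=> // y yx.
by rewrite e //; move: (h y); rewrite yx => /eqP ->.
Qed.

Lemma guess_ex x cols a : a < 2 ^ size cols -> exists2 cols',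
  all2 (fun c c' : col => [forall y, (y != x) ==> (c' y == c y)]) cols cols' &
  trackval x cols' = a.
Proof.
elim: cols a => [|c s IH] a /=.
  by rewrite expn0 ltnS leqn0 => /eqP ->; exists [::].
rewrite expnS => lt; have [|s' h e] := IH a./2.
  by have := odd_double_half a; lia.
exists ([ffun y => if y == x then odd a else c y] :: s') => /=; last first.
  by rewrite e ffunE eqxx odd_double_half.
rewrite h andbT; apply/forallP=> y; apply/implyP=> yx.
by rewrite ffunE (negbTE yx).
Qed.

Section Encoding.
Variables (w : seq A) (B : nat).
Hypothesis size_w : size w < B.

(** [B] is exactly the number of values of a track, so that a carry running off the cells and the
    failure of the bound in [rsem] are the same event. *)
Definition encc (v : nat -> nat) (cols : seq col) : Prop :=
  [/\ trackval hd cols <= size w, 2 ^ size cols = B & forall x, x < M -> trackval (inord x) cols = v x].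

Definition enc (v : nat -> nat) (c : mcfg T) : Prop :=
  exists2 cols, encc v cols & c = conf (trackval hd cols).+1 cols.

Lemma inord_hd x : x < M -> (inord x : 'I_M.+1) != hd.
Proof. by move=> lt; rewrite -val_eqE /= inordK ?neq_ltn ?lt // ltnS ltnW. Qed.

Lemma inord_eq x y : x < M -> y < M -> ((inord x : 'I_M.+1) == inord y) = (x == y).
Proof. by move=> hx hy; rewrite -val_eqE /= !inordK // ltnS ltnW. Qed.

Lemma encc_upd (x : nat) (cols cols' : seq col) v a : x < M ->
  (forall y, y != inord x -> trackval y cols' = trackval y cols) ->
  size cols' = size cols -> trackval (inord x) cols' = a ->
  encc v cols -> encc (upd v x a) cols'.
Proof.
move=> xM e es ex [leh eB ev]; split; first by rewrite e // eq_sym inord_hd.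
  by rewrite es.
move=> y yM; rewrite /upd; case: eqP => [->//|/eqP yx].
by rewrite e ?ev // inord_eq.
Qed.

Lemma encc_enc v cols : encc v cols -> enc v (conf (trackval hd cols).+1 cols).
Proof. by exists cols. Qed.

Lemma encc_hd v cols cols' : encc v cols -> trackval hd cols' <= size w ->
  (forall y, y != hd -> trackval y cols' = trackval y cols) ->
  size cols' = size cols -> encc v cols'.
Proof.
move=> [leh eB ev] le' e es; split=> //; first by rewrite es.
by move=> x xM; rewrite e ?ev // inord_hd.
Qed.

Lemma read_some j : isSome (read w j.+1) = (j < size w).
Proof.
rewrite /=; case: ltnP => [|le]; last by rewrite nth_default // size_map.
by elim: (w) j => [|a s IH] [|j] //= /IH.
Qed.

Lemma pa_input i t p g di c' : p < size t ->
  sem w (pa (fun a x y => g a && (y == x)) di DS) (i, t, p) c' <->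
  g (read w i) /\ c' = (minn (size w).+1 (move di i), t, p).
Proof.
move=> lt.
have E : pad blk (set_nth blk t p (nth blk t p)) p = t.
  by rewrite /pad !set_nth_id.
split.
  by case=> y /= /andP[gy /eqP ->] ->; rewrite E.
by case=> gy ->; exists (nth blk t p) => /=; rewrite ?gy ?eqxx // E.
Qed.

Lemma headR_sound v cols c' : encc v cols ->
  sem w (headR A M) (conf (trackval hd cols).+1 cols) c' -> enc v c'.
Proof.
move=> ev [c1 /pa_input[] // ] ; rewrite read_some => lt -> /carryP[].
  by rewrite geq_minl.
move=> cols' E ->; have -> : minn (size w).+1 (move DR (trackval hd cols).+1) = (trackval hd cols').+1.
  by rewrite (carry_cols_inc E) /=; apply/minn_idPr.
apply: encc_enc; apply: (encc_hd ev).
- by rewrite (carry_cols_inc E).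
- by move=> y yh; apply: carry_cols_other E.
- exact: carry_cols_size E.
Qed.

Lemma headL_sound v cols c' : encc v cols ->
  sem w (headL A M) (conf (trackval hd cols).+1 cols) c' -> enc v c'.
Proof.
move=> ev [c1 /carryP[]]; first by rewrite ltnS; case: ev.
move=> cols' E -> /(@pa_input _ _ _ (fun _ => true))[] // _ ->.
have -> : minn (size w).+1 (move DL (trackval hd cols).+1) = (trackval hd cols').+1.
  rewrite (carry_cols_dec E) /=; apply/minn_idPr; case: ev.
  by rewrite (carry_cols_dec E) => h _ _; apply: ltnW.
apply: encc_enc; apply: (encc_hd ev).
- by case: ev; rewrite (carry_cols_dec E) => /ltnW.
- by move=> y yh; apply: carry_cols_other E.
- exact: carry_cols_size E.
Qed.

Lemma headR_ex v cols : encc v cols -> trackval hd cols < size w ->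
  exists2 cols', encc v cols' /\ trackval hd cols' = (trackval hd cols).+1 &
   sem w (headR A M) (conf (trackval hd cols).+1 cols) (conf (trackval hd cols').+1 cols').
Proof.
move=> ev lt.
case E : (carry_cols true hd cols) => [cols'|]; last first.
  by have [_] := carry_cols_inc_None E; case: ev => _ -> _; lia.
exists cols'.
  split; last exact: carry_cols_inc E.
  apply: (encc_hd ev); rewrite ?(carry_cols_inc E) //; last exact: carry_cols_size E.
  by move=> y yh; apply: carry_cols_other E.
exists (conf (trackval hd cols).+2 cols).
  apply/(@pa_input _ _ _ isSome) => //; split; rewrite ?read_some //=.
  by rewrite (minn_idPr _).
rewrite (carry_cols_inc E); apply/carryP; first by rewrite ltnS.
by exists cols'.
Qed.

Lemma headL_ex v cols : encc v cols -> 0 < trackval hd cols ->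
  exists2 cols', encc v cols' /\ (trackval hd cols').+1 = trackval hd cols &
   sem w (headL A M) (conf (trackval hd cols).+1 cols) (conf (trackval hd cols').+1 cols').
Proof.
move=> ev lt.
case E : (carry_cols false hd cols) => [cols'|]; last by move: lt; rewrite (carry_cols_dec_None E).
have e := carry_cols_dec E.
have le : trackval hd cols' < size w by case: ev; rewrite e.
exists cols'.
  split=> //.
  apply: (encc_hd ev); first exact: ltnW; last exact: carry_cols_size E.
  by move=> y yh; apply: carry_cols_other E.
exists (conf (trackval hd cols).+1 cols').
  by apply/carryP; [case: ev|exists cols'].
apply/(@pa_input _ _ _ (fun _ => true)) => //; split=> //=.
by rewrite e (minn_idPr _) // ltnS ltnW.
Qed.

Lemma seek_sound v cols c' : encc v cols ->
  sem w (PStar (PAlt (headR A M) (headL A M))) (conf (trackval hd cols).+1 cols) c' -> enc v c'.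
Proof.
move=> ev; move: (_ cols) (encc_enc ev) => c ec H.
elim/clos_refl_trans_ind_left: c' / H => // y z _ [cols1 ev1 ->].
by case; [apply: headR_sound|apply: headL_sound].
Qed.

Lemma seek_ex v cols a : encc v cols -> a <= size w ->
  exists2 cols', encc v cols' /\ trackval hd cols' = a &
  sem w (PStar (PAlt (headR A M) (headL A M))) (conf (trackval hd cols).+1 cols)
    (conf (trackval hd cols').+1 cols').
Proof.
(* Induction on the distance between head and target; one of the two truncated differences is 0. *)
move=> ev la; move m : (a - trackval hd cols + (trackval hd cols - a)) => m'.
elim: m' cols ev m => [|m IH] cols ev em.
  by exists cols; [split=> //; lia|apply: rt_refl].
case: (ltngtP a (trackval hd cols)) => h; last lia.
  have [cols1 [ev1 e1] s1] := headL_ex ev (leq_ltn_trans (leq0n _) h).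
  have [|cols' ee ss] := IH _ ev1; first lia.
  by exists cols' => //; apply: rt_trans ss; apply: rt_step; right.
have [cols1 [ev1 e1] s1] := headR_ex ev (leq_trans h la).
have [|cols' ee ss] := IH _ ev1; first lia.
by exists cols' => //; apply: rt_trans ss; apply: rt_step; left.
Qed.

Lemma comp_sound Q v c c' : rbound Q <= M -> enc v c ->
  sem w (@compile A M Q) c c' -> exists2 v', rsem w B Q v v' & enc v' c'.
Proof.
elim: Q v c c' => [x|x y|x|x|x|x p|P1 IH1 P2 IH2|P1 IH1 P2 IH2|P1 IH1] v c c' /=.
- move=> xM [cols ev ->] /sweepP[]; first by case: ev.
  move=> cols' /guess_other[es eo] ->.
  (* A register operation leaves the mirror track alone, so the unmoved input head is still where
     the encoding wants it. *)
  have -> : trackval hd cols = trackval hd cols' by rewrite eo // eq_sym inord_hd.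
  exists (upd v x (trackval (inord x) cols')); last by apply/encc_enc; apply: (encc_upd _ _ _ _ ev).
  by exists (trackval (inord x) cols') => //; case: ev => _ <- _; rewrite -es val_lt.
- rewrite geq_max => /andP[xM yM] [cols ev ->] /sweepP[]; first by case: ev.
  move=> cols' /(all2_test (fun c => c (inord x) == c (inord y)))[-> /all_eq_val e] ->.
  exists v; last exact: encc_enc.
  by split=> //; case: ev => _ _ ev; rewrite -!ev.
- move=> xM [cols ev ->] /sweepP[]; first by case: ev.
  move=> cols' /(all2_test (fun c => ~~ c (inord x)))[-> /all_zero_val e] ->.
  exists v; last exact: encc_enc.
  by split=> //; case: ev => _ _ ev; rewrite -!ev.
- move=> xM [cols ev ->] /carryP[]; first by case: ev.
  move=> cols' E ->.
  have -> : trackval hd cols = trackval hd cols'.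
    by rewrite (carry_cols_other _ E) // eq_sym inord_hd.
  have evx : trackval (inord x) cols = v x by case: ev => _ _ ->.
  exists (upd v x (v x).+1).
    split=> //; rewrite -evx -(carry_cols_inc E).
    by case: ev => _ <- _; rewrite -(carry_cols_size E) val_lt.
  apply/encc_enc; apply: (encc_upd _ _ _ _ ev) => //; last by rewrite (carry_cols_inc E) evx.
    by move=> y yx; apply: carry_cols_other E.
  exact: carry_cols_size E.
- move=> xM [cols ev ->] /carryP[]; first by case: ev.
  move=> cols' E ->.
  have -> : trackval hd cols = trackval hd cols'.
    by rewrite (carry_cols_other _ E) // eq_sym inord_hd.
  have evx : trackval (inord x) cols = v x by case: ev => _ _ ->.
  exists (upd v x (v x).-1); first by rewrite -evx (carry_cols_dec E).
  apply/encc_enc; apply: (encc_upd _ _ _ _ ev) => //; last by rewrite -evx (carry_cols_dec E).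
    by move=> y yx; apply: carry_cols_other E.
  exact: carry_cols_size E.
- move=> xM [cols ev ->] [c1 /(seek_sound ev)[cols1 ev1 ->]] [c2 /sweepP[]].
    by case: ev1.
  move=> cols' /(all2_test (fun c => c hd == c (inord x)))[-> /all_eq_val e] -> /(pa_input)[] //.
  move=> pa ->; exists v.
    by case: ev1 pa e => h _ -> // pa e; rewrite -e.
  by rewrite (minn_idPr _); [apply: encc_enc|case: ev1].
- rewrite geq_max => /andP[h1 h2] ec [c1 /(IH1 _ _ _ h1 ec)[v1 s1 ec1]].
  by case/(IH2 _ _ _ h2 ec1)=> v' s2 ec'; exists v' => //; exists v1.
- rewrite geq_max => /andP[h1 h2] ec [/(IH1 _ _ _ h1 ec)|/(IH2 _ _ _ h2 ec)] [v' s ec'].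
    by exists v' => //; left.
  by exists v' => //; right.
- move=> h ec H; elim/clos_refl_trans_ind_left: c' / H.
    by exists v => //; apply: rt_refl.
  move=> y z _ [v1 s1 e1] /(IH1 _ _ _ h e1)[v2 s2 e2]; exists v2 => //.
  by apply: rt_trans s1 _; apply: rt_step.
Qed.

Lemma comp_complete Q v v' c : rbound Q <= M -> enc v c ->
  rsem w B Q v v' -> exists2 c', sem w (@compile A M Q) c c' & enc v' c'.
Proof.
elim: Q v v' c => [x|x y|x|x|x|x p|P1 IH1 P2 IH2|P1 IH1 P2 IH2|P1 IH1] v v' c /=.
- move=> xM [cols ev ->] [a aB ->].
  have [|cols' h e] := @guess_ex (inord x) cols a; first by case: ev => _ ->.
  have [es eo] := guess_other h.
  exists (conf (trackval hd cols).+1 cols'); first by apply/sweepP; [case: ev|exists cols'].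
  have -> : trackval hd cols = trackval hd cols' by rewrite eo // eq_sym inord_hd.
  by apply/encc_enc; apply: (encc_upd _ _ _ _ ev).
- rewrite geq_max => /andP[xM yM] [cols ev ->] [e ->].
  exists (conf (trackval hd cols).+1 cols); last exact: encc_enc.
  apply/sweepP; first by case: ev.
  exists cols => //; apply/(all2_test (fun c => c (inord x) == c (inord y))); split=> //.
  by apply/all_eq_val; case: ev => _ _ ev; rewrite !ev.
- move=> xM [cols ev ->] [e ->].
  exists (conf (trackval hd cols).+1 cols); last exact: encc_enc.
  apply/sweepP; first by case: ev.
  exists cols => //; apply/(all2_test (fun c => ~~ c (inord x))); split=> //.
  by apply/all_zero_val; case: ev => _ _ ev; rewrite !ev.
- move=> xM [cols ev ->] [lt ->].
  have evx : trackval (inord x) cols = v x by case: ev => _ _ ->.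
  case E : (carry_cols true (inord x) cols) => [cols'|]; last first.
    by have [_] := carry_cols_inc_None E; case: ev => _ -> _; lia.
  exists (conf (trackval hd cols).+1 cols'); first by apply/carryP; [case: ev|exists cols'].
  have -> : trackval hd cols = trackval hd cols'.
    by rewrite (carry_cols_other _ E) // eq_sym inord_hd.
  apply/encc_enc; apply: (encc_upd _ _ _ _ ev) => //; last by rewrite (carry_cols_inc E) evx.
    by move=> y yx; apply: carry_cols_other E.
  exact: carry_cols_size E.
- move=> xM [cols ev ->] [lt ->].
  have evx : trackval (inord x) cols = v x by case: ev => _ _ ->.
  case E : (carry_cols false (inord x) cols) => [cols'|]; last first.
    by move: lt; rewrite -evx (carry_cols_dec_None E).
  exists (conf (trackval hd cols).+1 cols'); first by apply/carryP; [case: ev|exists cols'].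
  have -> : trackval hd cols = trackval hd cols'.
    by rewrite (carry_cols_other _ E) // eq_sym inord_hd.
  apply/encc_enc; apply: (encc_upd _ _ _ _ ev) => //; last by rewrite -evx (carry_cols_dec E).
    by move=> y yx; apply: carry_cols_other E.
  exact: carry_cols_size E.
- move=> xM [cols ev ->] [le pa ->].
  have [cols' [ev' e'] ss] := seek_ex ev le.
  exists (conf (trackval hd cols').+1 cols'); last exact: encc_enc.
  exists (conf (trackval hd cols').+1 cols') => //; exists (conf (trackval hd cols').+1 cols').
    apply/sweepP; first by case: ev'.
    exists cols' => //; apply/(all2_test (fun c => c hd == c (inord x))); split=> //.
    by apply/all_eq_val; rewrite e'; case: ev' => _ _ ->.
  apply/pa_input => //; rewrite e'; split=> //.
  by rewrite (minn_idPr _).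
- rewrite geq_max => /andP[h1 h2] ec [v1 /(IH1 _ _ _ h1 ec)[c1 s1 e1]].
  by case/(IH2 _ _ _ h2 e1)=> c' s2 e2; exists c' => //; exists c1.
- rewrite geq_max => /andP[h1 h2] ec [/(IH1 _ _ _ h1 ec)|/(IH2 _ _ _ h2 ec)] [c' s ec'].
    by exists c' => //; left.
  by exists c' => //; right.
- move=> h ec H; elim/clos_refl_trans_ind_left: v' / H.
    by exists c => //; apply: rt_refl.
  move=> y z _ [c1 s1 e1] /(IH1 _ _ _ h e1)[c2 s2 e2]; exists c2 => //.
  by apply: rt_trans s1 _; apply: rt_step.
Qed.

End Encoding.
End Correctness.

Lemma safe_mono (A : Type) (T : finType) (b : T) (w : seq A) (I I' : mcfg T -> Prop) e c :
  (forall c, I c -> I' c) -> safe b w I e c -> safe b w I' e c.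
Proof.
move=> II'; elim: e c => [a|e1 IH1 e2 IH2|e1 IH1 e2 IH2|e IH] c /=.
- by move=> h c' /h /II'.
- by case=> /IH1 h1 h2; split=> // c1 /h2 /IH2.
- by case=> /IH1 h1 /IH2.
- by move=> h c1 /h /IH.
Qed.

(** * Laying out logarithmically many cells *)

Section Layout.
Variables (A : Type) (M : nat).

Notation col := {ffun 'I_M.+1 -> bool}.
Notation T := (option (option col)).
Notation blk := (None : T).
Notation Lm := (Some None : T).
Notation cell c := (Some (Some c) : T).
Notation sem := (sem blk).
Notation hd := (@hd M).

Definition one : col := [ffun y => y == hd].
Definition newcell : prog A T := pa (fun _ x y => (x == blk) && (y == cell one)) DS DR.
(** An increment of the track [hd] that answers overflow by appending a cell. The new cell [one] is
    0 on all other tracks, so the registers start at 0, and counting on [hd] leaves the mirror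
    correct when the input has been read. *)
Definition incext : prog A T :=
  PSeq (offleft A M) (PSeq (PStar (colact A (flip true hd)))
    (PSeq (PAlt (colact A (flip false hd)) newcell) (rewind A M))).
(** The input head also leaves the left end marker, so that it stands at hd + 1 with hd = 0. *)
Definition startup : prog A T :=
  PSeq (pa (fun _ _ y => y == Lm) DR DR) (atend A M).
Definition nextin : prog A T := pa (fun a x y => isSome a && (y == x)) DR DS.
Definition layout : prog A T :=
  PSeq startup (PSeq (PStar (PSeq nextin incext))
    (pa (fun a x y => ~~ isSome a && (y == x)) DS DS)).

Definition inc_cols (cols : seq col) : seq col :=
  odflt (rcons (map (flipc hd) cols) one) (carry_cols true hd cols).

Lemma newcellP (w : seq A) i s c' : i <= (size w).+1 ->
  sem w newcell (zip_at i s [::]) c' <-> c' = zip_at i (rcons s (cell one)) [::].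
Proof.
move=> le_i.
have E : pad blk (set_nth blk (s ++ [:: blk]) (size s) (cell one)) (size s).+1
   = rcons s (cell one) ++ [:: blk].
  by rewrite set_nth_cat cat_rcons /pad; elim: s => //= a s ->.
have F : nth blk (s ++ [:: blk]) (size s) = blk by rewrite nth_cat ltnn subnn.
split.
  by case=> y /= /andP[_ /eqP ->] ->; rewrite E (minn_idPr le_i) /zip_at size_rcons.
move=> ->; exists (cell one); rewrite /zip_at /= ?F ?eqxx //.
by rewrite E (minn_idPr le_i) size_rcons.
Qed.

Lemma incextP (w : seq A) i cols c' : i <= (size w).+1 ->
  sem w incext (conf i cols) c' <-> c' = conf i (inc_cols cols).
Proof.
move=> le_i; split.
  case=> c1 /(offleftP le_i) -> [c2 /(colstarP le_i)[s1 [s1' [s2 [E g ->]]]]] [c3].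
  have h1 : all (fun c : col => c hd == true) s1.
    by elim: (s1) (s1') g => //= a s IH [|a' s'] //= /andP[/andP[-> _] /IH].
  rewrite (all2_flip g); case.
    case/(colactP le_i)=> c [c4 [cols1 [E2 /andP[/= cx /eqP ->] ->]]].
    rewrite /= -(map_rcons (fun c : col => cell c)) zip_at_tapeof.
    move/(rewind_conf le_i) => -> ; last by rewrite size_rcons size_cat size_rcons; lia.
    rewrite /inc_cols; have -> : carry_cols true hd cols = Some (map (flipc hd) s1 ++ flipc hd c :: cols1).
      by apply/carry_colsP; exists s1, c, cols1; split=> //; rewrite E E2.
    by rewrite cat_rcons.
  case: s2 E => [|c s2] E; last first.
    by case=> y /=; rewrite nth_cat ltnn subnn.
  rewrite cats0 in E; rewrite E.
  move/(newcellP _ _ le_i) => ->.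
  rewrite /= -(map_rcons (fun c : col => cell c)) zip_at_tapeof cats0.
  move/(rewind_conf le_i) => ->; last by rewrite size_rcons.
  rewrite /inc_cols; have -> // : carry_cols true hd s1 = None.
  by elim: (s1) h1 => //= a s IH /andP[/eqP -> /IH ->].
move=> ->; exists (zip_at i [:: Lm] cols); first exact/offleftP.
rewrite /inc_cols; case E : carry_cols => [cols'|] /=.
  have : sem w (carry A true hd) (conf i cols) (conf i cols').
    by apply/carryP => //; exists cols'.
  case=> _ /(offleftP le_i) -> [c1 h1 [c2 h2 h3]]; exists c1 => //; exists c2 => //.
  by left.
have [h _] := carry_cols_inc_None E.
exists (zip_at i ([:: Lm] ++ [seq cell c | c <- map (flipc hd) cols]) [::]).
  apply/colstarP => //; exists cols, (map (flipc hd) cols), [::]; split=> //.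
    by rewrite cats0.
  by elim: (cols) h => //= a s IH /andP[ax /IH ->]; rewrite /flip ax !eqxx.
exists (zip_at i (rcons ([:: Lm] ++ [seq cell c | c <- map (flipc hd) cols]) (cell one)) [::]).
  by right; apply/newcellP.
rewrite /= -(map_rcons (fun c : col => cell c)) zip_at_tapeof cats0; apply/rewind_conf => //.
Qed.

Lemma val_flip_all (s : seq col) (x : 'I_M.+1) : all (fun c : col => c hd) s ->
  trackval x (rcons (map (flipc hd) s) one) =
  if x == hd then 2 ^ size s else trackval x s.
Proof.
elim: s => [|c s IH] /=; first by rewrite ffunE; case: (x == hd).
case/andP=> ch /IH ->; rewrite ffunE expnS; case: (x =P hd) => [->|_] /=; last by [].
by rewrite ch /= -mul2n.
Qed.

Lemma inc_cols_val cols (x : 'I_M.+1) :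
  trackval x (inc_cols cols) = if x == hd then (trackval x cols).+1 else trackval x cols.
Proof.
rewrite /inc_cols; case E : carry_cols => [cols'|] /=.
  case: eqP => [->|/eqP xh]; first exact: carry_cols_inc E.
  exact: carry_cols_other E.
have [h e] := carry_cols_inc_None E.
by rewrite val_flip_all //; case: eqP => // ->; rewrite e.
Qed.

(** The counter has no leading zero; [maxn 1] accounts for the value 0, written with no cells. *)
Definition tight_width cols := 2 ^ size cols <= maxn 1 (trackval hd cols).*2.

Lemma inc_cols_width cols : tight_width cols -> tight_width (inc_cols cols).
Proof.
rewrite /tight_width inc_cols_val eqxx /inc_cols; case E : carry_cols => [cols'|] /=.
  by rewrite (carry_cols_size E); lia.
have [h e] := carry_cols_inc_None E.
by rewrite size_rcons size_map expnS e; lia.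
Qed.

Definition counted j := iter j inc_cols [::].

Lemma val_counted j (x : 'I_M.+1) : trackval x (counted j) = if x == hd then j else 0.
Proof.
elim: j => [|j IH] /=; first by case: ifP.
by rewrite inc_cols_val IH; case: (x == hd).
Qed.

Lemma width_counted j : tight_width (counted j).
Proof. by elim: j => //= j IH; apply: inc_cols_width. Qed.

Lemma width_log j : size (counted j) <= (trunc_log 2 (j + 2)).+1.
Proof.
move: (width_counted j); rewrite /tight_width val_counted eqxx.
case: (size _) => // m; rewrite expnS => h; rewrite ltnS.
by apply: trunc_log_max => //; lia.
Qed.

Lemma startupP (w : seq A) c' :
  sem w startup (minit blk) c' <-> c' = conf 1 (counted 0).
Proof.
have E : forall c, sem w (pa (fun _ _ y => y == Lm) DR DR) (minit blk) c <->
    c = (1, [:: Lm; blk], 1).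
  move=> c; split; first by case=> y /= /eqP -> ->; rewrite (minn_idPr _).
  by move=> ->; exists Lm => //=; rewrite (minn_idPr _).
split.
  by case=> c /E -> /(@pa_left_same _ _ _ _ _ (fun _ x => x == blk))[] // _ ->.
move=> ->; exists (1, [:: Lm; blk], 1); first exact/E.
by apply/(@pa_left_same _ _ _ _ _ (fun _ x => x == blk)).
Qed.

Lemma nextinP (w : seq A) j c' cols :
  sem w nextin (conf j.+1 cols) c' <-> j < size w /\ c' = conf j.+2 cols.
Proof.
rewrite -(read_some w j); split.
  move=> /(@pa_input _ _ _ _ _ _ isSome)[] // h ->; split=> //.
  by rewrite (minn_idPr _) // ltnS -(read_some w j).
case=> h ->; apply/(@pa_input _ _ _ _ _ _ isSome) => //; split=> //.
by rewrite (minn_idPr _) // ltnS -(read_some w j).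
Qed.

Lemma count_loop (w : seq A) c :
  star _ (sem w (PSeq nextin incext)) (conf 1 (counted 0)) c <->
  exists2 j, j <= size w & c = conf j.+1 (counted j).
Proof.
split.
  move=> H; elim/clos_refl_trans_ind_left: c / H; first by exists 0.
  move=> y z _ [j lej ->] [c1 /nextinP[lt ->] /incextP ->] //.
  by exists j.+1.
case=> j + ->; elim: j => [|j IH] lej; first exact: rt_refl.
apply: rt_trans (IH (ltnW lej)) _; apply: rt_step.
by exists (conf j.+2 (counted j)); [apply/nextinP|apply/incextP].
Qed.

(** The loop may stop anywhere, but the closing test succeeds only on the right end marker, so all
    symbols have been counted. *)
Lemma layoutP (w : seq A) c' :
  sem w layout (minit blk) c' <-> c' = conf (size w).+1 (counted (size w)).
Proof.
have E j cols c : sem w (pa (fun a x y => ~~ isSome a && (y == x)) DS DS) (conf j.+1 cols) c <->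
    size w <= j /\ c = (minn (size w).+1 j.+1, tapeof cols, 0).
  rewrite leqNgt -(read_some w j); split.
    by case/(@pa_input _ _ _ _ _ _ (fun a => ~~ isSome a)).
  by move=> h; apply/(@pa_input _ _ _ _ _ _ (fun a => ~~ isSome a)).
split.
  case=> c1 /startupP -> [c2 /count_loop[j lej ->]] /E[le ->].
  have -> : size w = j by lia.
  by rewrite minnn.
move=> ->; exists (conf 1 (counted 0)); first exact/startupP.
exists (conf (size w).+1 (counted (size w))); first by apply/count_loop; exists (size w).
by apply/E; rewrite minnn.
Qed.

(* The N nonblank cells of the tape form an initial segment, which programs of
   the second phase neither lengthen nor shorten. *)
Definition fenced N (c : mcfg T) : Prop :=
  [/\ size c.1.2 = N.+1, forall j, j < N -> nth blk c.1.2 j != blk,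
      nth blk c.1.2 N = blk & c.2 <= N].

(** The first clause preserves the nonblank segment; the second keeps the head from passing the
    first blank. *)
Definition tight_act (a : act A T) := forall x u y, guard a x u y ->
  ((u == blk) = (y == blk)) /\ (u == blk -> tpmove a <> DR).

Fixpoint tight (e : prog A T) : Prop :=
  match e with
  | PAct a => tight_act a
  | PSeq e1 e2 | PAlt e1 e2 => tight e1 /\ tight e2
  | PStar e1 => tight e1
  end.

Lemma tight_step (w : seq A) N a c c' : tight_act a -> fenced N c ->
  asem blk w a c c' -> fenced N c'.
Proof.
case: c => [[i t] p] ta [/= st nb bl le] [y /= /ta[e1 e2] ->].
(* On the blank cell N a move to the right is excluded; from any earlier cell one move does not pass
   N. *)
have lt : move (tpmove a) p <= N.
  move: le; rewrite leq_eqVlt => /orP[/eqP pN|lt].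
    by move: e2; rewrite pN bl; case: (tpmove a) => //= h; [apply: leq_pred|case: (h _)].
  by case: (tpmove a) => //=; [apply: leq_trans (leq_pred _) (ltnW lt)|apply: ltnW].
have es : size (set_nth blk t p y) = N.+1 by rewrite size_set_nth st; lia.
have -> : pad blk (set_nth blk t p y) (move (tpmove a) p) = set_nth blk t p y.
  by rewrite /pad set_nth_id // es ltnS.
split=> //= [j jN|]; rewrite nth_set_nth /=.
  by case: (j =P p) jN => [->|_] jN; rewrite -?e1 nb.
by case: (N =P p) => [e|//]; apply/eqP; rewrite -e1 -e bl.
Qed.

Lemma tight_safe (w : seq A) N e c : tight e -> fenced N c -> safe blk w (fenced N) e c.
Proof.
elim: e c => [a|e1 IH1 e2 IH2|e1 IH1 e2 IH2|e IH] c /=.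
- by move=> ta fc c'; apply: tight_step.
- case=> t1 t2 fc; split; first exact: IH1.
  by move=> c1 s1; apply: IH2 => //; apply: sem_safe s1 => //; apply: IH1.
- by case=> t1 t2 fc; split; [apply: IH1|apply: IH2].
- move=> te fc c1 H; apply: (IH) => //.
  elim/clos_refl_trans_ind_left: c1 / H => // y z _ fy.
  by apply: sem_safe => //; apply: IH.
Qed.

Lemma tight_colact G : tight (colact A G).
Proof. by move=> x [[u|]|] [[y|]|]. Qed.

Lemma tight_offleft : tight (offleft A M).
Proof. by move=> x u y /andP[/eqP -> /eqP ->]. Qed.

Lemma tight_rewind : tight (rewind A M).
Proof. by split=> x u y /andP[h /eqP ->]; split=> //. Qed.

Lemma tight_carry b x : tight (carry A b x).
Proof.
split; first exact: tight_offleft.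
by split; [apply: tight_colact|split; [apply: tight_colact|apply: tight_rewind]].
Qed.

Lemma tight_sweep G : tight (sweep A G).
Proof.
split; first exact: tight_offleft.
split; first exact: tight_colact.
by split; [move=> x u y /andP[h /eqP ->]; split|apply: tight_rewind].
Qed.

Lemma tight_compile Q : tight (compile M Q).
Proof.
elim: Q => //=; do ?[by move=> *; apply: tight_carry|by move=> *; apply: tight_sweep].
move=> n p; split; last first.
  by split; [apply: tight_sweep|move=> x u y /andP[h /eqP ->]; split].
split; first by split; [move=> x u y /andP[h /eqP ->]; split|apply: tight_carry].
by split; [apply: tight_carry|move=> x u y /eqP ->; split].
Qed.

Lemma fenced_tapeof i cols p : p <= (size cols).+1 ->
  fenced (size cols).+1 (i, tapeof cols, p).
Proof.
move=> le; split=> //=; first by rewrite size_rcons size_map.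
  case=> // j; rewrite ltnS /= nth_rcons size_map => lt; rewrite lt.
  by case: cols lt {le} => // c0 cols lt; rewrite (nth_map c0).
by rewrite nth_rcons size_map ltnn eqxx.
Qed.

(** [newcell] is the one action here that is not tight, and it can run only when all cells have been
    passed. The rest is tight, within the old fence before it and the new one after it. *)
Lemma incext_safe (w : seq A) i cols N : i <= (size w).+1 ->
  size (inc_cols cols) < N -> safe blk w (fun c => c.2 <= N) incext (conf i cols).
Proof.
move=> le_i ltN.
have size_incl : size cols <= size (inc_cols cols).
  rewrite /inc_cols; case E : carry_cols => [s|]; first by rewrite (carry_cols_size E).
  by rewrite size_rcons size_map.
have wk n : n <= N -> forall c, fenced n c -> c.2 <= N.
  by move=> nN c [_ _ _ cn]; apply: leq_trans cn nN.
have fin n e c : n <= N -> tight e -> fenced n c -> safe blk w (fun c => c.2 <= N) e c.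
  by move=> nN te fc; apply: safe_mono (wk _ nN) _; apply: tight_safe.
have lec : (size cols).+1 <= N by apply: leq_trans ltN.
split; first by apply: (fin _ _ _ lec); [apply: tight_offleft|apply: fenced_tapeof].
move=> c1 /(offleftP le_i) ->; have E0 := zip_at_tapeof i [::] cols; rewrite /= in E0.
split; first by apply: (fin _ _ _ lec); [apply: tight_colact|rewrite E0; apply: fenced_tapeof].
move=> c2 /(colstarP le_i)[s1 [s1' [s2 [E g ->]]]].
have es : size cols = size s1' + size s2.
  by rewrite E size_cat (all2_flip g) size_map.
have f2 : fenced (size cols).+1 (zip_at i ([:: Lm] ++ [seq cell c | c <- s1']) s2).
  by rewrite /= zip_at_tapeof es -size_cat; apply: fenced_tapeof; rewrite size_cat; lia.
have h1 : all (fun c : col => c hd == true) s1.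
  by elim: (s1) (s1') g => //= a s IH [|a' s'] //= /andP[/andP[-> _] /IH].
have nc c3 : sem w newcell (zip_at i ([:: Lm] ++ [seq cell c | c <- s1']) s2) c3 ->
    c3 = (i, tapeof (inc_cols cols), (size (inc_cols cols)).+1).
  case: s2 E {es f2} => [|c s2] E; last by case=> y /=; rewrite nth_cat ltnn subnn.
  move/(newcellP _ _ le_i) => ->; rewrite cats0 in E; subst.
  rewrite /= -(map_rcons (fun c : col => cell c)) zip_at_tapeof cats0.
  rewrite /inc_cols; have -> /= : carry_cols true hd s1 = None.
    by elim: (s1) h1 => //= a s IH /andP[/eqP -> /IH ->].
  by rewrite (all2_flip g).
split.
  split; first by apply: (fin _ _ _ lec f2) || apply: (fin _ _ _ lec _ f2); apply: tight_colact.
  by move=> c3 /nc ->.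
move=> c3 [h|/nc ->]; last first.
  by apply: (fin _ _ _ ltN); [apply: tight_rewind|apply: fenced_tapeof].
apply: (fin _ _ _ lec); first exact: tight_rewind.
apply: (sem_safe (e := colact A (flip false hd)) (I := fenced (size cols).+1) f2 _ h).
by apply: (tight_safe _ _ f2); apply: tight_colact.
Qed.

Lemma layout_safe (w : seq A) N : trunc_log 2 (size w + 2) + 2 <= N ->
  safe blk w (fun c => c.2 <= N) layout (minit blk).
Proof.
move=> leN; split.
  split; first by move=> c' [y _ ->] /=; lia.
  move=> c1 [y _ ->] /= c2 [y1 _ ->] /=; lia.
move=> c /startupP ->; split; last first.
  by move=> c1 /count_loop[j _ ->] c' [y _ ->].
move=> c1 /count_loop[j lej ->]; split; first by move=> c' [y _ ->].
move=> c2 /nextinP[lt ->]; apply: incext_safe => //.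
have -> : inc_cols (counted j) = counted j.+1 by [].
apply: leq_trans leN; rewrite addn2 !ltnS.
apply: leq_trans (width_log _) _; rewrite ltnS.
by apply: leq_trunc_log; lia.
Qed.

End Layout.

(** The hypothesis covers every B > |w| because a program does not choose B: the layout supplies
    some power of two above |w|. *)
Theorem in_NL_rprog (A : Type) (L : seq A -> Prop) (Q : rprog A) :
  (forall w B, size w < B -> L w <-> exists v, rsem w B Q (fun=> 0) v) -> in_NL L.
Proof.
move=> LQ; pose M := rbound Q.
have e0 (w : seq A) : enc w (2 ^ size (counted M (size w))) (fun=> 0) (conf (size w).+1 (counted M (size w))).
  exists (counted M (size w)); last by rewrite val_counted eqxx.
  split=> //; first by rewrite val_counted eqxx.
  by move=> x xM; rewrite val_counted (negbTE (inord_hd xM)).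
have szB (w : seq A) : size w < 2 ^ size (counted M (size w)).
  by have := val_lt (hd M) (counted M (size w)); rewrite val_counted eqxx.
(* The head stays within trunc_log 2 (|w| + 2) + 2 cells, bits and marker and blank included, hence
   the constant 2. *)
apply: (@in_NL_prog A _ None L (PSeq (layout A M) (compile M Q)) 2) => w.
  rewrite (LQ w _ (szB w)); split.
    case=> v /(comp_complete (szB w) (leqnn _) (e0 w))[c' h _]; exists c'.
    by exists (conf (size w).+1 (counted M (size w))) => //; apply/layoutP.
  case=> c' [c1 /layoutP -> h].
  have [v sv _] := comp_sound (leqnn _) (e0 w) h.
  by exists v.
split; first by apply: layout_safe; lia.
move=> c /layoutP ->.
apply: safe_mono (tight_safe w (tight_compile M Q) (fenced_tapeof _ _)) => //.
move=> c1 [_ _ _ h]; apply: leq_trans h _.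
by have := width_log M (size w); lia.
Qed.

(** * Testing properties of register values *)

Definition sym_code (s : sym) : nat :=
  match s with B0 => 0 | B1 => 1 | Comma => 2 | Semi => 3 | Bar => 4 end.
Definition sym_decode (n : nat) : option sym := nth None (map Some [:: B0; B1; Comma; Semi; Bar]) n.
Lemma sym_codeK : pcancel sym_code sym_decode. Proof. by case. Qed.
HB.instance Definition _ := Equality.copy sym (pcan_type sym_codeK).

Lemma upd_same v x a : upd v x a x = a. Proof. by rewrite /upd eqxx. Qed.
Lemma upd_other v x a y : y != x -> upd v x a y = v y.
Proof. by rewrite /upd => /negbTE ->. Qed.
Lemma upd_lt v x a y : y < x -> upd v x a y = v y.
Proof. by move=> lt; rewrite upd_other // neq_ltn lt. Qed.
Lemma upd_upd v x a b : upd (upd v x a) x b = upd v x b.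
Proof. by apply: functional_extensionality => y; rewrite /upd; case: eqP. Qed.
Lemma upd_id v x : upd v x (v x) = v.
Proof. by apply: functional_extensionality => y; rewrite /upd; case: eqP => // ->. Qed.

Notation rsym := (rprog sym).
(* The first program has a run exactly when the formula holds, the second exactly
   when it fails, so negation needs no complementation of machines. *)
Definition form := (rsym * rsym)%type.

Definition rset0 x : rsym := RSeq (RGuess _ x) (RZero _ x).
Definition rcopy x y : rsym := RSeq (RGuess _ x) (REq _ x y).
Definition rskip x : rsym := RSym x predT.

Definition f_not (F : form) : form := (F.2, F.1).
Definition f_and (F G : form) : form := (RSeq F.1 G.1, RAlt F.2 G.2).
Definition f_or (F G : form) : form := (RAlt F.1 G.1, RSeq F.2 G.2).
(** A universal statement is certified by a single run through all positions; the last test admits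
    only d = |w|, so none is left out. *)
Definition rall d (P : rsym) : rsym :=
  RSeq (rset0 d) (RSeq (RStar (RSeq P (RSeq (RSym d isSome) (RInc _ d))))
                       (RSym d (fun a => ~~ isSome a))).
Definition f_ex d (F : form) : form :=
  (RSeq (RGuess _ d) (RSeq (RSym d isSome) F.1), rall d F.2).
Definition f_sym x (p : pred (option sym)) : form := (RSym x p, RSym x (predC p)).
Definition rprev d x p : rsym := RSeq (rcopy d x) (RSeq (RDec _ d) (RSym d p)).
Definition f_start d x (p : pred (option sym)) : form :=
  (RAlt (RZero _ x) (rprev d x p), rprev d x (predC p)).
(** The witness of the inequality is the guessed number of increments that leads from x to y. *)
Definition rle d x y : rsym := RSeq (rcopy d x) (RSeq (RStar (RInc _ d)) (REq _ d y)).
Definition rlt d x y : rsym :=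
  RSeq (rcopy d x) (RSeq (RInc _ d) (RSeq (RStar (RInc _ d)) (REq _ d y))).
Definition f_le d x y : form := (rle d x y, rlt d y x).
Definition f_lt d x y : form := (rlt d x y, rle d y x).
Definition f_eq d x y : form := (REq _ x y, RAlt (rlt d x y) (rlt d y x)).
(** Meant for a P with exactly one result: existence and uniqueness of the value let P precede the
    formula and its negation alike. *)
Definition f_let (P : rsym) (F : form) : form := (RSeq P F.1, RSeq P F.2).

(** * Correctness of the formula combinators *)

Section Formulas.
Variables (w : seq sym) (B : nat).
Hypothesis size_w : size w < B.
Notation sem := (rsem w B).
Notation n := (size w).

Definition symat (i : nat) : option sym := read w i.+1.

Arguments symat : simpl never.

Lemma symat_some i : isSome (symat i) = (i < n).
Proof. exact: read_some. Qed.

Definition agree d (v v' : nat -> nat) := forall x, x < d -> v x = v' x.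
Definition small d (v : nat -> nat) := forall x, x < d -> v x <= n.
Definition local d (T : Type) (phi : (nat -> nat) -> T) :=
  forall v v', agree d v v' -> phi v = phi v'.
(* Registers from d on are scratch. *)
Definition asserts d P (phi : (nat -> nat) -> bool) := forall v, small d v ->
  (forall v', sem P v v' -> phi v /\ agree d v v') /\ (phi v -> exists v', sem P v v').
Definition decides d (F : form) phi :=
  [/\ local d phi, asserts d F.1 phi & asserts d F.2 (fun v => ~~ phi v)].

Lemma agree_small d v v' : agree d v v' -> small d v -> small d v'.
Proof. by move=> e s x xd; rewrite -e // s. Qed.

Lemma agree_sym d v v' : agree d v v' -> agree d v' v.
Proof. by move=> e x xd; rewrite e. Qed.

Lemma agree_trans d v1 v2 v3 : agree d v1 v2 -> agree d v2 v3 -> agree d v1 v3.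
Proof. by move=> e e' x xd; rewrite e // e'. Qed.

Lemma agree_le d d' v v' : d <= d' -> agree d' v v' -> agree d v v'.
Proof. by move=> le e x xd; apply: e; apply: leq_trans le. Qed.

Lemma agree_upd d x v a : d <= x -> agree d v (upd v x a).
Proof. by move=> dx y yd; rewrite upd_lt // (leq_trans yd). Qed.

Lemma agree_upd_S d v v' a : agree d v v' -> agree d.+1 (upd v d a) (upd v' d a).
Proof.
move=> e y; rewrite ltnS leq_eqVlt => /orP[/eqP ->|lt]; first by rewrite !upd_same.
by rewrite !upd_lt // e.
Qed.

Lemma agree_S d v v' : agree d v v' -> v d = v' d -> agree d.+1 v v'.
Proof. by move=> e e' y; rewrite ltnS leq_eqVlt => /orP[/eqP ->|/e]. Qed.

Lemma small_upd d v a : small d v -> a <= n -> small d.+1 (upd v d a).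
Proof.
move=> s le y; rewrite ltnS leq_eqVlt => /orP[/eqP ->|lt]; first by rewrite upd_same.
by rewrite upd_lt // s.
Qed.

Lemma rset0P x v v' : sem (rset0 x) v v' <-> v' = upd v x 0.
Proof.
split; first by case=> _ [a _ ->] /= [+ ->]; rewrite upd_same => ->.
move=> ->; exists (upd v x 0); last by split; rewrite ?upd_same.
by exists 0 => //; apply: leq_ltn_trans size_w.
Qed.

Lemma rcopyP x y v v' : x != y -> v y <= n -> sem (rcopy x y) v v' <-> v' = upd v x (v y).
Proof.
move=> xy le; split.
  by case=> _ [a _ ->] /= [+ ->]; rewrite upd_same upd_other 1?eq_sym // => ->.
move=> ->; exists (upd v x (v y)); first by exists (v y) => //; apply: leq_ltn_trans size_w.
by split=> //; rewrite upd_same upd_other 1?eq_sym.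
Qed.

Lemma asserts_ext d P phi psi : (forall v, small d v -> phi v = psi v) ->
  asserts d P phi -> asserts d P psi.
Proof. by move=> e h v sv; rewrite -e //; apply: h. Qed.

Lemma asserts_seq d P Q phi psi : local d psi -> asserts d P phi -> asserts d Q psi ->
  asserts d (RSeq P Q) (fun v => phi v && psi v).
Proof.
move=> lp hP hQ v sv; have [h1 h2] := hP v sv; split.
  move=> v' [v1 /h1[-> e1]] s2.
  have [h _] := hQ v1 (agree_small e1 sv); have [p2 e2] := h _ s2.
  by rewrite (lp _ _ e1) p2; split=> //; apply: agree_trans e2.
case/andP=> /h2[v1 s1] pv; have [_ e1] := h1 _ s1.
have [_ []] := hQ v1 (agree_small e1 sv); first by rewrite -(lp _ _ e1).
by move=> v' s2; exists v'; exists v1.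
Qed.

Lemma asserts_alt d P Q phi psi : asserts d P phi -> asserts d Q psi ->
  asserts d (RAlt P Q) (fun v => phi v || psi v).
Proof.
move=> hP hQ v sv; have [h1 h2] := hP v sv; have [h3 h4] := hQ v sv; split.
  by move=> v' [/h1[-> ?]|/h3[-> ?]]; rewrite ?orbT.
by case/orP=> [/h2[v' s]|/h4[v' s]]; exists v'; [left|right].
Qed.

Lemma asserts_all d P phi : local d.+1 phi -> asserts d.+1 P phi ->
  asserts d (rall d P) (fun v => all (fun a => phi (upd v d a)) (iota 0 n)).
Proof.
move=> lp hP v sv; split.
  move=> v' [v0 /rset0P -> [v1 H [/= le nsome ->]]].
  (* Loop invariant: the registers below d are as at the start, and phi holds at every position
     already passed. *)
  have [ag ld al] : [/\ agree d v v1, v1 d <= n & forall a, a < v1 d -> phi (upd v d a)].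
    elim/clos_refl_trans_ind_left: v1 / H {le nsome}.
      by rewrite upd_same; split=> //; apply: agree_upd.
    move=> y z _ [ag ld al] /= [y1 sP [y2 [_ some ->] [_ ->]]].
    have sy : small d.+1 y.
      by move=> x; rewrite ltnS leq_eqVlt => /orP[/eqP ->//|xd]; rewrite -ag // sv.
    have [hs _] := hP y sy; have [py e] := hs _ sP; split.
    - apply: agree_trans ag _; apply: agree_trans (agree_le (leqnSn _) e) _.
      exact: agree_upd.
    - by rewrite upd_same -symat_some.
    - move=> a; rewrite upd_same ltnS leq_eqVlt => /orP[/eqP ->|lt]; last first.
        by apply: al; rewrite e.
      rewrite -(lp y) // => x; rewrite ltnS leq_eqVlt => /orP[/eqP ->|lt].
        by rewrite upd_same e.
      by rewrite upd_lt // ag.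
  split=> //; apply/allP=> a; rewrite mem_iota => /andP[_ an]; apply: al.
  apply: leq_trans an _; rewrite add0n leqNgt -symat_some.
  exact: nsome.
move/allP=> al.
(* Conversely, a run is extended position by position; P may spoil scratch registers but neither d
   nor those below it. *)
have [v1 [st ag e]] : exists v1, [/\ star _ (sem (RSeq P (RSeq (RSym d isSome) (RInc _ d)))) (upd v d 0) v1,
    agree d v v1 & v1 d = n].
  elim: {1 3}n (leqnn n) => [|a IH] lea.
    exists (upd v d 0); split; [exact: rt_refl|exact: agree_upd|exact: upd_same].
  have [v1 [st ag e]] := IH (ltnW lea).
  have sv1 : small d.+1 v1.
    move=> x; rewrite ltnS leq_eqVlt => /orP[/eqP ->|xd]; first by rewrite e ltnW.
    by rewrite -ag // sv.
  have [hs [|v2 sP]] := hP v1 sv1.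
    rewrite (lp _ (upd v d a)); first by apply: al; rewrite mem_iota.
    by apply: agree_S; [apply: agree_trans (agree_sym ag) (agree_upd _ _ _)|rewrite upd_same].
  have [_ e2] := hs _ sP.
  have v2d : v2 d = a by rewrite -e2.
  exists (upd v2 d a.+1); split.
  - apply: rt_trans st _; apply: rt_step; exists v2 => //; exists v2.
      split=> //; rewrite ?v2d; first exact: ltnW.
      by rewrite -/(symat a) symat_some.
    by split; rewrite v2d //; apply: leq_ltn_trans size_w.
  - apply: agree_trans ag _; apply: agree_trans (agree_le (leqnSn _) e2) _.
    exact: agree_upd.
  - exact: upd_same.
exists v1; exists (upd v d 0); first exact/rset0P.
exists v1 => //; split=> //; rewrite e //.
by rewrite -/(symat n) symat_some ltnn.
Qed.

(** [RGuess] ranges up to B - 1; the test [isSome] cuts the guess down to the positions of w. *)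
Lemma asserts_ex d P phi : local d.+1 phi -> asserts d.+1 P phi ->
  asserts d (RSeq (RGuess _ d) (RSeq (RSym d isSome) P))
    (fun v => has (fun a => phi (upd v d a)) (iota 0 n)).
Proof.
move=> lp hP v sv; split.
  move=> v' [_ [a aB ->] [_ [le some ->] sP]].
  rewrite upd_same -/(symat a) symat_some in le some.
  have [h _] := hP _ (small_upd sv le); have [pa e] := h _ sP; split.
    by apply/hasP; exists a => //; rewrite mem_iota.
  exact: agree_trans (agree_upd _ _ (leqnn d)) (agree_le (leqnSn _) e).
case/hasP=> a; rewrite mem_iota => /andP[_ an] pa.
have an' : a <= n by apply: ltnW.
have [_ [//|v' s]] := hP _ (small_upd sv an').
exists v'; exists (upd v d a); first by exists a => //; apply: leq_ltn_trans size_w.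
exists (upd v d a) => //; split=> //; rewrite upd_same //.
by rewrite -/(symat a) symat_some.
Qed.

Lemma decides_not d F phi : decides d F phi -> decides d (f_not F) (fun v => ~~ phi v).
Proof.
case=> l h1 h2; split=> //; first by move=> v v' e; rewrite (l _ _ e).
by apply: asserts_ext h1 => v _; rewrite negbK.
Qed.

Lemma decides_and d F G phi psi : decides d F phi -> decides d G psi ->
  decides d (f_and F G) (fun v => phi v && psi v).
Proof.
case=> l1 h1 h2 [l2 h3 h4]; split.
- by move=> v v' e; rewrite (l1 _ _ e) (l2 _ _ e).
- exact: asserts_seq.
- by apply: asserts_ext (asserts_alt h2 h4) => v _; rewrite negb_and.
Qed.

Lemma decides_or d F G phi psi : decides d F phi -> decides d G psi ->
  decides d (f_or F G) (fun v => phi v || psi v).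
Proof.
case=> l1 h1 h2 [l2 h3 h4]; split.
- by move=> v v' e; rewrite (l1 _ _ e) (l2 _ _ e).
- exact: asserts_alt.
- apply: asserts_ext (asserts_seq _ h2 h4) => [v _|v v' e]; first by rewrite negb_or.
  by rewrite (l2 _ _ e).
Qed.

Lemma decides_ex d F phi : decides d.+1 F phi ->
  decides d (f_ex d F) (fun v => has (fun a => phi (upd v d a)) (iota 0 n)).
Proof.
case=> l h1 h2; split.
- move=> v v' e; apply: eq_has => a; apply: l; exact: agree_upd_S.
- exact: asserts_ex.
- apply: asserts_ext (asserts_all _ h2) => [v _|v v' e]; last by rewrite (l _ _ e).
  by rewrite -all_predC.
Qed.

Lemma decides_ext d F phi psi : phi =1 psi -> decides d F phi -> decides d F psi.
Proof.
move=> e [l h1 h2]; split.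
- by move=> v v' /l; rewrite !e.
- by apply: asserts_ext h1 => v _; rewrite e.
- by apply: asserts_ext h2 => v _; rewrite e.
Qed.

Lemma decides_sym d x p : x < d -> decides d (f_sym x p) (fun v => p (symat (v x))).
Proof.
move=> xd; split; first by move=> v v' e; rewrite e.
  move=> v sv; split; first by move=> v' [_ h ->].
  by move=> h; exists v; split=> //; apply: sv.
move=> v sv; split; first by move=> v' [_ h ->].
by move=> h; exists v; split=> //; apply: sv.
Qed.

Lemma rprevP d x p v v' : x < d -> small d v -> sem (rprev d x p) v v' <->
  [/\ 0 < v x, p (symat (v x).-1) & v' = upd v d (v x).-1].
Proof.
move=> xd sv; have xd' : d != x by rewrite neq_ltn xd orbT.
have le : (v x).-1 <= n := leq_trans (leq_pred _) (sv _ xd).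
split.
  case=> v1 /(rcopyP _ xd' (sv _ xd)) -> [_ [/= + ->]]; rewrite upd_same => pos.
  by case=> _; rewrite upd_upd upd_same => h ->.
case=> pos h ->; exists (upd v d (v x)); first exact/(rcopyP _ xd' (sv _ xd)).
exists (upd v d (v x).-1); first by rewrite /= upd_same upd_upd.
by rewrite /= upd_same; split.
Qed.

Lemma decides_start d x p : x < d ->
  decides d (f_start d x p) (fun v => (v x == 0) || p (symat (v x).-1)).
Proof.
move=> xd; split; first by move=> v v' e; rewrite e.
  move=> v sv; split.
    move=> v' [[-> ->] //|/(rprevP _ _ xd sv)[_ -> ->]].
    by rewrite orbT; split=> //; apply: agree_upd.
  case: (posnP (v x)) => [e _|pos]; first by exists v; left.
  by move=> /= h; eexists; right; apply/(rprevP _ _ xd sv); split.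
move=> v sv; split.
  move=> v' /(rprevP _ _ xd sv)[pos h ->]; rewrite negb_or -lt0n pos /=.
  by split; [exact: h|apply: agree_upd].
rewrite negb_or -lt0n => /andP[pos h]; by eexists; apply/(rprevP _ _ xd sv); split.
Qed.

(** The bound on [a] is conditional since zero iterations check nothing. *)
Lemma star_inc d v v' : sem (RStar (RInc _ d)) v v' <->
  exists2 a, v d <= a & v' = upd v d a /\ (v d < a -> a < B).
Proof.
split.
  move=> H; elim/clos_refl_trans_ind_left: v' / H.
    by exists (v d); rewrite ?upd_id ?ltnn.
  move=> _ z _ [a le [-> _]] [/= lt ->]; rewrite upd_same in lt *.
  by exists a.+1; [apply: leqW|rewrite upd_upd].
case=> a le [-> aB].
move: aB; rewrite -(subnKC le); elim: (a - v d) => [|m IH] aB.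
  by rewrite addn0 upd_id; apply: rt_refl.
apply: rt_trans (IH _) _; first by move=> _; apply: leq_trans (aB _); lia.
apply: rt_step; rewrite /= upd_same upd_upd addnS; split=> //.
by rewrite -addnS; apply: aB; lia.
Qed.

Lemma asserts_le d x y : x < d -> y < d -> asserts d (rle d x y) (fun v => v x <= v y).
Proof.
move=> xd yd v sv.
have xd' : d != x by rewrite neq_ltn xd orbT.
split.
  move=> v' [_ /(rcopyP _ xd' (sv _ xd)) -> [v2 /star_inc[a]]].
  rewrite upd_same upd_upd => le [-> _] [/=]; rewrite upd_same upd_lt // => <- ->.
  by split=> //; apply: agree_upd.
move=> le; exists (upd v d (v y)); exists (upd v d (v x)); first exact/(rcopyP _ xd' (sv _ xd)).
exists (upd v d (v y)); last by rewrite /= upd_same upd_lt.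
apply/star_inc; exists (v y); rewrite ?upd_same // upd_upd; split=> // _.
by apply: leq_ltn_trans size_w; apply: sv.
Qed.

Lemma asserts_lt d x y : x < d -> y < d -> asserts d (rlt d x y) (fun v => v x < v y).
Proof.
move=> xd yd v sv.
have xd' : d != x by rewrite neq_ltn xd orbT.
split.
  move=> v' [_ /(rcopyP _ xd' (sv _ xd)) -> [_ [/= h ->]]].
  rewrite upd_same upd_upd => -[v2 /star_inc[a]].
  rewrite upd_same upd_upd => le [-> _] [/=]; rewrite upd_same upd_lt // => <- ->.
  by split=> //; apply: agree_upd.
move=> le; exists (upd v d (v y)); exists (upd v d (v x)); first exact/(rcopyP _ xd' (sv _ xd)).
exists (upd v d (v x).+1).
  rewrite /= upd_same upd_upd; split=> //.
  by apply: leq_ltn_trans le _; apply: leq_ltn_trans size_w; apply: sv.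
exists (upd v d (v y)); last by rewrite /= upd_same upd_lt.
apply/star_inc; exists (v y); rewrite ?upd_same // upd_upd; split=> // _.
by apply: leq_ltn_trans size_w; apply: sv.
Qed.

Lemma decides_le d x y : x < d -> y < d -> decides d (f_le d x y) (fun v => v x <= v y).
Proof.
move=> xd yd; split; [by move=> v v' e; rewrite !e|exact: asserts_le|].
by apply: asserts_ext (asserts_lt yd xd) => v _; rewrite ltnNge.
Qed.

Lemma decides_lt d x y : x < d -> y < d -> decides d (f_lt d x y) (fun v => v x < v y).
Proof.
move=> xd yd; split; [by move=> v v' e; rewrite !e|exact: asserts_lt|].
by apply: asserts_ext (asserts_le yd xd) => v _; rewrite leqNgt.
Qed.

Lemma decides_eq d x y : x < d -> y < d -> decides d (f_eq d x y) (fun v => v x == v y).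
Proof.
move=> xd yd; split; first by move=> v v' e; rewrite !e.
  move=> v sv; split; first by move=> v' [/= -> ->].
  by move/eqP=> e; exists v.
by apply: asserts_ext (asserts_alt (asserts_lt xd yd) (asserts_lt yd xd)) => v _; rewrite neq_ltn.
Qed.

Lemma decides_let d P g F phi : local d g ->
  (forall v, small d v -> g v <= n) ->
  (forall v v', small d v -> sem P v v' <-> v' = upd v d (g v)) ->
  decides d.+1 F phi -> decides d (f_let P F) (fun v => phi (upd v d (g v))).
Proof.
move=> lg gn hP [l h1 h2]; split.
- move=> v v' e; apply: l; rewrite (lg _ _ e); exact: agree_upd_S.
- move=> v sv; have [h3 h4] := h1 _ (small_upd sv (gn v sv)); split.
    move=> v' [_ /(hP _ _ sv) -> /h3[-> e]]; split=> //.
    exact: agree_trans (agree_upd _ _ (leqnn d)) (agree_le (leqnSn _) e).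
  by move/h4=> [v' s]; exists v'; exists (upd v d (g v)) => //; apply/hP.
- move=> v sv; have [h3 h4] := h2 _ (small_upd sv (gn v sv)); split.
    move=> v' [_ /(hP _ _ sv) -> /h3[-> e]]; split=> //.
    exact: agree_trans (agree_upd _ _ (leqnn d)) (agree_le (leqnSn _) e).
  by move/h4=> [v' s]; exists v'; exists (upd v d (g v)) => //; apply/hP.
Qed.

End Formulas.

(** * Matching the input *)

Definition isbit (c : sym) : bool := (c == B0) || (c == B1).
(** Admitting [Comma] lets one notion of field serve twice: read from the start of a bin it is the
    whole bin, read from the end of its name it is the comma with the pallet symbol. *)
Definition incell (c : sym) : bool := isbit c || (c == Comma).

Lemma enc_natE m : enc_nat m =
  if m < 2 then [:: bitsym (odd m)] else rcons (enc_nat m./2) (bitsym (odd m)).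
Proof.
have fuel f g k : k <= f -> k <= g -> bits_aux f k = bits_aux g k.
  elim: f g k => [|f IH] [|g] k //=; rewrite ?leqn0.
  - by move=> /eqP ->.
  - by move=> _ /eqP ->.
  - move=> kf kg; case: ltnP => // k2; congr rcons; apply: IH.
      by rewrite leq_half_double; lia.
    by rewrite leq_half_double; lia.
rewrite {1}/enc_nat; case: m => [|m] //=; case: ifP => // h.
by congr rcons; apply: fuel => //; have := half_double m.+1; lia.
Qed.

Definition dec_nat (s : seq sym) : nat := foldl (fun a c => a.*2 + (c == B1)) 0 s.

Lemma dec_rcons s c : dec_nat (rcons s c) = (dec_nat s).*2 + (c == B1).
Proof. by rewrite /dec_nat foldl_rcons. Qed.

Lemma enc_natK : cancel enc_nat dec_nat.
Proof.
move=> m; elim/ltn_ind: m => m IH; rewrite enc_natE.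
case: ltnP => [|m2]; first by case: m {IH} => [|[|]].
rewrite dec_rcons IH; last by lia.
by have := odd_double_half m; case: (odd m) => /=; lia.
Qed.

Lemma enc_nat_inj : injective enc_nat.
Proof. exact: can_inj enc_natK. Qed.

(** There are no leading zeros, so being a positive number is a regular property of a word; the
    parser checks pallet symbols and p in this way. *)
Lemma enc_nat_pos s :
  (exists2 m, 0 < m & s = enc_nat m) <-> (exists2 bs, all isbit bs & s = B1 :: bs).
Proof.
split.
  case=> m + ->; elim/ltn_ind: m => m IH m0; rewrite enc_natE.
  case: ltnP => m2; first by exists [::] => //; case: m m0 m2 {IH} => [|[|]].
  have [||bs h ->] := IH m./2; try lia.
  by exists (rcons bs (bitsym (odd m))); rewrite ?all_rcons ?h //; case: (odd m).
case=> bs + ->; elim/last_ind: bs => [|bs c IH]; first by exists 1.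
rewrite all_rcons => /andP[hc /IH[m m0 E]].
exists (m.*2 + (c == B1)); first by lia.
rewrite enc_natE; have -> : (m.*2 + (c == B1)) < 2 = false by lia.
have -> : (m.*2 + (c == B1))./2 = m by case: (c == B1); lia.
rewrite -E -rcons_cons; congr rcons.
by rewrite oddD odd_double; case: c hc.
Qed.

Lemma enc_nat_bits m : all isbit (enc_nat m).
Proof.
case: m => // m; have [h _] := enc_nat_pos (enc_nat m.+1).
by have [|bs h' ->] := h; first by exists m.+1.
Qed.

Lemma enc_nat_nil m : enc_nat m <> [::].
Proof. by rewrite enc_natE; case: ifP => // _; case: (enc_nat _). Qed.

Lemma enc_nat_lang s : (exists m, s = enc_nat m) <->
  s = [:: B0] \/ (exists2 bs, all isbit bs & s = B1 :: bs).
Proof.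
split.
  case=> [[|m]] ->; first by left.
  by right; apply/enc_nat_pos; exists m.+1.
by case=> [->|/enc_nat_pos[m _ ->]]; [exists 0|exists m].
Qed.

Definition fieldl (s : seq sym) := take (find (predC incell) s) s.

Definition cellopt (a : option sym) : bool := if a is Some c then incell c else false.

Lemma fieldl_cat s u : all incell s -> fieldl (s ++ u) = s ++ fieldl u.
Proof. by elim: s => //= c s IH /andP[hc /IH]; rewrite /fieldl /= hc /= => ->. Qed.

Lemma fieldl_nil u : ~~ cellopt (ohead u) -> fieldl u = [::].
Proof. by case: u => //= c u; rewrite /fieldl /= => ->. Qed.

Lemma fieldl_split u : exists t, [/\ u = fieldl u ++ t, all incell (fieldl u) & ~~ cellopt (ohead t)].
Proof.
elim: u => [|c u [t [E al h]]]; first by exists [::].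
rewrite /fieldl /=; case hc: (incell c) => /=.
  by exists t; split=> //=; [rewrite {1}E|rewrite hc].
by exists (c :: u); rewrite /= hc.
Qed.

(** How two fields part after a common prefix: the left one continues with a symbol not found on the
    right, or only the right one continues. Two symbols outside fields never count as different. *)
Definition differ (a b : option sym) : bool :=
  (cellopt a && (b != a)) || (~~ cellopt a && cellopt b).

Lemma fieldl_neq u1 u2 : (fieldl u1 != fieldl u2) <->
  exists s t1 t2, [/\ all incell s, u1 = s ++ t1, u2 = s ++ t2 & differ (ohead t1) (ohead t2)].
Proof.
split; last first.
  case=> s [t1 [t2 [al -> ->]]]; rewrite !fieldl_cat // eqseq_cat // eqxx /=.
  case/orP; last first.
    case/andP=> h1; rewrite (fieldl_nil h1).
    by case: t2 => //= c t2 hc; rewrite /fieldl /= hc.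
  case: t1 => // c t1 /= /andP[hc]; rewrite /fieldl /= hc /=.
  by case: t2 => //= c2 t2 h; case: ifP => //= _; rewrite eqseq_cons; case: (c =P c2) h => // ->; rewrite eqxx.
elim: u1 u2 => [|c1 u1 IH] [|c2 u2] //=.
- rewrite /fieldl /=; case h: (incell c2) => //= _.
  by exists [::], [::], (c2 :: u2); rewrite /differ /= h.
- rewrite /fieldl /=; case h: (incell c1) => //= _.
  by exists [::], (c1 :: u1), [::]; rewrite /differ /= h.
- case h1: (incell c1); last first.
    rewrite (@fieldl_nil (c1 :: u1)) /= ?h1 // /fieldl /=; case h: (incell c2) => //= _.
    by exists [::], (c1 :: u1), (c2 :: u2); rewrite /differ /= h1 h.
  case: (c2 =P c1) => [->|/eqP ne] ne'; last first.
    exists [::], (c1 :: u1), (c2 :: u2); split=> //; rewrite /differ /= h1 /=.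
    by apply/orP; left; apply: contra ne => /eqP[->].
  have [|s [t1 [t2 [al -> -> df]]]] := IH u2.
    by move: ne'; rewrite /fieldl /= h1 /= eqseq_cons eqxx.
  by exists (c1 :: s), t1, t2; rewrite /= h1.
Qed.

Lemma upd_pair v x y a b a' b' : x != y ->
  upd (upd (upd (upd v x a) y b) x a') y b' = upd (upd v x a') y b'.
Proof.
move=> xy; apply: functional_extensionality => z; rewrite /upd.
by case: (z =P y) => // _; case: (z =P x).
Qed.

(** * Programs that scan the input *)

Definition rchar (p : pred sym) x : rsym :=
  RSeq (RSym x (fun a => if a is Some c then p c else false)) (RInc _ x).
Definition rnatpos x : rsym := RSeq (rchar (pred1 B1) x) (RStar (rchar isbit x)).
Definition rnat x : rsym := RAlt (rchar (pred1 B0) x) (rnatpos x).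
Definition rbin x : rsym :=
  RSeq (rnat x) (RSeq (rchar (pred1 Comma) x) (RSeq (rnatpos x) (rchar (pred1 Semi) x))).
Definition rbins x : rsym := RSeq (RStar (rbin x)) (rchar (pred1 Bar) x).
Definition rbits x : rsym :=
  RSeq (RStar (rchar isbit x)) (RSym x (fun a => if a is Some c then ~~ isbit c else true)).

(** A predicate in [RSym] sees a single symbol, so two positions are compared by guessing the symbol
    among the three of [incell]. *)
Definition rboth x y c : rsym := RSeq (RSym x (pred1 (Some c))) (RSym y (pred1 (Some c))).
Definition rsame x y : rsym := RSeq (RAlt (rboth x y B0) (RAlt (rboth x y B1) (rboth x y Comma)))
  (RSeq (RInc _ x) (RInc _ y)).
Definition rdiff x y c : rsym := RSeq (RSym x (pred1 (Some c))) (RSym y (predC1 (Some c))).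
Definition rdiffer x y : rsym :=
  RAlt (RAlt (rdiff x y B0) (RAlt (rdiff x y B1) (rdiff x y Comma)))
       (RSeq (RSym x (predC cellopt)) (RSym y cellopt)).
(** Both programs walk along a guessed common prefix on copies of x and y. Equality is certified by
    both fields ending there, inequality by a point where they part. *)
Definition f_field d x y : form :=
  (RSeq (rcopy d x) (RSeq (rcopy d.+1 y) (RSeq (RStar (rsame d d.+1))
     (RSeq (RSym d (predC cellopt)) (RSym d.+1 (predC cellopt))))),
   RSeq (rcopy d x) (RSeq (rcopy d.+1 y) (RSeq (RStar (rsame d d.+1)) (rdiffer d d.+1)))).

Section Scan.
Variables (w : seq sym) (B : nat).
Hypothesis size_w : size w < B.
Notation sem := (rsem w B).
Notation n := (size w).
Notation symat := (symat w).

Definition subw i (s : seq sym) := exists u, drop i w = s ++ u.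
(** Treats a scanning program as an acceptor of a language, so that sequence, alternative and star
    of programs become the regular operations. *)
Definition consumes P x (K : seq sym -> Prop) := forall v v', sem P v v' <->
  exists s, [/\ K s, subw (v x) s & v' = upd v x (v x + size s)].

Lemma symat_drop i : symat i = ohead (drop i w).
Proof.
by rewrite /(symat _) /=; elim: (w) i => [|a s IH] [|i] //=; rewrite IH.
Qed.

Lemma subw_cat i s t : subw i (s ++ t) <-> subw i s /\ subw (i + size s) t.
Proof.
rewrite /subw; split.
  case=> u E; split; first by exists (t ++ u); rewrite catA.
  by exists u; rewrite addnC -drop_drop E -catA drop_size_cat.
case=> [[u E] [u']]; rewrite addnC -drop_drop E drop_size_cat // => ->.
by exists u'; rewrite catA.
Qed.

Lemma subw_nil i : subw i [::]. Proof. by exists (drop i w). Qed.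

Lemma subw_size i s : i <= n -> subw i s -> i + size s <= n.
Proof.
by move=> le [u] /(congr1 size); rewrite size_drop size_cat; lia.
Qed.

Lemma subw1 i c : subw i [:: c] <-> symat i = Some c.
Proof.
rewrite symat_drop /subw; split; first by case=> u ->.
by case: drop => //= a u [->]; exists u.
Qed.

Lemma symat_nth i s t : subw i s -> t < size s -> symat (i + t) = Some (nth B0 s t).
Proof.
move=> [u E] ts; rewrite symat_drop addnC -drop_drop E drop_cat ts.
by rewrite (drop_nth B0 ts).
Qed.

Lemma consumes_ext P x K K' : (forall s, K s <-> K' s) -> consumes P x K -> consumes P x K'.
Proof.
move=> e h v v'; rewrite h; split; case=> s [Ks sub ->]; exists s; split=> //; exact/e.
Qed.

Lemma consumes_char p x : consumes (rchar p x) x (fun s => exists2 c, p c & s = [:: c]).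
Proof.
move=> v v'; split.
  case=> v1 [le + ->] [lt ->]; rewrite -/(symat (v x)).
  case E: (symat (v x)) => [c|] // pc; exists [:: c]; split; first by exists c.
    exact/subw1.
  by rewrite addn1.
case=> s [[c pc ->] /subw1 E ->]; rewrite addn1.
have lt : v x < n by rewrite -symat_some E.
exists v; first by split; rewrite -?/(symat (v x)) ?E // ltnW.
by split=> //; apply: leq_ltn_trans size_w.
Qed.

Lemma consumes_seq P Q x K L : consumes P x K -> consumes Q x L ->
  consumes (RSeq P Q) x (fun s => exists s1 s2, [/\ K s1, L s2 & s = s1 ++ s2]).
Proof.
move=> hP hQ v v'; split.
  case=> _ /hP[s1 [K1 sub1 ->]] /hQ[s2 [L2 sub2 ->]].
  rewrite upd_same upd_upd in sub2 *; exists (s1 ++ s2); split.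
  - by exists s1, s2.
  - exact/subw_cat.
  - by rewrite size_cat addnA.
case=> _ [[s1 [s2 [K1 L2 ->]]] /subw_cat[sub1 sub2] ->].
exists (upd v x (v x + size s1)); first by apply/hP; exists s1.
by apply/hQ; exists s2; rewrite upd_same upd_upd size_cat addnA.
Qed.

Lemma consumes_alt P Q x K L : consumes P x K -> consumes Q x L ->
  consumes (RAlt P Q) x (fun s => K s \/ L s).
Proof.
move=> hP hQ v v'; split.
  by case=> [/hP|/hQ] [s [h sub ->]]; exists s; split=> //; [left|right].
by case=> s [[h|h] sub ->]; [left; apply/hP|right; apply/hQ]; exists s.
Qed.

Lemma consumes_star P x K : consumes P x K ->
  consumes (RStar P) x (fun s => exists2 ss, {in ss, forall s, K s} & s = flatten ss).
Proof.
move=> hP v v'; split.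
  move=> H; elim/clos_refl_trans_ind_left: v' / H.
    by exists [::]; split; [exists [::]|apply: subw_nil|rewrite addn0 upd_id].
  move=> _ z _ [_ [[ss Kss ->] sub ->]] /hP[s [Ks sub' ->]].
  rewrite upd_same upd_upd in sub' *; exists (flatten ss ++ s); split.
  - exists (rcons ss s); last by rewrite flatten_rcons.
    by move=> t; rewrite mem_rcons inE => /orP[/eqP ->|/Kss].
  - exact/subw_cat.
  - by rewrite size_cat addnA.
case=> _ [[ss Kss ->] + ->]; elim: ss v Kss => [|s ss IH] v Kss /=.
  by rewrite addn0 upd_id => _; apply: rt_refl.
case/subw_cat=> sub1 sub2; apply: rt_trans (_ : star _ _ (upd v x (v x + size s)) _).
  by apply: rt_step; apply/hP; exists s; split=> //; apply: Kss; rewrite mem_head.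
have := IH (upd v x (v x + size s)); rewrite upd_same upd_upd size_cat addnA; apply=> //.
by move=> t tss; apply: Kss; rewrite inE tss orbT.
Qed.

Lemma consumes_char1 c x : consumes (rchar (pred1 c) x) x (fun s => s = [:: c]).
Proof.
apply: consumes_ext (consumes_char _ _) => s.
by split=> [[c' /eqP -> ->]|->] //; exists c => /=.
Qed.

Lemma consumes_starchar p x : consumes (RStar (rchar p x)) x (all p).
Proof.
apply: consumes_ext (consumes_star (consumes_char _ _)) => s; split.
  case=> ss + ->; elim: ss => //= t ss IH h; rewrite all_cat IH ?andbT.
    by have [|c pc ->] := h t; rewrite ?mem_head //= pc.
  by move=> u uss; apply: h; rewrite inE uss orbT.
move=> al; exists [seq [:: c] | c <- s]; last by rewrite flatten_seq1.
by move=> _ /mapP[c /(allP al) pc ->]; exists c.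
Qed.

Lemma consumes_natpos x : consumes (rnatpos x) x (fun s => exists2 m, 0 < m & s = enc_nat m).
Proof.
apply: consumes_ext (consumes_seq (consumes_char1 _ _) (consumes_starchar _ _)) => s.
rewrite enc_nat_pos; split; first by case=> _ [bs [-> al ->]]; exists bs.
by case=> bs al ->; exists [:: B1], bs.
Qed.

Lemma consumes_nat x : consumes (rnat x) x (fun s => exists m, s = enc_nat m).
Proof.
apply: consumes_ext (consumes_alt (consumes_char1 _ _) (consumes_natpos _)) => s.
by rewrite enc_nat_lang enc_nat_pos.
Qed.

Lemma consumes_bin x :
  consumes (rbin x) x (fun s => exists2 b, 0 < plt b & s = rcons (enc_bin b) Semi).
Proof.
apply: consumes_ext (consumes_seq (consumes_nat _) (consumes_seq (consumes_char1 _ _)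
   (consumes_seq (consumes_natpos _) (consumes_char1 _ _)))) => s; split.
  case=> _ [_ [[a ->] [_ [_ [-> [_ [_ [[m m0 ->] -> ->]] ->]]] ->]]].
  by exists (a, m) => //; rewrite /enc_bin /= rcons_cat /= cats1.
case=> -[a m] /= m0 ->; exists (enc_nat a), (Comma :: rcons (enc_nat m) Semi).
split; [by exists a| |by rewrite /enc_bin /= rcons_cat].
exists [:: Comma], (rcons (enc_nat m) Semi); split=> //.
exists (enc_nat m), [:: Semi]; split=> //; [by exists m|by rewrite cats1].
Qed.

Lemma consumes_bins x : consumes (rbins x) x
  (fun s => exists2 q, all (fun b => 0 < plt b) q & s = rcons (enc_seq q) Bar).
Proof.
apply: consumes_ext (consumes_seq (consumes_star (consumes_bin _)) (consumes_char1 _ _)) => s; split.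
  case=> _ [_ [[ss h ->] -> ->]]; rewrite cats1.
  elim: ss h => [|t ss IH] h; first by exists [::].
  have [|b b0 E] := h t; first by rewrite mem_head.
  have [|q al /rcons_inj [E']] := IH; first by move=> u uss; apply: h; rewrite inE uss orbT.
  by exists (b :: q); rewrite /= ?b0 // /enc_seq /= -/(enc_seq q) -E' E.
case=> q al ->; exists (enc_seq q), [:: Bar]; rewrite cats1; split=> //.
exists [seq rcons (enc_bin b) Semi | b <- q] => //.
by move=> _ /mapP[b /(allP al) b0 ->]; exists b.
Qed.

Definition endbits i := i + find (predC isbit) (drop i w).

Lemma endbits_le i : i <= n -> endbits i <= n.
Proof.
by move=> le; rewrite /endbits -[leqRHS](subnKC le) leq_add2l -size_drop find_size.
Qed.

Lemma endbits_sub i s : subw i s -> all isbit s ->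
  (if symat (i + size s) is Some c then ~~ isbit c else true) -> endbits i = i + size s.
Proof.
case=> u E al h; rewrite /endbits E find_cat has_predC al /=; congr addn.
have : ohead u = symat (i + size s).
  by rewrite symat_drop addnC -drop_drop E drop_size_cat.
by case: u {E} => [|c u] /= e; rewrite ?addn0 //; move: h; rewrite -e => ->; rewrite addn0.
Qed.

(** The star may stop early, but the test after it rejects a following bit, which makes the result
    unique. *)
Lemma rbitsP x v v' : v x <= n -> sem (rbits x) v v' <-> v' = upd v x (endbits (v x)).
Proof.
move=> le; split.
  case=> _ /consumes_starchar[s [al sub ->]] [_ + ->]; rewrite upd_same => h.
  by rewrite (endbits_sub sub al).
move=> ->; exists (upd v x (endbits (v x))).
  apply/consumes_starchar; exists (take (find (predC isbit) (drop (v x) w)) (drop (v x) w)).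
  have lef := find_size (predC isbit) (drop (v x) w).
  split; last by rewrite size_takel.
    rewrite -[all _ _]negbK -has_predC has_take_leq // -leqNgt.
    exact: leqnn.
  by exists (drop (find (predC isbit) (drop (v x) w)) (drop (v x) w)); rewrite cat_take_drop.
split=> //; rewrite upd_same; first exact: endbits_le.
rewrite -/(symat (endbits (v x))) symat_drop /endbits addnC -drop_drop.
elim: (drop (v x) w) => //= c s IH; case hc: (isbit c) => //=.
by rewrite hc.
Qed.

Definition field i := fieldl (drop i w).

Lemma rsameP x y v v' : x != y -> v x <= n -> v y <= n -> sem (rsame x y) v v' <->
  exists c, [/\ incell c, symat (v x) = Some c, symat (v y) = Some c &
    v' = upd (upd v x (v x).+1) y (v y).+1].
Proof.
move=> xy lex ley; split.
  have H c : incell c -> sem (RSeq (rboth x y c) (RSeq (RInc _ x) (RInc _ y))) v v' ->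
      exists c, [/\ incell c, symat (v x) = Some c, symat (v y) = Some c &
    v' = upd (upd v x (v x).+1) y (v y).+1].
    move=> ic [v1 [v2 [_ /eqP e1 ->] [_ /eqP e2 ->]]] [v3 [_ ->] [_ ->]].
    by exists c; split=> //; rewrite upd_other // eq_sym.
  by case=> v1 [h|[h|h]] h'; [apply: (H B0)|apply: (H B1)|apply: (H Comma)] => //; exists v1.
case=> c [ic e1 e2 ->].
have lx : v x < n by rewrite -symat_some e1.
have ly : v y < n by rewrite -symat_some e2.
exists v; last first.
  exists (upd v x (v x).+1); first by split=> //; apply: leq_ltn_trans size_w.
  by rewrite /= upd_other 1?eq_sym //; split=> //; apply: leq_ltn_trans size_w.
have h : sem (rboth x y c) v v.
  by exists v; split=> //; rewrite -/(symat _) ?e1 ?e2 /= eqxx.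
by case: c ic e1 e2 h => // _ _ _ h; [left|right; left|right; right].
Qed.

Lemma rsame_star x y v v' : x != y -> v x <= n -> v y <= n ->
  sem (RStar (rsame x y)) v v' <->
  exists s, [/\ all incell s, subw (v x) s, subw (v y) s &
    v' = upd (upd v x (v x + size s)) y (v y + size s)].
Proof.
move=> xy lex ley; split.
  move=> H; elim/clos_refl_trans_ind_left: v' / H.
    exists [::]; split=> //; [exact: subw_nil|exact: subw_nil|].
    by rewrite !addn0 upd_id upd_id.
  move=> _ z _ [s [al sx sy ->]] /rsameP[] //.
  - by rewrite upd_other // upd_same subw_size.
  - by rewrite upd_same subw_size.
  move=> c; rewrite upd_other // !upd_same => -[ic /subw1 e1 /subw1 e2 ->].
  exists (rcons s c); split.
  - by rewrite all_rcons ic.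
  - by rewrite -cats1; apply/subw_cat.
  - by rewrite -cats1; apply/subw_cat.
  - by rewrite size_rcons !addnS upd_pair.
case=> s [+ + + ->]; elim: s v lex ley => [|c s IH] v lex ley /=.
  by rewrite !addn0 !upd_id => _ _ _; apply: rt_refl.
case/andP=> ic al; rewrite -cat1s => /subw_cat[/subw1 e1 sx] /subw_cat[/subw1 e2 sy].
apply: rt_trans (_ : star _ _ (upd (upd v x (v x).+1) y (v y).+1) _).
  by apply: rt_step; apply/rsameP => //; exists c.
have lx : v x < n by rewrite -symat_some e1.
have ly : v y < n by rewrite -symat_some e2.
have := IH (upd (upd v x (v x).+1) y (v y).+1).
rewrite /= !addn1 in sx sy.
rewrite upd_other // !upd_same; move/(_ lx ly al sx sy).
by rewrite upd_pair // !addSnnS.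
Qed.

Lemma decides_field d x y : x < d -> y < d ->
  decides w B d (f_field d x y) (fun v => field (v x) == field (v y)).
Proof.
move=> xd yd; have dd : d != d.+1 by rewrite neq_ltn leqnn.
have dx : d != x by rewrite neq_ltn xd orbT.
have dy : d.+1 != y by rewrite neq_ltn (leqW yd) orbT.
(* The part common to the two programs, with their final tests abstracted to P. *)
have prep (P : rsym) v v' : small w d v ->
  sem (RSeq (rcopy d x) (RSeq (rcopy d.+1 y) (RSeq (RStar (rsame d d.+1)) P))) v v' <->
  exists s, [/\ all incell s, subw (v x) s, subw (v y) s &
    sem P (upd (upd v d (v x + size s)) d.+1 (v y + size s)) v'].
  move=> sv; have vx := sv _ xd; have vy := sv _ yd.
  split.
    case=> _ /(rcopyP size_w _ dx vx) -> [v1].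
    have hy : upd v d (v x) y <= n by rewrite upd_lt.
    move/(rcopyP size_w _ dy hy) => ->; rewrite upd_lt // => -[v2].
    have h1 : upd (upd v d (v x)) d.+1 (v y) d <= n by rewrite upd_lt // upd_same.
    have h2 : upd (upd v d (v x)) d.+1 (v y) d.+1 <= n by rewrite upd_same.
    case/(rsame_star _ dd h1 h2)=> s; rewrite upd_lt // !upd_same => -[al sx sy ->] sP.
    exists s; split=> //; move: sP.
    by rewrite upd_pair.
  case=> s [al sx sy sP]; exists (upd v d (v x)); first exact/(rcopyP size_w _ dx vx).
  exists (upd (upd v d (v x)) d.+1 (v y)).
    by apply/(rcopyP size_w _ dy); rewrite upd_lt.
  exists (upd (upd v d (v x + size s)) d.+1 (v y + size s)) => //.
  have h1 : upd (upd v d (v x)) d.+1 (v y) d <= n by rewrite upd_lt // upd_same.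
  have h2 : upd (upd v d (v x)) d.+1 (v y) d.+1 <= n by rewrite upd_same.
  apply/(rsame_star _ dd h1 h2).
  exists s; rewrite upd_lt // !upd_same; split=> //.
  by rewrite upd_pair.
have next i s : subw i s -> exists2 u, drop i w = s ++ u & symat (i + size s) = ohead u.
  by case=> u E; exists u => //; rewrite symat_drop addnC -drop_drop E drop_size_cat.
have ag v a b : agree d v (upd (upd v d a) d.+1 b).
  by apply: agree_trans (agree_upd _ _ (leqnn d)) (agree_upd _ _ (leqnSn d)).
split; first by move=> v v' e; rewrite !e.
- move=> v sv; split.
    move=> v' /(prep _ _ _ sv)[s [al sx sy]].
    have [u1 E1 e1] := next _ _ sx; have [u2 E2 e2] := next _ _ sy.
    case=> _ [_ + ->] [_ + ->].
    rewrite upd_lt // !upd_same -!/(symat _) e1 e2 => /= h1 h2; split=> //.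
    by rewrite /field E1 E2 !fieldl_cat // !fieldl_nil.
  move/eqP=> E; have [t1 [E1 al h1]] := fieldl_split (drop (v x) w).
  have [t2 [E2 _ h2]] := fieldl_split (drop (v y) w).
  rewrite -/(field _) in E1 al; rewrite -/(field _) -E in E2.
  have sx : subw (v x) (field (v x)) by exists t1.
  have sy : subw (v y) (field (v x)) by exists t2.
  have lx := subw_size (sv _ xd) sx; have ly := subw_size (sv _ yd) sy.
  eexists; apply/(prep _ _ _ sv); exists (field (v x)); split=> //.
  have [u1 E1' e1] := next _ _ sx; have [u2 E2' e2] := next _ _ sy.
  have {E1'} ? : u1 = t1 by move: E1'; rewrite {1}E1 => /eqP; rewrite eqseq_cat // => /andP[_ /eqP].
  have {E2'} ? : u2 = t2 by move: E2'; rewrite {1}E2 => /eqP; rewrite eqseq_cat // => /andP[_ /eqP].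
  subst; set v1 := upd _ _ _.
  have v1x : symat (v1 d) = ohead t1 by rewrite /v1 upd_lt // upd_same.
  have v1y : symat (v1 d.+1) = ohead t2 by rewrite /v1 upd_same.
  have lx' : v1 d <= n by rewrite /v1 upd_lt // upd_same.
  have ly' : v1 d.+1 <= n by rewrite /v1 upd_same.
  exists v1; first by split; rewrite -/(symat (v1 d)) ?v1x.
  by split; rewrite -/(symat (v1 d.+1)) ?v1y.
- move=> v sv; split.
    move=> v' /(prep _ _ _ sv)[s [al sx sy h]].
    have [u1 E1 e1] := next _ _ sx; have [u2 E2 e2] := next _ _ sy.
    set v1 := upd _ _ _ in h.
    have v1x : symat (v1 d) = ohead u1 by rewrite /v1 upd_lt // upd_same.
    have v1y : symat (v1 d.+1) = ohead u2 by rewrite /v1 upd_same.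
    have [df ->] : differ (ohead u1) (ohead u2) /\ v' = v1.
      rewrite -v1x -v1y /differ; case: h => [[|[|]]|]; case=> _ [_ + ->] [_ + ->];
        rewrite -!/(symat _) => /= h1 h2; split=> //.
      - by rewrite (eqP h1) h2.
      - by rewrite (eqP h1) h2.
      - by rewrite (eqP h1) h2.
      - by rewrite h1 h2 orbT.
    split; last exact: ag.
    by apply/fieldl_neq; exists s, u1, u2.
  case/fieldl_neq=> [s [t1 [t2 [al E1 E2 df]]]].
  have sx : subw (v x) s by exists t1.
  have sy : subw (v y) s by exists t2.
  have lx := subw_size (sv _ xd) sx; have ly := subw_size (sv _ yd) sy.
  eexists; apply/(prep _ _ _ sv); exists s; split=> //.
  have [u1 E1' e1] := next _ _ sx; have [u2 E2' e2] := next _ _ sy.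
  have {E1'} ? : u1 = t1 by move: E1'; rewrite {1}E1 => /eqP; rewrite eqseq_cat // => /andP[_ /eqP].
  have {E2'} ? : u2 = t2 by move: E2'; rewrite {1}E2 => /eqP; rewrite eqseq_cat // => /andP[_ /eqP].
  subst; set v1 := upd _ _ _.
  have v1x : symat (v1 d) = ohead t1 by rewrite /v1 upd_lt // upd_same.
  have v1y : symat (v1 d.+1) = ohead t2 by rewrite /v1 upd_same.
  have lx' : v1 d <= n by rewrite /v1 upd_lt // upd_same.
  have ly' : v1 d.+1 <= n by rewrite /v1 upd_same.
  move: df; rewrite -v1x -v1y /differ => /orP[]/andP[h1 h2]; last first.
    by right; exists v1; split.
  left; case E: (symat (v1 d)) h1 => [c|] //= ic.
  have rd : sem (rdiff d d.+1 c) v1 v1.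
    exists v1; first by split=> //; rewrite -/(symat (v1 d)) E /= eqxx.
    by split=> //; rewrite -/(symat (v1 d.+1)); rewrite E in h2.
  by case: c ic {E h2} rd => // _ h; [left|right; left|right; right].
Qed.

End Scan.

(** * Positions in the encoding of an instance *)

Definition bitopt (a : option sym) : bool := if a is Some c then isbit c else false.
Definition sepopt (a : option sym) : bool := if a is Some c then (c == Semi) || (c == Bar) else false.

Definition enc_seqs (Q : seq (seq bin)) : seq sym :=
  flatten [seq rcons (enc_seq q) Bar | q <- Q].

Notation row Q j := (nth [::] Q j).
Notation nobin := (0, 0).

Definition bin_at (Q : seq (seq bin)) (x : nat * nat) : bin := nth nobin (row Q x.1) x.2.
Definition indices (Q : seq (seq bin)) : seq (nat * nat) :=
  [seq (j, i) | j <- iota 0 (size Q), i <- iota 0 (size (row Q j))].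
(** Used beyond the bins as well: for i = |q_j| it is the [Bar] that closes sequence j, and
    [pos Q k 0], with k the number of sequences, is the start of p. *)
Definition pos (Q : seq (seq bin)) (j i : nat) : nat :=
  size (enc_seqs (take j Q)) + size (enc_seq (take i (row Q j))).

Lemma mem_indices Q x : (x \in indices Q) = (x.1 < size Q) && (x.2 < size (row Q x.1)).
Proof.
apply/allpairsPdep/idP => [[j [i [+ + ->]]]|/andP[h1 h2]]; first by rewrite !mem_iota /= => -> ->.
by exists x.1, x.2; rewrite !mem_iota h1 h2; split=> //; case: (x).
Qed.

Lemma uniq_indices Q : uniq (indices Q).
Proof.
apply: allpairs_uniq_dep => [|j _|[j i] [j' i'] _ _ /= [-> ->]//]; exact: iota_uniq.
Qed.

Lemma flatten_indices Q : flatten Q = [seq bin_at Q x | x <- indices Q].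
Proof.
rewrite /indices map_flatten -map_comp -[in LHS](mkseq_nth [::] Q) /mkseq.
congr flatten; apply: eq_map => j /=; rewrite -map_comp.
by rewrite -[LHS](mkseq_nth nobin).
Qed.

Lemma enc_seqs_cat Q1 Q2 : enc_seqs (Q1 ++ Q2) = enc_seqs Q1 ++ enc_seqs Q2.
Proof. by rewrite /enc_seqs map_cat flatten_cat. Qed.

Lemma enc_seq_cat q1 q2 : enc_seq (q1 ++ q2) = enc_seq q1 ++ enc_seq q2.
Proof. by rewrite /enc_seq map_cat flatten_cat. Qed.

Lemma enc_instE Q p : enc_inst Q p = enc_seqs Q ++ enc_nat p. Proof. by []. Qed.

Lemma bitopt_head m u : bitopt (ohead (enc_nat m ++ u)).
Proof.
by have := enc_nat_bits m; case: (enc_nat m) (@enc_nat_nil m) => // c s _ /andP[].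
Qed.

Lemma enc_bin_incell b : all incell (enc_bin b).
Proof.
rewrite /enc_bin all_cat /=.
have h m : all incell (enc_nat m) by apply: sub_all (enc_nat_bits m) => c; rewrite /incell => ->.
by rewrite h /= h.
Qed.

Lemma enc_bin_inj : injective enc_bin.
Proof.
move=> [a m] [a' m']; rewrite /enc_bin /= => E.
have e : size (enc_nat a) = size (enc_nat a').
  have h b u : find (predC isbit) (enc_nat b ++ Comma :: u) = size (enc_nat b).
    by rewrite find_cat has_predC enc_nat_bits /= addn0.
  by rewrite -(h a (enc_nat m)) E h.
move/eqP: E; rewrite eqseq_cat // => /andP[/eqP /enc_nat_inj -> /eqP [/enc_nat_inj ->]].
by [].
Qed.

(** Discrete intermediate values, used to locate the sequence that contains a position and then the
    bin within it. *)
Lemma interval_step (f : nat -> nat) m y : f 0 <= y < f m ->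
  exists2 i, i < m & f i <= y < f i.+1.
Proof.
elim: m => [|m IH]; first by lia.
case/andP=> h0 hm; case: (ltnP y (f m)) => [lt|ge].
  by have [|i im h] := IH; [rewrite h0|exists i => //; apply: leqW].
by exists m; rewrite ?ge.
Qed.

(** Starts of bins are recognised from two adjacent symbols. The bound s, the start of p, is there
    because p passes the symbol tests too. *)
Definition isstart (w : seq sym) (s y : nat) : bool :=
  [&& bitopt (symat w y), (y == 0) || sepopt (symat w y.-1) & y < s].

Section Positions.
Variables (Q : seq (seq bin)) (p : nat).
Notation w := (enc_inst Q p).
Notation k := (size Q).
Notation q j := (row Q j).
Notation pos := (pos Q).
Notation subw := (subw w).
Notation symat := (symat w).

Lemma drop_pos j i : j < k -> drop (pos j i) w =
  enc_seq (drop i (q j)) ++ Bar :: enc_seqs (drop j.+1 Q) ++ enc_nat p.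
Proof.
move=> jk.
have -> : w = enc_seqs (take j Q) ++ enc_seq (take i (q j)) ++
    enc_seq (drop i (q j)) ++ Bar :: enc_seqs (drop j.+1 Q) ++ enc_nat p.
  rewrite enc_instE -{1}(cat_take_drop j Q) enc_seqs_cat (drop_nth [::] jk) -catA; congr cat.
  rewrite -[in enc_seq (take i _) ++ _](cat1s Bar) !catA; congr cat.
  by rewrite /enc_seqs /= -enc_seq_cat cat_take_drop cats1.
by rewrite catA drop_size_cat // size_cat.
Qed.

Lemma pos_end : pos k 0 = size (enc_seqs Q).
Proof. by rewrite /pos take0 take_size addn0. Qed.

Lemma pos0 j : pos j 0 = size (enc_seqs (take j Q)).
Proof. by rewrite /pos take0 addn0. Qed.

Lemma subw_bin j i : j < k -> i < size (q j) ->
  subw (pos j i) (rcons (enc_bin (bin_at Q (j, i))) Semi).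
Proof.
move=> jk iq; rewrite /(subw _ _) drop_pos // (drop_nth nobin iq) /enc_seq /= -catA.
by eexists.
Qed.

Lemma posS j i : j < k -> i < size (q j) ->
  pos j i.+1 = pos j i + size (rcons (enc_bin (bin_at Q (j, i))) Semi).
Proof.
move=> jk iq; rewrite /pos (take_nth nobin iq) -cats1 enc_seq_cat size_cat addnA.
by rewrite /enc_seq /= cats0.
Qed.

Lemma symat_bar j : j < k -> symat (pos j (size (q j))) = Some Bar.
Proof. by move=> jk; rewrite symat_drop drop_pos // drop_size. Qed.

Lemma pos_next j : j < k -> pos j.+1 0 = (pos j (size (q j))).+1.
Proof.
move=> jk; rewrite pos0 /pos (take_nth [::] jk) -cats1 enc_seqs_cat size_cat.
by rewrite /enc_seqs /= cats0 size_rcons take_size addnS.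
Qed.

Lemma pos_ltS j i : j < k -> i < size (q j) -> pos j i < pos j i.+1.
Proof. by move=> jk iq; rewrite posS // size_rcons addnS ltnS leq_addr. Qed.

Lemma pos_lt j i i' : j < k -> i' <= size (q j) -> (pos j i < pos j i') = (i < i').
Proof.
move=> jk.
have lt a b : b <= size (q j) -> a < b -> pos j a < pos j b.
  elim: b => // b IH bq; rewrite ltnS leq_eqVlt => /orP[/eqP ->|ab]; first exact: pos_ltS.
  by apply: ltn_trans (IH (ltnW bq) ab) _; apply: pos_ltS.
move=> le'; case: (ltnP i i') => [h|h]; first exact: lt.
case: (ltnP i (size (q j))) => [hi|hi].
  apply/negbTE; rewrite -leqNgt; move: h; rewrite leq_eqVlt => /orP[/eqP -> //|h].
  by apply: ltnW; apply: lt => //; apply: ltnW.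
apply/negbTE; rewrite -leqNgt.
have -> : pos j i = pos j (size (q j)) by rewrite /pos [take i _]take_oversize // take_size.
move: le'; rewrite leq_eqVlt => /orP[/eqP -> //|h']; by apply: ltnW; apply: lt.
Qed.

Lemma pos_le_next j i : j < k -> pos j i < pos j.+1 0.
Proof.
move=> jk; rewrite pos_next // ltnS /pos leq_add2l take_size.
by rewrite -{2}(cat_take_drop i (q j)) enc_seq_cat size_cat leq_addr.
Qed.

Lemma pos0_le j j' : j <= j' <= k -> pos j 0 <= pos j' 0.
Proof.
case/andP; elim: j' => [|j' IH]; first by rewrite leqn0 => /eqP ->.
rewrite leq_eqVlt => /orP[/eqP -> //|jj'] j'k.
by apply: leq_trans (IH jj' (ltnW j'k)) _; apply: ltnW; apply: pos_le_next.
Qed.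

Lemma pos_ge0 j i : pos j 0 <= pos j i.
Proof. by rewrite pos0 leq_addr. Qed.

Lemma pos_row j j' i : j < k -> j' < k -> (pos j' 0 <= pos j i < pos j'.+1 0) = (j == j').
Proof.
move=> jk jk'; case: (ltngtP j j') => [lt|gt|->]; last by rewrite pos_ge0 pos_le_next.
  have h1 := pos_le_next i jk; have := @pos0_le j.+1 j'; rewrite lt (ltnW jk') => /(_ isT).
  by lia.
have h1 := pos_ge0 j i; have := @pos0_le j'.+1 j; rewrite gt (ltnW jk) => /(_ isT).
by lia.
Qed.

Lemma pos_size j i : j <= k -> pos j i <= size w.
Proof.
rewrite leq_eqVlt => /orP[/eqP ->|jk].
  by rewrite /pos nth_default // take_size addn0 enc_instE size_cat leq_addr.
apply: ltnW; apply: leq_trans (pos_le_next i jk) _.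
apply: leq_trans (@pos0_le j.+1 k _) _; first by rewrite jk leqnn.
by rewrite pos_end enc_instE size_cat leq_addr.
Qed.

Lemma pos_lt_end j i : j < k -> pos j i < pos k 0.
Proof.
move=> jk; apply: leq_trans (pos_le_next i jk) _.
by apply: pos0_le; rewrite jk leqnn.
Qed.

Lemma pos_lt_size j i : j < k -> pos j i < size w.
Proof. by move=> jk; apply: leq_trans (pos_lt_end i jk) (pos_size 0 (leqnn k)). Qed.

Lemma pos_inj : {in indices Q &, injective (fun x => pos x.1 x.2)}.
Proof.
move=> [j i] [j' i']; rewrite !mem_indices /= => /andP[jk iq] /andP[jk' iq'] e.
have jj : j = j'.
  apply/eqP; rewrite -(pos_row i jk jk') e pos_ge0 /=; exact: pos_le_next.
subst j'; congr pair; apply/eqP.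
have := pos_lt i jk (ltnW iq'); have := pos_lt i' jk (ltnW iq).
by rewrite e ltnn eqn_leq ![i <= _]leqNgt ![i' <= _]leqNgt => <- <-.
Qed.

Lemma isstart_pos x : x \in indices Q -> isstart w (pos k 0) (pos x.1 x.2).
Proof.
case: x => j i; rewrite mem_indices /= => /andP[jk iq].
apply/and3P; split; last exact: pos_lt_end.
  rewrite symat_drop drop_pos // (drop_nth nobin iq) /enc_seq /= -cats1 /enc_bin -!catA.
  exact: bitopt_head.
case: i iq => [|i] iq.
  case: j jk {iq} => [|j] jk; first by rewrite pos0 take0.
  by rewrite pos_next ?(ltnW jk) //= symat_bar ?orbT // ltnW.
apply/orP; right; rewrite posS // 1?ltnW // size_rcons addnS /=.
have h := subw_bin jk (ltnW iq).
rewrite (symat_nth h) ?size_rcons // nth_rcons ltnn eqxx //.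
Qed.

(** A position after the first of an encoded bin, its [Semi] included, is preceded by a symbol of
    [incell] and not by a separator; the only other positions before p carry a [Bar], which is no
    bit. *)
Lemma isstartP y : isstart w (pos k 0) y -> exists2 x, x \in indices Q & y = pos x.1 x.2.
Proof.
case/and3P=> hb hs lt.
have [|j jk h] := @interval_step (fun j => pos j 0) k y; first by rewrite lt pos0 take0.
have [e|yb] := eqVneq y (pos j (size (q j))).
  by move: hb; rewrite e symat_bar.
have [|i iq /andP[h1 h2]] := @interval_step (pos j) (size (q j)) y.
  by case/andP: h => -> /=; rewrite pos_next // ltnS leq_eqVlt (negbTE yb).
exists (j, i); first by rewrite mem_indices /= jk.
move: h1; rewrite leq_eqVlt => /orP[/eqP -> //|gt].
have y0 : y != 0 by rewrite -lt0n (leq_ltn_trans _ gt).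
move: hs; rewrite (negbTE y0) /=.
have sb := subw_bin jk iq.
have [t tb yt] : exists2 t, t < size (enc_bin (bin_at Q (j, i))) & y.-1 = pos j i + t.
  exists (y.-1 - pos j i); last by lia.
  by move: h2; rewrite posS // size_rcons; lia.
rewrite yt (symat_nth sb) ?size_rcons ?ltnS 1?ltnW // nth_rcons tb /=.
have := allP (enc_bin_incell (bin_at Q (j, i))) _ (mem_nth B0 tb).
by case: nth.
Qed.

Lemma field_pos j i : j < k -> i < size (q j) ->
  field w (pos j i) = enc_bin (bin_at Q (j, i)).
Proof.
move=> jk iq; have [u E] := subw_bin jk iq.
by rewrite /field E -cats1 -catA fieldl_cat ?enc_bin_incell //= cats0.
Qed.

Lemma endbits_pos j i : j < k -> i < size (q j) ->
  endbits w (pos j i) = pos j i + size (enc_nat (bin_at Q (j, i)).1).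
Proof.
move=> jk iq; have [u E] := subw_bin jk iq.
rewrite /endbits E -cats1 -catA /enc_bin -catA find_cat has_predC enc_nat_bits /=.
by rewrite addn0.
Qed.

Lemma field_plt j i : j < k -> i < size (q j) ->
  field w (endbits w (pos j i)) = Comma :: enc_nat (plt (bin_at Q (j, i))).
Proof.
move=> jk iq; rewrite endbits_pos //; have [u E] := subw_bin jk iq.
rewrite /field addnC -drop_drop E -cats1 -catA /enc_bin -catA drop_size_cat //.
rewrite [in X in fieldl X]/= -cat_cons.
rewrite fieldl_cat ?cats0 //=.
by apply: sub_all (enc_nat_bits _) => c; rewrite /incell => ->.
Qed.

Lemma eq_field_plt x y : x \in indices Q -> y \in indices Q ->
  (field w (endbits w (pos x.1 x.2)) == field w (endbits w (pos y.1 y.2))) =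
  (plt (bin_at Q x) == plt (bin_at Q y)).
Proof.
case: x y => [j i] [j' i']; rewrite !mem_indices => /andP[/= jk iq] /andP[/= jk' iq'].
by rewrite !field_plt // eqseq_cons eqxx /= (inj_eq enc_nat_inj).
Qed.

Lemma eq_field_bin x y : x \in indices Q -> y \in indices Q ->
  (field w (pos x.1 x.2) == field w (pos y.1 y.2)) = (bin_at Q x == bin_at Q y).
Proof.
case: x y => [j i] [j' i']; rewrite !mem_indices => /andP[/= jk iq] /andP[/= jk' iq'].
by rewrite !field_pos // (inj_eq enc_bin_inj).
Qed.

(** Carries a search over input positions over to a search over the bins of Q. *)
Lemma has_start (P : pred nat) :
  has (fun a => isstart w (pos k 0) a && P a) (iota 0 (size w)) =
  has (fun x => P (pos x.1 x.2)) (indices Q).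
Proof.
apply/hasP/hasP => [[a _ /andP[/isstartP[x xI ->] h]]|[x xI h]]; first by exists x.
exists (pos x.1 x.2); last by rewrite isstart_pos.
by rewrite mem_iota /=; apply: pos_lt_size; move: xI; rewrite mem_indices => /andP[].
Qed.

End Positions.

(** * Open pallets along a processing *)

Lemma count_gt1 (T : eqType) (s : seq T) (a : pred T) x : uniq s -> x \in s -> a x ->
  (1 < count a s) = has (fun y => (x != y) && a y) s.
Proof.
move=> us xs ax; have /permP -> := perm_to_rem xs.
rewrite /= ax add1n ltnS -has_count rem_filter // has_filter -filter_predI -has_filter.
by apply: eq_has => y /=; rewrite andbC eq_sym.
Qed.

(** Two predicates that differ at most at t have counts that differ as their values at t do; sums on
    both sides avoid truncated subtraction. *)
Lemma count_change (T : eqType) (s : seq T) (a b : pred T) t : uniq s -> t \in s ->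
  {in s, forall u, u != t -> a u = b u} -> count b s + a t = count a s + b t.
Proof.
move=> us ts e; have /permP pe := perm_to_rem ts; rewrite !pe /=.
have -> : count a (rem t s) = count b (rem t s).
  apply: eq_in_count => u; rewrite rem_filter // mem_filter => /andP[ut us'].
  exact: e.
by lia.
Qed.

Definition removed_before (k : nat) (s e : nat -> nat) (a : nat) : bool :=
  has (fun j => (s j <= a) && (a < e j)) (iota 0 k).

(** No bin has a duplicate or lacks a partner for its pallet. Asking for a second position replaces
    the count of [valid_instance]; positivity of pallet symbols is left to the parser. *)
Definition valid_at (w : seq sym) (s : nat) : bool :=
  ~~ has (fun a => isstart w s a &&
     (has (fun b => isstart w s b && ((a != b) && (field w a == field w b))) (iota 0 (size w)) ||
   ~~ has (fun b => isstart w s b &&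
        ((a != b) && (field w (endbits w b) == field w (endbits w a)))) (iota 0 (size w))))
   (iota 0 (size w)).

Section Combinatorics.
Variable Q : seq (seq bin).
Notation k := (size Q).
Notation I := (indices Q).
Notation q j := (row Q j).

Lemma uniq_bins : uniq (flatten Q) =
  ~~ has (fun x => has (fun y => (x != y) && (bin_at Q x == bin_at Q y)) I) I.
Proof.
rewrite flatten_indices; apply/idP/idP.
  move=> u; apply/hasPn => x xI; apply/hasPn => y yI; apply/negP => /andP[/eqP xy /eqP e].
  have := u; have /permP pe := perm_to_rem xI.
  apply/negP; have yr : y \in rem x I by rewrite (mem_rem_uniq x (uniq_indices Q)) !inE eq_sym; move/eqP: xy => ->.
  rewrite (perm_uniq (perm_map _ (perm_to_rem xI))) /= e.
  by rewrite map_f.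
move/hasPn=> h; rewrite map_inj_in_uniq ?uniq_indices // => x y xI yI e.
apply/eqP/negPn/negP => xy; have /hasPn/(_ y yI) := h x xI.
by rewrite xy e eqxx.
Qed.

Lemma paired_bins :
  all (fun b => 1 < count (fun b' => plt b' == plt b) (flatten Q)) (flatten Q) =
  all (fun x => has (fun y => (x != y) && (plt (bin_at Q y) == plt (bin_at Q x))) I) I.
Proof.
rewrite flatten_indices all_map; apply: eq_in_all => x xI /=; rewrite count_map.
by rewrite (@count_gt1 _ _ _ x) ?uniq_indices //=.
Qed.

Definition taken (C : seq (seq bin)) (j : nat) := size (q j) - size (row C j).
Definition wfconf (C : seq (seq bin)) :=
  size C = k /\ forall j, j < k -> row C j = drop (taken C j) (q j).

Lemma taken_le C j : taken C j <= size (q j). Proof. exact: leq_subr. Qed.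

Lemma is_openE C t : wfconf C -> is_open Q C t =
  has (fun x => ~~ (x.2 < taken C x.1) && (plt (bin_at Q x) == t)) I &&
  has (fun x => (x.2 < taken C x.1) && (plt (bin_at Q x) == t)) I.
Proof.
case=> sC wC; congr andb.
  apply/hasP/hasP.
    case=> j; rewrite mem_iota /= => jk; rewrite wC // => /(has_nthP nobin)[i].
    rewrite size_drop nth_drop => iq h; exists (j, taken C j + i).
      by rewrite mem_indices /= jk -ltn_subRL.
    by rewrite /= -leqNgt leq_addr.
  case=> -[j i]; rewrite mem_indices /= => /andP[jk iq]; rewrite -leqNgt => /andP[le h].
  exists j; first by rewrite mem_iota.
  rewrite wC //; apply/(has_nthP nobin); exists (i - taken C j).
    by rewrite size_drop ltn_sub2rE.
  by rewrite nth_drop subnKC.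
apply/hasP/hasP.
  case=> j; rewrite mem_iota /= => jk /(has_nthP nobin)[i].
  rewrite size_takel ?leq_subr // => lt; rewrite nth_take // => h; exists (j, i).
    by rewrite mem_indices /= jk (leq_trans lt (leq_subr _ _)).
  by rewrite /= lt.
case=> -[j i]; rewrite mem_indices /= => /andP[jk iq] /andP[lt h].
exists j; first by rewrite mem_iota.
apply/(has_nthP nobin); exists i; first by rewrite size_takel ?leq_subr.
by rewrite nth_take.
Qed.

Definition has_taken C t := has (fun x => (x.2 < taken C x.1) && (plt (bin_at Q x) == t)) I.
Definition has_left C x0 t :=
  has (fun x => ~~ (x.2 < taken C x.1) && ((x != x0) && (plt (bin_at Q x) == t))) I.

Lemma num_open_step C C' j : wfconf C -> wfconf C' -> j < k ->
  taken C j < size (q j) -> taken C' j = (taken C j).+1 ->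
  (forall i, i != j -> taken C' i = taken C i) ->
  let x0 := (j, taken C j) in let t := plt (bin_at Q x0) in
  num_open Q C' + has_taken C t = num_open Q C + has_left C x0 t.
Proof.
move=> wC wC' jk lt ej ne x0 t.
have x0I : x0 \in I by rewrite mem_indices /= jk.
have rem' x : (x.2 < taken C' x.1) = (x.2 < taken C x.1) || (x == x0).
  case: x => a i; rewrite /x0 xpair_eqE /=; case: eqP => [->|/eqP aj] /=.
    by rewrite ej ltnS leq_eqVlt orbC.
  by rewrite ne // orbF.
(* Before the step x0 is itself a remaining bin for t, so only the removed side of openness is in
   question; after the step x0 is a removed bin and the sides are exchanged. *)
have openC : is_open Q C t = has_taken C t.
  rewrite is_openE // (_ : has _ I = true) //.
  by apply/hasP; exists x0 => //=; rewrite ltnn eqxx.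
have openC' : is_open Q C' t = has_left C x0 t.
  rewrite is_openE // [X in _ && X](_ : _ = true) ?andbT.
    by apply: eq_has => x; rewrite rem' negb_or -andbA.
  by apply/hasP; exists x0 => //; rewrite rem' !eqxx orbT.
rewrite -openC -openC'; apply: count_change; first exact: undup_uniq.
  by rewrite mem_undup map_f // flatten_indices map_f.
(* Only x0 changes sides, and it is no bin for u. *)
move=> u _ ut; rewrite !is_openE //; congr andb; apply: eq_has => x; rewrite rem'.
  by case: (x =P x0) => [->|_]; rewrite ?orbF // orbT /= eq_sym (negbTE ut) andbF.
by case: (x =P x0) => [->|_]; rewrite ?orbF // orbT /= eq_sym (negbTE ut) andbF.
Qed.

Lemma num_open_init : num_open Q Q = 0.
Proof.
have wQ : wfconf Q by split=> // j jk; rewrite /taken subnn drop0.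
apply/eqP; rewrite -leqn0 leqNgt -has_count; apply/hasPn => t _.
rewrite is_openE // negb_and; apply/orP; right; apply/hasPn => x _.
by rewrite /taken subnn ltn0.
Qed.

Lemma tstepP C C' : wfconf C -> tstep C C' <->
  exists j, [/\ j < k, taken C j < size (q j) & C' = set_nth [::] C j (behead (row C j))].
Proof.
case=> sC wC; split.
  case/hasP=> j; rewrite mem_iota /= sC => jk /andP[ne /eqP ->]; exists j; split=> //.
  move: ne; rewrite wC //; case: ltnP => // le.
  by rewrite drop_oversize.
case=> j [jk lt ->]; apply/hasP; exists j; first by rewrite mem_iota sC.
by rewrite eqxx andbT wC // -size_eq0 size_drop subn_eq0 -ltnNge.
Qed.

Lemma tstep_conf C j : wfconf C -> j < k -> taken C j < size (q j) ->
  let C' := set_nth [::] C j (behead (row C j)) in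
  [/\ wfconf C', taken C' j = (taken C j).+1 & forall i, i != j -> taken C' i = taken C i].
Proof.
move=> [sC wC] jk lt C'.
have nC i : row C' i = if i == j then behead (row C j) else row C i by rewrite nth_set_nth.
have t' : taken C' j = (taken C j).+1.
  rewrite /taken nC eqxx size_behead.
  move: (congr1 size (wC j jk)) lt; rewrite size_drop /taken.
  by move: (size (row C j)) (size (q j)) => a b; lia.
have tn i : i != j -> taken C' i = taken C i.
  by move=> ij; rewrite /taken nC (negbTE ij).
split=> //; split; first by rewrite size_set_nth sC; apply/maxn_idPr.
move=> i ik; rewrite nC; case: eqP => [->|/eqP ij]; last by rewrite tn // wC.
by rewrite t' wC // -drop1 drop_drop add1n.
Qed.

Lemma wf_all_taken C : wfconf C -> (forall j, j < k -> taken C j = size (q j)) ->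
  C = nseq k [::].
Proof.
case=> sC wC h; apply: (@eq_from_nth _ [::]); rewrite ?size_nseq // sC => j jk.
by rewrite wC // h // drop_size nth_nseq jk.
Qed.

Lemma taken_nil j : j < k -> taken (nseq k [::]) j = size (q j).
Proof. by move=> jk; rewrite /taken nth_nseq jk subn0. Qed.

Variable p : nat.
Notation w := (enc_inst Q p).
Notation n := (size w).

Lemma removed_beforeP C s e x : x \in I ->
  (forall j, j < k -> s j = pos Q j 0) -> (forall j, j < k -> e j = pos Q j (taken C j)) ->
  removed_before k s e (pos Q x.1 x.2) = (x.2 < taken C x.1).
Proof.
move=> xI hs he; case: x xI => j i; rewrite mem_indices /= => /andP[jk iq].
apply/hasP/idP.
  case=> j'; rewrite mem_iota /= => jk'; rewrite hs // he // => /andP[h1 h2].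
  have jj : j = j'.
    apply/eqP; rewrite -(pos_row i jk jk') h1 /=.
    by apply: ltn_trans h2 (pos_le_next _ jk').
  by subst j'; rewrite -(@pos_lt Q j) ?taken_le.
move=> lt; exists j; first by rewrite mem_iota.
by rewrite hs // he // pos_ge0 pos_lt ?taken_le.
Qed.

Lemma valid_atP : all (fun b => 0 < plt b) (flatten Q) ->
  valid_at w (pos Q k 0) = valid_instance Q.
Proof.
move=> pp; rewrite /valid_instance pp uniq_bins paired_bins /valid_at.
rewrite (has_start Q p (fun a => has (fun b => isstart w (pos Q k 0) b && ((a != b) && (field w a == field w b))) (iota 0 n) ||
   ~~ has (fun b => isstart w (pos Q k 0) b &&
        ((a != b) && (field w (endbits w b) == field w (endbits w a)))) (iota 0 n))).
have ne x y : x \in I -> y \in I -> (pos Q x.1 x.2 != pos Q y.1 y.2) = (x != y).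
  by move=> xI yI; congr negb; apply/eqP/eqP => [/pos_inj ->//|->].
rewrite -[X in _ && (_ && X)]negbK -has_predC -negb_or -has_predU; congr negb.
apply: eq_in_has => x xI /=.
congr orb.
  rewrite (has_start Q p (fun b => (pos Q x.1 x.2 != b) && (field w (pos Q x.1 x.2) == field w b))).
  by apply: eq_in_has => y yI; rewrite ne // eq_field_bin.
congr negb.
rewrite (has_start Q p (fun b => (pos Q x.1 x.2 != b) && (field w (endbits w b) == field w (endbits w (pos Q x.1 x.2))))).
by apply: eq_in_has => y yI; rewrite ne // eq_field_plt.
Qed.

End Combinatorics.

(** * The program for the stack-up problem *)

Ltac updlia := cbv beta; rewrite ?upd_same; repeat (rewrite upd_lt; last by lia); rewrite ?upd_same.

Definition rend d y : rsym := RSeq (rcopy d y) (rbits d).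
Definition f_isstart d s y : form :=
  f_and (f_sym y bitopt) (f_and (f_start d y sepopt) (f_lt d y s)).
Definition f_exstart d s (F : form) : form := f_ex d (f_and (f_isstart d.+1 s d) F).
(** Since k is fixed, the search over the sequences is unrolled into the program; [f_sym y pred0] is
    falsity, the unit of [f_or]. *)
Definition f_removed k d y : form :=
  foldr (fun j F => f_or (f_and (f_le d j y) (f_lt d y (k.+1 + j))) F) (f_sym y pred0) (iota 0 k).
(** Here y is the start of a bin, whereas c already points past the name of the other bin. *)
Definition f_samefield d y c : form := f_let (rend d y) (f_field d.+1 d c).
Definition f_valid d s : form :=
  f_not (f_exstart d s (f_or
    (f_exstart d.+1 s (f_and (f_not (f_eq d.+2 d d.+1)) (f_field d.+2 d d.+1)))
    (f_let (rend d.+1 d) (f_not (f_exstart d.+2 s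
       (f_and (f_not (f_eq d.+3 d d.+2)) (f_samefield d.+3 d.+2 d.+1))))))).
Definition f_hastaken k d s c : form :=
  f_exstart d s (f_and (f_removed k d.+1 d) (f_samefield d.+1 d c)).
Definition f_hasleft k d s x c : form :=
  f_exstart d s (f_and (f_not (f_removed k d.+1 d))
    (f_and (f_not (f_eq d.+1 d x)) (f_samefield d.+1 d c))).

Lemma removed_upd k v d a y : k.+1 + k <= d ->
  removed_before k (upd v d a) (fun j => upd v d a (k.+1 + j)) y =
  removed_before k v (fun j => v (k.+1 + j)) y.
Proof.
move=> kd; apply: eq_in_has => j; rewrite mem_iota /= => jk.
by rewrite !upd_lt //; lia.
Qed.

Section StackUpFormulas.
Variables (w : seq sym) (B : nat).
Hypothesis size_w : size w < B.
Notation sem := (rsem w B).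
Notation n := (size w).
Notation decides := (decides w B).

Lemma rendP d y v v' : y < d -> small w d v ->
  sem (rend d y) v v' <-> v' = upd v d (endbits w (v y)).
Proof.
move=> yd sv; have dy : d != y by rewrite neq_ltn yd orbT.
have hy := sv _ yd.
split.
  case=> _ /(rcopyP size_w _ dy hy) -> /rbitsP; rewrite upd_same upd_upd; exact.
move=> ->; exists (upd v d (v y)); first exact/(rcopyP size_w _ dy hy).
by apply/rbitsP => //; rewrite ?upd_same ?upd_upd.
Qed.

Lemma decides_end d y F phi psi : y < d -> decides d.+1 F phi ->
  (forall v, phi (upd v d (endbits w (v y))) = psi v) -> decides d (f_let (rend d y) F) psi.
Proof.
move=> yd dF e.
apply: decides_ext (decides_let (g := fun v => endbits w (v y)) _ _ _ dF) => //.
- by move=> v v' h; rewrite h.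
- by move=> v sv; apply: endbits_le; exact: sv.
- by move=> v v' sv; apply: rendP.
Qed.

Lemma decides_isstart d s y : s < d -> y < d ->
  decides d (f_isstart d s y) (fun v => isstart w (v s) (v y)).
Proof.
move=> sd yd; apply: decides_and; first exact: decides_sym.
by apply: decides_and; [apply: decides_start|apply: decides_lt].
Qed.

Lemma decides_exstart d s F phi psi : s < d -> decides d.+1 F phi ->
  (forall v a, phi (upd v d a) = psi v a) ->
  decides d (f_exstart d s F) (fun v => has (fun a => isstart w (v s) a && psi v a) (iota 0 n)).
Proof.
move=> sd dF e; have sd' : s < d.+1 by apply: ltnW.
apply: decides_ext (decides_ex size_w (decides_and (decides_isstart sd' (ltnSn d)) dF)) => v.
by apply: eq_has => a; rewrite e; updlia.
Qed.

Lemma decides_removed k d y : y < d -> k.+1 + k <= d ->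
  decides d (f_removed k d y) (fun v => removed_before k v (fun j => v (k.+1 + j)) (v y)).
Proof.
move=> yd kd; rewrite /f_removed /removed_before.
have : {subset iota 0 k <= gtn k} by move=> j; rewrite mem_iota.
elim: (iota 0 k) => [_|j s IH h] /=.
  exact: (@decides_sym w B d y pred0 yd).
have jk : j < k by apply: h; rewrite mem_head.
apply: decides_or; last by apply: IH => i si; apply: h; rewrite inE si orbT.
by apply: decides_and; [apply: decides_le|apply: decides_lt] => //; lia.
Qed.

Lemma decides_samefield d y c : y < d -> c < d ->
  decides d (f_samefield d y c) (fun v => field w (endbits w (v y)) == field w (v c)).
Proof.
move=> yd cd; apply: decides_end => //.
  by apply: (decides_field size_w); [apply: ltnSn|apply: ltnW].
by move=> v; updlia.
Qed.

Lemma decides_valid d s : s < d -> decides d (f_valid d s) (fun v => valid_at w (v s)).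
Proof.
move=> sd; apply: decides_not.
apply: decides_exstart => //.
  apply: decides_or.
    apply: decides_exstart; first exact: ltnW.
      apply: decides_and; first by apply: decides_not; apply: decides_eq; lia.
      by apply: decides_field; lia.
    by move=> v a; updlia; reflexivity.
  apply: decides_end; first exact: ltnSn.
    apply: decides_not; apply: decides_exstart; first by lia.
      apply: decides_and; first by apply: decides_not; apply: decides_eq; lia.
      by apply: decides_samefield; lia.
    by move=> v a; updlia; reflexivity.
  by move=> v; updlia; reflexivity.
by move=> v a; updlia; reflexivity.
Qed.

Definition has_taken_at k (v : nat -> nat) s c : bool :=
  has (fun a => isstart w s a && (removed_before k v (fun j => v (k.+1 + j)) a &&
     (field w (endbits w a) == field w c))) (iota 0 n).
Definition has_left_at k (v : nat -> nat) s x c : bool :=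
  has (fun a => isstart w s a && (~~ removed_before k v (fun j => v (k.+1 + j)) a &&
     ((a != x) && (field w (endbits w a) == field w c)))) (iota 0 n).

Lemma decides_hastaken k d s c : s < d -> c < d -> k.+1 + k <= d ->
  decides d (f_hastaken k d s c) (fun v => has_taken_at k v (v s) (v c)).
Proof.
move=> sd cd kd; apply: decides_exstart => //.
  apply: decides_and; first by apply: decides_removed => //; lia.
  by apply: decides_samefield => //; lia.
by move=> v a; cbv beta; rewrite removed_upd //; updlia.
Qed.

Lemma decides_hasleft k d s x c : s < d -> x < d -> c < d -> k.+1 + k <= d ->
  decides d (f_hasleft k d s x c) (fun v => has_left_at k v (v s) (v x) (v c)).
Proof.
move=> sd xd cd kd; apply: decides_exstart => //.
  apply: decides_and; first by apply: decides_not; apply: decides_removed => //; lia.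
  apply: decides_and; first by apply: decides_not; apply: decides_eq; lia.
  by apply: decides_samefield => //; lia.
by move=> v a; cbv beta; rewrite removed_upd //; updlia.
Qed.

End StackUpFormulas.

(** * Parsing the instance and comparing a register with p *)

Fixpoint rparse j : rsym :=
  if j is i.+1 then RSeq (rparse i) (RSeq (rcopy j i) (rbins j)) else RZero _ 0.
Definition rparsepos d s : rsym :=
  RSeq (rcopy d s) (RSeq (rnatpos d) (RSym d (fun a => ~~ isSome a))).
(** The base case serves as a skip: register 0 is the start of the first sequence and always holds
    0. *)
Fixpoint rptrs b m : rsym :=
  if m is j.+1 then RSeq (rptrs b j) (rcopy (b + j) j) else RZero _ 0.

(* The value of p may exceed every register, so rlenum only keeps in register
   d+1 some u with u <= the value of the bits of p read so far; choosing
   u = min(that value, f) makes every f <= p pass. *)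
Definition rmaybe d x : rsym := RAlt (rskip d) (RInc _ x).
(** A round adds one to d and at most two to d + 1, so d + 1 ends at some value up to twice d.
    Register z only supplies the value of at most |w| that [rskip] requires. *)
Definition rdouble d z : rsym :=
  RStar (RSeq (RInc _ d) (RSeq (rmaybe z d.+1) (rmaybe z d.+1))).
(** One digit of Horner's scheme, with d as the reading position and u in d + 1: d + 2 is counted up
    to u while d + 3 collects at most 2u, plus an optional one if the bit is 1. *)
Definition rbitstep d z : rsym :=
  RSeq (rset0 d.+2) (RSeq (rset0 d.+3) (RSeq (rdouble d.+2 z) (RSeq (REq _ d.+2 d.+1)
    (RSeq (RAlt (RSym d (pred1 (Some B0))) (RSeq (RSym d (pred1 (Some B1))) (rmaybe z d.+3)))
          (RSeq (rcopy d.+1 d.+3) (RInc _ d)))))).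
Definition rlenum d s f : rsym :=
  RSeq (rcopy d s) (RSeq (rset0 d.+1) (RSeq (RStar (rbitstep d s))
    (RSeq (RSym d (fun a => ~~ isSome a)) (rle d.+2 f d.+1)))).

Section Sem.
Variables (w : seq sym) (B : nat).
Hypothesis size_w : size w < B.
Notation sem := (rsem w B).
Notation n := (size w).
Notation subw := (subw w).
Notation symat := (symat w).

Lemma rcopy_sound x y v v' : x != y -> sem (rcopy x y) v v' -> v' = upd v x (v y).
Proof.
move=> xy [_ [a _ ->] /= [+ ->]].
by rewrite upd_same upd_other 1?eq_sym // => ->.
Qed.

Lemma rcopy_complete x y v : x != y -> v y < B -> sem (rcopy x y) v (upd v x (v y)).
Proof.
move=> xy lt; exists (upd v x (v y)); first by exists (v y).
by split=> //; rewrite upd_same upd_other 1?eq_sym.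
Qed.

Lemma end_of_input x v v' : sem (RSym x (fun a => ~~ isSome a)) v v' <-> v x = n /\ v' = v.
Proof.
split.
  case=> le; rewrite -/(symat (v x)) symat_some -leqNgt => ge ->.
  by split=> //; apply/eqP; rewrite eqn_leq le.
case=> e ->; split=> //; first by rewrite e.
by rewrite -/(symat (v x)) symat_some e ltnn.
Qed.

Lemma rparse_sound j v : sem (rparse j) (fun=> 0) v ->
  exists Q, [/\ size Q = j, all (fun b => 0 < plt b) (flatten Q), subw 0 (enc_seqs Q),
    forall i, i <= j -> v i = size (enc_seqs (take i Q)) & forall x, j < x -> v x = 0].
Proof.
elim: j v => [|j IH] v /=.
  case=> _ ->; exists [::]; split=> //; exact: subw_nil.
case=> v1 /IH[Q [sQ pQ sub e0 e1]] [v2 /rcopy_sound].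
rewrite neq_ltn ltnSn orbT => /(_ isT) -> /(consumes_bins size_w)[_ [[q pq ->]]].
have ej : v1 j = size (enc_seqs Q) by rewrite e0 // -sQ take_size.
rewrite upd_same upd_upd ej => sub' ->.
exists (rcons Q q); split.
- by rewrite size_rcons sQ.
- by rewrite flatten_rcons all_cat pQ.
- rewrite -cats1 enc_seqs_cat; apply/subw_cat; split=> //.
  by rewrite /enc_seqs /= cats0.
- move=> i; rewrite leq_eqVlt => /orP[/eqP ->|lt].
    rewrite upd_same take_oversize ?size_rcons ?sQ //.
    by rewrite -(cats1 Q) enc_seqs_cat size_cat /enc_seqs /= cats0 size_rcons.
  by rewrite upd_lt // e0 // -cats1 takel_cat ?sQ.
- by move=> x jx; rewrite upd_other ?neq_ltn ?jx ?orbT // e1 // ltnW.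
Qed.

Lemma rbitstep_double d z v v' : z < d -> sem (rdouble d z) v v' ->
  v d.+1 <= (v d).*2 -> agree d v v' /\ v' d.+1 <= (v' d).*2.
Proof.
move=> zd H le; elim/clos_refl_trans_ind_left: v' / H => // y y' _ [ag IH].
have maybe u u' : sem (rmaybe z d.+1) u u' ->
    agree d.+1 u u' /\ u' d.+1 <= (u d.+1).+1.
  case=> [[_ _ ->] //|[_ ->]]; rewrite upd_same; split=> //.
  exact: agree_upd.
case=> _ [_ ->] [u1 /maybe[a1 l1] /maybe[a2 l2]].
split.
  apply: agree_trans ag _; apply: agree_trans (agree_upd _ _ (leqnn d)) _.
  exact: agree_trans (agree_le (leqnSn _) a1) (agree_le (leqnSn _) a2).
rewrite -(a2 d (ltnSn d)) -(a1 d (ltnSn d)) upd_same.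
move: l1; rewrite upd_other ?neq_ltn ?ltnSn ?orbT //; lia.
Qed.

Lemma rdouble_complete d z v t x : z < d -> v z <= n -> v d = 0 -> v d.+1 = 0 ->
  x <= t.*2 -> t < B -> x < B ->
  exists v', [/\ sem (rdouble d z) v v', agree d v v', v' d = t & v' d.+1 = x].
Proof.
move=> zd vz e0 e1; elim: t x => [|t IH] x le tB xB.
  by exists v; split=> //; [apply: rt_refl|lia].
(* The last round contributes min(x, 2): min(x, 1) by its first optional increment and the rest by
   its second. *)
have [|||v1 [st ag et ex]] := IH (x - minn x 2); try lia.
have maybe u y : u z <= n -> y <= 1 -> u d.+1 + y < B -> exists u', [/\ sem (rmaybe z d.+1) u u',
    agree d.+1 u u' & u' d.+1 = u d.+1 + y].
  case: y => [|[|y]] // uz _ lt.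
    by exists u; rewrite addn0; split=> //; left.
  exists (upd u d.+1 (u d.+1).+1); rewrite upd_same addn1; split=> //.
    by right; split=> //; rewrite -addn1.
  exact: agree_upd.
have v1z : v1 z <= n by rewrite -ag.
have zd1 : z < d.+1 by apply: ltnW.
have [|||u1 [s1 a1 x1]] := maybe (upd v1 d t.+1) (minn x 1); try lia.
- by rewrite upd_lt.
- by rewrite upd_other ?neq_ltn ?ltnSn ?orbT // ex; lia.
have [|||u2 [s2 a2 x2]] := maybe u1 (minn x 2 - minn x 1); try lia.
- by rewrite -a1 // upd_lt.
- by rewrite x1 upd_other ?neq_ltn ?ltnSn ?orbT // ex; lia.
exists u2; split.
- apply: rt_trans st _; apply: rt_step; exists (upd v1 d t.+1); first by split; rewrite et.
  by exists u1.
- apply: agree_trans ag _; apply: agree_trans (agree_upd _ _ (leqnn d)) _.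
  exact: agree_trans (agree_le (leqnSn _) a1) (agree_le (leqnSn _) a2).
- by rewrite -(a2 d (ltnSn d)) -(a1 d (ltnSn d)) upd_same.
- by rewrite x2 x1 upd_other ?neq_ltn ?ltnSn ?orbT // ex; lia.
Qed.

Lemma rbitstep_sound d z v v' : z < d -> sem (rbitstep d z) v v' ->
  exists c, [/\ isbit c, symat (v d) = Some c, v' d = (v d).+1,
    v' d.+1 <= (v d.+1).*2 + (c == B1) & agree d v v'].
Proof.
move=> zd [_ /(rset0P size_w) -> [_ /(rset0P size_w) -> [v1 /rbitstep_double]]].
case; [by lia|by rewrite upd_same|].
move=> ag; move=> le [_ [eq ->]].
have ag' x : x < d.+2 -> v1 x = v x.
  by move=> xd; rewrite -ag // !upd_lt //; lia.
have fin c u2 : isbit c -> symat (v d) = Some c -> agree d.+3 v1 u2 -> u2 d.+3 <= v1 d.+3 + (c == B1) ->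
    sem (RSeq (rcopy d.+1 d.+3) (RInc _ d)) u2 v' ->
  exists c, [/\ isbit c, symat (v d) = Some c, v' d = (v d).+1,
    v' d.+1 <= (v d.+1).*2 + (c == B1) & agree d v v'].
  move=> ic sc ag2 le2 [u3 /rcopy_sound].
  rewrite neq_ltn (ltnW (ltnSn _)) => /(_ isT) -> [_ ->].
  exists c; split=> //.
  - by rewrite upd_same upd_lt // -ag2 ?ag' //; lia.
  - rewrite upd_other ?neq_ltn ?ltnSn ?orbT // upd_same; apply: leq_trans le2 _.
    by rewrite leq_add2r -ag' // -eq.
  - move=> x xd; rewrite upd_lt // upd_lt ?(ltn_trans xd) // -ag2 ?ag' //; lia.
have vd : v1 d = v d by apply: ag'; lia.
case=> u2 [[_ + ->]|[_ [_ + ->]]]; rewrite -/(symat _) vd => /eqP sc.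
  by apply: (fin B0) => //; rewrite addn0.
case=> [[_ _ ->]|[_ ->]]; first by apply: (fin B1) => //; lia.
apply: (fin B1) => //; last by rewrite upd_same addn1.
exact: agree_upd.
Qed.

Lemma rbitstep_complete d z v c u : z < d -> v z <= n -> v d.+1 < B -> isbit c ->
  symat (v d) = Some c -> u <= (v d.+1).*2 + (c == B1) -> u < B ->
  exists v', [/\ sem (rbitstep d z) v v', v' d = (v d).+1, v' d.+1 = u & agree d v v'].
Proof.
move=> zd vz uB ic sc le ltB.
have lt : v d < n by rewrite -symat_some sc.
pose v0 := upd (upd v d.+2 0) d.+3 0.
have v0l x : x < d.+2 -> v0 x = v x by move=> xd; rewrite /v0 !upd_lt //; lia.
(* Doubling produces u itself, except that for a bit 1 and the odd maximum u = 2v + 1 it produces 2v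
   and the last optional increment does the rest. *)
have [|||||||v1 [s1 a1 t1 x1]] := @rdouble_complete d.+2 z v0 (v d.+1) (u - (c == B1 : nat) * (u == (v d.+1).*2.+1)).
- by lia.
- by rewrite v0l //; lia.
- by rewrite /v0 upd_lt // upd_same.
- by rewrite /v0 upd_same.
- by case: (c == B1) le => /=; case: eqP; lia.
- by [].
- by lia.
have v1l x : x < d.+2 -> v1 x = v x by move=> xd; rewrite -a1 // v0l.
have v1d : symat (v1 d) = Some c by rewrite v1l //; lia.
have lt1 : v1 d <= n by rewrite v1l; [apply: ltnW|lia].
have v1z : v1 z <= n by rewrite v1l //; lia.
have [u2 [s2 a2 x2]] : exists u2, [/\ sem (RAlt (RSym d (pred1 (Some B0)))
    (RSeq (RSym d (pred1 (Some B1))) (rmaybe z d.+3))) v1 u2, agree d.+3 v1 u2 & u2 d.+3 = u].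
  have [cB|cB] := eqVneq c B1; last first.
    have c0 : c = B0 by move: ic; rewrite /isbit (negbTE cB) orbF => /eqP.
    exists v1; split=> //; last by rewrite x1 (negbTE cB) subn0.
    left; split=> //; by rewrite -/(symat _) v1d c0.
  have sB : sem (RSym d (pred1 (Some B1))) v1 v1.
    by split=> //; rewrite -/(symat _) v1d cB /= eqxx.
  case e : (u == (v d.+1).*2.+1).
    exists (upd v1 d.+3 u); split; [|exact: agree_upd|by rewrite upd_same].
    right; exists v1 => //; right; split; rewrite x1 cB eqxx e /=; first by lia.
    by congr upd; move/eqP: e => ->; lia.
  exists v1; split=> //; last by rewrite x1 cB e; lia.
  by right; exists v1 => //; left.
exists (upd (upd u2 d.+1 u) d (v d).+1); split.
- exists (upd v d.+2 0); first exact/(rset0P size_w).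
  exists v0; first exact/(rset0P size_w).
  exists v1 => //; exists v1; first by split; rewrite // t1 v1l.
  exists u2 => //; exists (upd u2 d.+1 u).
    rewrite -x2; apply: rcopy_complete; last by rewrite x2.
    by rewrite neq_ltn (ltnW (ltnSn _)).
  have e : upd u2 d.+1 u d = v d.
    by rewrite upd_lt // -a2 ?v1l //; lia.
  by split; rewrite e //; apply: leq_ltn_trans lt _.
- by rewrite upd_same.
- by rewrite upd_other ?neq_ltn ?ltnSn ?orbT // upd_same.
- move=> x xd; rewrite upd_lt // upd_lt; last by lia.
  by rewrite -a2 ?v1l //; lia.
Qed.

Lemma rlenum_sound d s f v v' m : s < d -> f < d -> small w d v ->
  drop (v s) w = enc_nat m -> sem (rlenum d s f) v v' -> v f <= m /\ agree d v v'.
Proof.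
move=> sd fd sv E [u3 /rcopy_sound]; rewrite neq_ltn sd orbT => /(_ isT) ->.
case=> _ /(rset0P size_w) -> [v1 H].
set v0 := upd _ _ _ in H.
(* [t] is the part of p read so far. The bound by its value survives because Horner's step is
   monotone. *)
have [t [tb sub e1 e2 ag]] : exists t, [/\ all isbit t, subw (v s) t,
    v1 d = v s + size t, v1 d.+1 <= dec_nat t & agree d v v1].
  elim/clos_refl_trans_ind_left: v1 / H.
    exists [::]; split=> //; first exact: subw_nil.
    - by rewrite /v0 upd_lt // upd_same addn0.
    - by rewrite /v0 upd_same.
    - by move=> x xd; rewrite /v0 !upd_lt //; apply: ltnW.
  move=> y z _ [t [tb sub e1 e2 ag]] /(rbitstep_sound sd)[c [ic sc ed eu ag']].
  exists (rcons t c); split.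
  - by rewrite all_rcons ic.
  - by rewrite -cats1; apply/subw_cat; split=> //; rewrite -e1; apply/subw1.
  - by rewrite ed e1 size_rcons addnS.
  - by apply: leq_trans eu _; rewrite dec_rcons leq_add2r leq_double.
  - exact: agree_trans ag'.
case=> _ /end_of_input[en ->].
(* Reading has reached the end of the input, so no digit of p is missing. *)
have tE : t = enc_nat m.
  case: sub => u; rewrite E => Eu; have : size (enc_nat m) = size t.
    by rewrite -E size_drop -en e1 addKn.
  by rewrite Eu size_cat; case: (u) Eu => [|a l]; rewrite ?cats0 //=; lia.
rewrite tE enc_natK in e2.
have ne : d.+2 != f by lia.
case=> u4 /(rcopy_sound ne) ->.
case=> u5 /(star_inc size_w)[a + [-> _]]; rewrite upd_same upd_upd => le [/= + ->].
rewrite upd_same upd_lt // => ea; split.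
  by rewrite ag //; apply: leq_trans le _; rewrite ea.
by apply: agree_trans ag (agree_upd _ _ _); lia.
Qed.

Lemma rlenum_complete d s f v m : s < d -> f < d -> small w d v ->
  drop (v s) w = enc_nat m -> v f <= m -> exists v', sem (rlenum d s f) v v'.
Proof.
move=> sd fd sv E le.
have sB : v s < B by apply: leq_ltn_trans (sv _ sd) size_w.
have fB : v f < B by apply: leq_ltn_trans (sv _ fd) size_w.
pose v0 := upd (upd v d (v s)) d.+1 0.
have ag0 : agree d v v0 by move=> x xd; rewrite /v0 !upd_lt //; apply: ltnW.
have loop i : i <= size (enc_nat m) -> exists v1, [/\ star _ (sem (rbitstep d s)) v0 v1,
    v1 d = v s + i, v1 d.+1 = minn (dec_nat (take i (enc_nat m))) (v f) & agree d v v1].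
  elim: i => [|i IH] lei.
    exists v0; split=> //; first exact: rt_refl.
      by rewrite /v0 upd_lt // upd_same addn0.
    by rewrite /v0 upd_same take0 min0n.
  have [v1 [st e1 e2 ag]] := IH (ltnW lei).
  have sc : symat (v1 d) = Some (nth B0 (enc_nat m) i).
    rewrite e1 (@symat_nth w (v s) (enc_nat m)) //.
    by exists [::]; rewrite cats0 E.
  have ic : isbit (nth B0 (enc_nat m) i) by apply: (allP (enc_nat_bits m)); apply: mem_nth.
  have [||||v2 [s2 ed eu ag2]] := @rbitstep_complete d s v1 _ (minn (dec_nat (take i.+1 (enc_nat m))) (v f)) sd _ _ ic sc.
  - by rewrite -ag // sv.
  - by rewrite e2; apply: leq_ltn_trans fB; apply: geq_minr.
  - by rewrite e2 (take_nth B0 lei) dec_rcons; lia.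
  - by apply: leq_ltn_trans fB; apply: geq_minr.
  exists v2; split=> //; last exact: agree_trans ag2.
    by apply: rt_trans st _; apply: rt_step.
  by rewrite ed e1 addnS.
have [v1 [st e1 e2 ag]] := loop _ (leqnn _); rewrite take_size in e2.
rewrite enc_natK (minn_idPr le) in e2.
exists (upd v1 d.+2 (v f)); exists (upd v d (v s)).
  by apply: rcopy_complete => //; rewrite neq_ltn sd orbT.
exists v0; first exact/(rset0P size_w).
exists v1 => //; exists v1.
  apply/end_of_input; split=> //; rewrite e1 -E size_drop subnKC //; exact: sv.
exists (upd v1 d.+2 (v1 f)).
  apply: rcopy_complete; first by lia.
  by rewrite -ag.
exists (upd v1 d.+2 (v f)).
  apply/(star_inc size_w); exists (v f); rewrite upd_same -ag // upd_upd.
  by split=> //; rewrite ltnn.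
by split=> //; rewrite upd_same upd_lt.
Qed.

End Sem.

(* Registers: 0..k hold the starts of the k sequences and of p, k+1+j the
   position reached in sequence j, 2k+1 the number of free stack-up places. *)
Definition base k := (k.+1 + k).+1.
Definition rfree k := k.+1 + k.

(** A place becomes free if the pallet was open and no other bin for it is left, and is occupied if
    the pallet was not open and one is left. [RDec] fails when no place is free, and this enforces
    the bound on open pallets. *)
Definition radjust k j : rsym :=
  let T := f_hastaken k (base k).+1 k (base k) in
  let L := f_hasleft k (base k).+1 k (k.+1 + j) (base k) in
  RAlt (RAlt (RSeq T.1 L.1) (RSeq T.2 L.2))
       (RAlt (RSeq (RSeq T.1 L.2) (RInc _ (rfree k))) (RSeq (RSeq T.2 L.1) (RDec _ (rfree k)))).
(** A bit under the pointer shows that sequence j is not exhausted. The pallet tests run before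
    [rbin] advances the pointer, so they see the configuration before the step. *)
Definition rstep k j : rsym :=
  RSeq (RSym (k.+1 + j) bitopt) (RSeq (rend (base k) (k.+1 + j))
    (RSeq (radjust k j) (rbin (k.+1 + j)))).
(** [RSym 0 pred0] has no run; it is the empty alternative. *)
Definition rmain k : rsym :=
  RStar (foldr (fun j P => RAlt (rstep k j) P) (RSym 0 pred0) (iota 0 k)).
Definition rfinal k : rsym :=
  foldr (fun j P => RSeq (RSym (k.+1 + j) (pred1 (Some Bar))) P) (rskip 0) (iota 0 k).
(** [rskip] passes only guesses of at most |w|. *)
Definition rguess k : rsym := RSeq (RGuess _ (rfree k))
  (RSeq (rskip (rfree k)) (rlenum (base k) k (rfree k))).
Definition stackup_prog k : rsym :=
  RSeq (RSeq (rparse k) (rparsepos (base k) k))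
    (RSeq (f_valid (base k) k).1 (RSeq (rptrs k.+1 k) (RSeq (rguess k)
      (RSeq (rmain k) (rfinal k))))).

(** * Runs of the main loop and processings *)

Section Simulation.
Variables (Q : seq (seq bin)) (p B : nat).
Notation w := (enc_inst Q p).
Notation n := (size w).
Notation k := (size Q).
Notation pos := (pos Q).
Notation q j := (row Q j).
Notation sem := (rsem w B).
Notation D := (base k).
Notation free := (rfree k).
Notation small := (small w).
Notation I := (indices Q).
Notation taken := (taken Q).
Variable F : nat.

(** The sum of free places and open pallets is conserved, so at most F pallets are open as long as
    the free places form a natural number. *)
Definition tracks (v : nat -> nat) (C : seq (seq bin)) : Prop :=
  [/\ wfconf Q C, forall j, j <= k -> v j = pos j 0,
      forall j, j < k -> v (k.+1 + j) = pos j (taken C j) &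
      v free + num_open Q C = F].

Lemma lt_start i : i <= k -> i < D. Proof. by rewrite /base; lia. Qed.
Lemma ne_start i : i <= k -> i != free. Proof. by rewrite /rfree; lia. Qed.
Lemma lt_ptr i : i < k -> k.+1 + i < D. Proof. by rewrite /base; lia. Qed.
Lemma ne_ptr i : i < k -> k.+1 + i != free. Proof. by rewrite /rfree; lia. Qed.
Lemma lt_free : free < D. Proof. exact: ltnSn. Qed.
Lemma start_ptr i j : i <= k -> i != k.+1 + j. Proof. by lia. Qed.

Lemma tracks_agree v v' C : agree D v v' -> tracks v C -> tracks v' C.
Proof.
move=> ag [wf h1 h2 h3]; split=> //.
- by move=> j jk; rewrite -ag ?h1 // /base; lia.
- by move=> j jk; rewrite -ag ?h2 // /base; lia.
- by rewrite -ag // /base /rfree; lia.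
Qed.

Hypothesis F_le : F <= n.

Lemma tracks_small v C : tracks v C -> small D v.
Proof.
case=> _ h1 h2 h3 x; rewrite /base => xD.
case: (leqP x k) => [xk|kx]; first by rewrite h1 // pos_size.
case: (ltnP x free) => [xf|fx].
  have jk : x - k.+1 < k by rewrite /rfree in xf; lia.
  by rewrite -(subnKC kx) h2 // pos_size // ltnW.
have -> : x = free by rewrite /rfree in fx *; lia.
by lia.
Qed.

Hypothesis size_w : n < B.

Lemma radjust_sound j v v' : j < k -> small D.+1 v -> sem (radjust k j) v v' ->
  v' free + has_left_at w k v (v k) (v (k.+1 + j)) (v D) =
  v free + has_taken_at w k v (v k) (v D) /\
  forall x, x < D.+1 -> x != free -> v' x = v x.
Proof.
move=> jk sv.
have [l1 t1 t2] : decides w B D.+1 (f_hastaken k D.+1 k D) (fun v => has_taken_at w k v (v k) (v D)).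
  by apply: decides_hastaken => //; rewrite /base; lia.
have [l2 t3 t4] : decides w B D.+1 (f_hasleft k D.+1 k (k.+1 + j) D)
    (fun v => has_left_at w k v (v k) (v (k.+1 + j)) (v D)).
  by apply: decides_hasleft => //; rewrite /base; lia.
have fD : free < D.+1 by rewrite /base /rfree.
case=> [[|]|[|]].
- case/(proj1 (asserts_seq l2 t1 t3 sv)) => /andP[-> ->] ag.
  by rewrite ag //; split=> // x xD _; rewrite ag.
- case/(proj1 (asserts_seq (fun v v' e => congr1 negb (l2 v v' e)) t2 t4 sv)) => /andP[/negbTE -> /negbTE ->] ag.
  by rewrite ag //; split=> // x xD _; rewrite ag.
- case=> v1 /(proj1 (asserts_seq (fun v v' e => congr1 negb (l2 v v' e)) t1 t4 sv))[/andP[-> /negbTE ->] ag] [_ ->].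
  rewrite upd_same -ag //; split; first by rewrite addn0 addn1.
  by move=> x xD xf; rewrite upd_other // ag.
- case=> v1 /(proj1 (asserts_seq l2 t2 t3 sv))[/andP[/negbTE -> ->] ag] [h ->].
  rewrite upd_same -ag // in h *; split; first by rewrite addn0 addn1 prednK.
  by move=> x xD xf; rewrite upd_other // ag.
Qed.

Lemma radjust_complete j v f : j < k -> small D.+1 v ->
  f + has_left_at w k v (v k) (v (k.+1 + j)) (v D) =
    v free + has_taken_at w k v (v k) (v D) -> f < B ->
  exists v', [/\ sem (radjust k j) v v', v' free = f &
    forall x, x < D.+1 -> x != free -> v' x = v x].
Proof.
move=> jk sv.
have [l1 t1 t2] : decides w B D.+1 (f_hastaken k D.+1 k D) (fun v => has_taken_at w k v (v k) (v D)).
  by apply: decides_hastaken => //; rewrite /base; lia.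
have [l2 t3 t4] : decides w B D.+1 (f_hasleft k D.+1 k (k.+1 + j) D)
    (fun v => has_left_at w k v (v k) (v (k.+1 + j)) (v D)).
  by apply: decides_hasleft => //; rewrite /base; lia.
have fD : free < D.+1 by rewrite /base /rfree.
have s1 := asserts_seq l2 t1 t3 sv.
have s2 := asserts_seq (fun v v' e => congr1 negb (l2 v v' e)) t2 t4 sv.
have s3 := asserts_seq (fun v v' e => congr1 negb (l2 v v' e)) t1 t4 sv.
have s4 := asserts_seq l2 t2 t3 sv.
case ht: (has_taken_at _ _ _ _ _) s1 s2 s3 s4 => s1 s2 s3 s4;
  case hl: (has_left_at _ _ _ _ _ _) s1 s2 s3 s4 => s1 s2 s3 s4 /= e fB.
- case: s1 => s1 /(_ isT)[v' h]; have [_ ag] := s1 _ h.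
  exists v'; split; [by left; left|by rewrite -ag //; lia|].
  by move=> x xD _; rewrite ag.
- case: s3 => s3 /(_ isT)[v' h]; have [_ ag] := s3 _ h.
  exists (upd v' free f); split; [|by rewrite upd_same|].
    have ef : f = (v' free).+1 by rewrite -ag //; lia.
    by right; left; exists v' => //; split; rewrite -ef.
  by move=> x xD xf; rewrite upd_other // ag.
- case: s4 => s4 /(_ isT)[v' h]; have [_ ag] := s4 _ h.
  exists (upd v' free f); split; [|by rewrite upd_same|].
    have ef : v' free = f.+1 by rewrite -ag //; lia.
    by right; right; exists v' => //; split; rewrite ef.
  by move=> x xD xf; rewrite upd_other // ag.
- case: s2 => s2 /(_ isT)[v' h]; have [_ ag] := s2 _ h.
  exists v'; split; [by left; right|by rewrite -ag //; lia|].
  by move=> x xD _; rewrite ag.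
Qed.

(** The state [u] is the one in which [radjust] starts: register D points past the name of the bin
    about to be removed. *)
Lemma taken_leftP v C j : tracks v C -> j < k -> taken C j < size (q j) ->
  let u := upd v D (endbits w (v (k.+1 + j))) in let x0 := (j, taken C j) in
  has_taken_at w k u (u k) (u D) = has_taken Q C (plt (bin_at Q x0)) /\
  has_left_at w k u (u k) (u (k.+1 + j)) (u D) = has_left Q C x0 (plt (bin_at Q x0)).
Proof.
move=> [wf h1 h2 h3] jk lt u x0.
have x0I : x0 \in I by rewrite mem_indices /= jk.
have uk : u k = pos k 0 by rewrite /u upd_lt ?h1 // /base; lia.
have uj : u (k.+1 + j) = pos x0.1 x0.2 by rewrite /u upd_lt ?h2 // /base; lia.
have uD : u D = endbits w (pos x0.1 x0.2) by rewrite /u upd_same h2.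
have rm x : x \in I ->
    removed_before k u (fun j => u (k.+1 + j)) (pos x.1 x.2) = (x.2 < taken C x.1).
  move=> xI; rewrite /u removed_upd; last by rewrite /base; lia.
  by apply: (@removed_beforeP Q C) => // i ik; rewrite h1 // ltnW.
rewrite /has_taken_at /has_left_at uk uj uD; split.
  rewrite (has_start Q p (fun a => removed_before k u (fun j => u (k.+1 + j)) a &&
     (field w (endbits w a) == field w (endbits w (pos x0.1 x0.2))))).
  by apply: eq_in_has => x xI; rewrite rm // eq_field_plt.
rewrite (has_start Q p (fun a => ~~ removed_before k u (fun j => u (k.+1 + j)) a &&
   ((a != pos x0.1 x0.2) && (field w (endbits w a) == field w (endbits w (pos x0.1 x0.2)))))).
apply: eq_in_has => x xI; rewrite rm // eq_field_plt //.
congr (_ && (~~ _ && _)); apply/eqP/eqP => [e|->//].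
exact: (@pos_inj Q).
Qed.

(** The pointer stands on the first bit of the next bin or, if there is none, on the closing
    [Bar]. *)
Lemma pos_bitP v C j : tracks v C -> j < k ->
  bitopt (symat w (v (k.+1 + j))) = (taken C j < size (q j)).
Proof.
move=> [wf h1 h2 h3] jk; rewrite h2 //.
case: ltnP => [lt|ge].
  have := @isstart_pos Q p (j, taken C j); rewrite mem_indices /= jk => /(_ lt).
  by case/and3P.
by have -> : taken C j = size (q j) by [apply/eqP; rewrite eqn_leq ge taken_le];
   rewrite symat_bar.
Qed.

(** [rbin] may consume any encoded bin that it finds; the [Semi] after a field leaves only one
    possible length. *)
Lemma subw_binE i j s b : j < k -> i < size (q j) -> s = rcons (enc_bin b) Semi ->
  subw w (pos j i) s -> pos j i + size s = pos j i.+1.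
Proof.
move=> jk iq -> [u E]; rewrite posS //; congr addn.
have := congr1 (fun s => size (fieldl s)) E.
rewrite -/(field w (pos j i)) field_pos // -cats1 -catA fieldl_cat ?enc_bin_incell //=.
by rewrite cats0 !size_rcons size_cat /= addn1 => ->.
Qed.

Lemma rstep_sound v v' C j : j < k -> tracks v C -> sem (rstep k j) v v' ->
  exists2 C', tstep C C' & tracks v' C'.
Proof.
move=> jk tr; have sv := tracks_small tr; have jD : k.+1 + j < D by rewrite /base; lia.
case=> _ [_ + ->]; rewrite -/(symat _ _) (pos_bitP tr) // => lt.
case=> u /(rendP size_w _ jD sv) ->.
have [ht hl] := taken_leftP tr jk lt.
case=> v1 /radjust_sound[] //.
  by apply: small_upd => //; apply: endbits_le; apply: sv.
rewrite ht hl => e1 e2 /(consumes_bin size_w)[s [[b _ es] sub ->]].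
have [wf h1 h2 h3] := tr; have [wf' tj tn] := tstep_conf wf jk lt.
have e3 x : x < D -> x != free -> v1 x = v x.
  by move=> xD xf; rewrite e2 ?upd_lt // ltnW.
have jf : k.+1 + j != free by rewrite /rfree; lia.
exists (set_nth [::] C j (behead (row C j))); first by apply/(tstepP _ wf); exists j.
split=> //.
- by move=> i ik; rewrite upd_other ?start_ptr // e3 ?h1 ?lt_start ?ne_start.
- move=> i ik; have [->|ij] := eqVneq i j.
    rewrite upd_same tj e3 // h2 //; apply: subw_binE => //; [exact: es|].
    by rewrite -h2 // -e3.
  by rewrite upd_other ?eqn_add2l // e3 ?h2 ?tn ?lt_ptr ?ne_ptr.
- rewrite upd_other 1?eq_sym //.
  have := num_open_step wf wf' jk lt tj tn; move: e1.
  by rewrite upd_lt ?lt_free //= => e1' no; lia.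
Qed.

Hypothesis pos_plt : all (fun b => 0 < plt b) (flatten Q).

Lemma rstep_complete v C C' : tracks v C -> tstep C C' -> num_open Q C' <= F ->
  exists j v', [/\ j < k, sem (rstep k j) v v' & tracks v' C'].
Proof.
move=> tr; have [wf h1 h2 h3] := tr; case/(tstepP _ wf)=> j [jk lt ->] leF.
have sv := tracks_small tr; have jD : k.+1 + j < D by rewrite /base; lia.
have [ht hl] := taken_leftP tr jk lt.
have [wf' tj tn] := tstep_conf wf jk lt.
have no := num_open_step wf wf' jk lt tj tn.
set C1 := set_nth _ _ _ _ in leF wf' tj tn no *.
pose u := upd v D (endbits w (v (k.+1 + j))).
have su : small D.+1 u.
  by apply: small_upd => //; apply: endbits_le; apply: sv.
have uf : u free = v free by rewrite /u upd_lt // /base /rfree.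
(* The bound on the open pallets of the new configuration makes this difference a true one. *)
have [||v1 [s1 ef e2]] := @radjust_complete j u (F - num_open Q C1) jk su.
- rewrite -/u in ht hl; rewrite ht hl uf; lia.
- by lia.
have e3 x : x < D -> x != free -> v1 x = v x.
  by move=> xD xf; rewrite e2 ?(leqW xD) // /u upd_lt.
have jf : k.+1 + j != free by rewrite /rfree; lia.
exists j, (upd v1 (k.+1 + j) (pos j (taken C j).+1)); split=> //.
  exists v; first by split; [apply: sv| rewrite -/(symat _ _) (pos_bitP tr)|].
  exists u; first exact/(rendP size_w _ jD sv).
  exists v1 => //; apply/(consumes_bin size_w).
  exists (rcons (enc_bin (bin_at Q (j, taken C j))) Semi); split.
  - exists (bin_at Q (j, taken C j)) => //.
    apply: (allP pos_plt); rewrite flatten_indices map_f // mem_indices /= jk //.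
  - by rewrite e3 // h2 //; apply: subw_bin.
  - by rewrite e3 // h2 // -posS.
split=> //.
- by move=> i ik; rewrite upd_other ?start_ptr // e3 ?h1 ?lt_start ?ne_start.
- move=> i ik; have [->|ij] := eqVneq i j; first by rewrite upd_same tj.
  by rewrite upd_other ?eqn_add2l // e3 ?h2 ?tn ?lt_ptr ?ne_ptr.
- by rewrite upd_other 1?eq_sym // ef subnK.
Qed.

Lemma rany_sound v v' s : sem (foldr (fun j P => RAlt (rstep k j) P) (RSym 0 pred0) s) v v' ->
  exists2 j, j \in s & sem (rstep k j) v v'.
Proof.
elim: s => [|j s IH] /=; first by case.
by case=> [h|/IH[i si h]]; [exists j; rewrite ?mem_head|exists i; rewrite // inE si orbT].
Qed.

Lemma rany_complete v v' s j : j \in s -> sem (rstep k j) v v' ->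
  sem (foldr (fun j P => RAlt (rstep k j) P) (RSym 0 pred0) s) v v'.
Proof.
elim: s => //= i s IH; rewrite inE => /orP[/eqP -> h|h1 h2]; first by left.
by right; apply: IH.
Qed.

Lemma rmain_sound v v' C : tracks v C -> sem (rmain k) v v' ->
  exists cs, [/\ path tstep C cs, tracks v' (last C cs) & all (fun C => num_open Q C <= F) (C :: cs)].
Proof.
move=> tr H; elim/clos_refl_trans_ind_left: v' / H.
  by exists [::]; split=> //=; rewrite andbT; case: tr => _ _ _ <-; rewrite leq_addl.
move=> y z _ [cs [pc ty al]] /rany_sound[j]; rewrite mem_iota => /= jk /(rstep_sound jk ty)[C' st tz].
exists (rcons cs C'); rewrite last_rcons rcons_path pc st; split=> //.
have /andP[h al'] : (num_open Q C <= F) && all (fun C => num_open Q C <= F) cs := al.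
rewrite /= h all_rcons al' andbT.
by case: tz => _ _ _ <-; rewrite leq_addl.
Qed.

Lemma rmain_complete v C cs : tracks v C -> path tstep C cs ->
  all (fun C => num_open Q C <= F) cs ->
  exists2 v', sem (rmain k) v v' & tracks v' (last C cs).
Proof.
elim: cs v C => [|C' cs IH] v C tr /=; first by exists v => //; apply: rt_refl.
case/andP=> st pc /andP[le al].
have [j [v1 [jk s1 t1]]] := rstep_complete tr st le.
have [v' s' t'] := IH _ _ t1 pc al; exists v' => //.
apply: rt_trans s'; apply: rt_step; apply: rany_complete s1.
by rewrite mem_iota.
Qed.

Lemma rfinalP v v' C : tracks v C -> sem (rfinal k) v v' <->
  C = nseq k [::] /\ v' = v.
Proof.
move=> tr; have [wf h1 h2 h3] := tr.
have E s : {subset s <= iota 0 k} ->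
    sem (foldr (fun j P => RSeq (RSym (k.+1 + j) (pred1 (Some Bar))) P) (rskip 0) s) v v' <->
    (forall j, j \in s -> symat w (v (k.+1 + j)) = Some Bar) /\ v' = v.
  elim: s => [|j s IH] sub /=.
    split; first by case.
    by case=> _ ->; split=> //; rewrite h1 // pos_size.
  have IH' := IH (fun i si => sub i (mem_behead (s := j :: s) si)).
  split.
    case=> _ [_ /eqP e ->] /IH'[h ->]; split=> // i.
    by rewrite inE => /orP[/eqP -> //|/h].
  case=> h e; rewrite e in IH' *; exists v; last by apply/IH'; split=> // i si; apply: h; rewrite inE si orbT.
  split=> //; last by apply/eqP; apply: h; rewrite mem_head.
  have := sub j (mem_head j s); rewrite mem_iota => jk.
  by rewrite h2 // pos_size // ltnW.
rewrite E //; split=> -[h ev]; split=> //.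
  apply: (@wf_all_taken Q) => // j jk; apply/eqP; rewrite eqn_leq taken_le leqNgt -(pos_bitP tr) //.
  by rewrite h // mem_iota.
by move=> j; rewrite mem_iota => jk; rewrite h2 // h taken_nil // symat_bar.
Qed.

Lemma tracks_init v : (forall j, j <= k -> v j = pos j 0) ->
  (forall j, j < k -> v (k.+1 + j) = v j) -> v free = F -> tracks v Q.
Proof.
move=> h1 h2 h3; have t0 j : taken Q j = 0 by rewrite /(taken _) subnn.
split=> //.
- by split=> // j jk; rewrite t0 drop0.
- by move=> j jk; rewrite h2 // h1 1?ltnW // t0.
- by rewrite num_open_init addn0.
Qed.

Lemma drop_end : drop (pos k 0) w = enc_nat p.
Proof. by rewrite pos_end enc_instE drop_size_cat. Qed.

Lemma rparse_complete j : j <= k -> exists v,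
  [/\ sem (rparse j) (fun=> 0) v, forall i, i <= j -> v i = pos i 0 & forall x, j < x -> v x = 0].
Proof.
elim: j => [|j IH] jk.
  exists (fun=> 0); split=> //; first by move=> i; rewrite leqn0 => /eqP ->; rewrite pos0 take0.
have [v [s1 h1 h2]] := IH (ltnW jk).
have e : pos j.+1 0 = pos j 0 + size (rcons (enc_seq (q j)) Bar).
  by rewrite pos_next // size_rcons addnS pos0 /(pos _ _) take_size.
exists (upd v j.+1 (pos j.+1 0)); split.
- exists v => //; exists (upd v j.+1 (v j)).
    apply: rcopy_complete; first by rewrite neq_ltn ltnSn orbT.
    by rewrite h1 //; apply: leq_ltn_trans size_w; apply: pos_size; apply: ltnW.
  apply/(consumes_bins size_w); exists (rcons (enc_seq (q j)) Bar); rewrite upd_same h1 // upd_upd e.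
  split=> //; last first.
    rewrite /(subw _ _) drop_pos // drop0.
    by eexists; rewrite -cats1 -catA.
  exists (q j) => //; apply/allP=> b bq; apply: (allP pos_plt); apply/flattenP.
  by exists (q j) => //; apply: mem_nth.
- move=> i; rewrite leq_eqVlt => /orP[/eqP ->|lt]; first by rewrite upd_same.
  by rewrite upd_lt // h1.
- by move=> x xj; rewrite upd_other ?h2 // ?(ltnW xj) // neq_ltn xj orbT.
Qed.

End Simulation.

(** * Soundness and completeness of the whole program *)

Section Program.
Variables (w : seq sym) (B : nat).
Notation sem := (rsem w B).
Notation n := (size w).

Lemma rptrs_sound b m v v' : m <= b -> sem (rptrs b m) v v' ->
  (forall j, j < m -> v' (b + j) = v j) /\
  forall x, (x < b) || (b + m <= x) -> v' x = v x.
Proof.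
elim: m v' => [|m IH] v' mb /=; first by case=> _ ->.
case=> v1 /(IH _ (ltnW mb))[h1 h2] /(rcopy_sound (w := w) (B := B)) -> //; last by lia.
split=> [j|x xb].
  rewrite ltnS leq_eqVlt => /orP[/eqP ->|jm]; first by rewrite upd_same h2 ?mb.
  by rewrite upd_other ?h1 // eqn_add2l neq_ltn jm.
by rewrite upd_other ?h2 //; lia.
Qed.

Hypothesis size_w : n < B.

Lemma rparsepos_sound d s v v' : s < d -> sem (rparsepos d s) v v' ->
  exists m, [/\ 0 < m, drop (v s) w = enc_nat m & v' = upd v d n].
Proof.
move=> sd; have ds : d != s by rewrite neq_ltn sd orbT.
case=> v1 /(rcopy_sound (w := w) (B := B) ds) -> [v2 /(consumes_natpos size_w)[t [[m m0 et] + ->]]].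
rewrite upd_same upd_upd et => -[u E] /(@end_of_input w B)[]; rewrite ?upd_same => en ->.
exists m; split=> //; last by rewrite en.
(* After the number the scan stands at the end of the input, so nothing follows p. *)
have : size u = 0.
  have := congr1 size E; rewrite size_drop size_cat.
  have := enc_nat_nil (m := m); case: (enc_nat m) en => // c l /= en _.
  by lia.
by rewrite E => /size0nil ->; rewrite cats0.
Qed.

Lemma rparsepos_complete d s v m : s < d -> v s <= n -> 0 < m -> drop (v s) w = enc_nat m ->
  sem (rparsepos d s) v (upd v d n).
Proof.
move=> sd le m0 E; have ds : d != s by rewrite neq_ltn sd orbT.
have e : v s + size (enc_nat m) = n by rewrite -E size_drop subnKC.
exists (upd v d (v s)); first by apply: rcopy_complete => //; apply: leq_ltn_trans size_w.
exists (upd v d n); last by apply/(@end_of_input w B); rewrite upd_same.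
apply/(consumes_natpos size_w); exists (enc_nat m); rewrite upd_same upd_upd e; split=> //.
  by exists m.
by exists [::]; rewrite cats0.
Qed.

Lemma rptrs_complete b m v : v 0 = 0 -> m <= b -> (forall j, j < m -> v j < B) ->
  exists v', sem (rptrs b m) v v'.
Proof.
move=> v0; elim: m => [|m IH] mb h; first by exists v.
have [v1 s1] := IH (ltnW mb) (fun j jm => h j (ltnW jm)).
have [_ h2] := rptrs_sound (ltnW mb) s1.
exists (upd v1 (b + m) (v1 m)); exists v1 => //; apply: rcopy_complete; first by lia.
by rewrite h2 ?mb //; apply: h.
Qed.

End Program.

(** There are no more pallets than bins, and distinct bins start at distinct positions of the
    input. *)
Lemma num_open_size Q p C : num_open Q C <= size (enc_inst Q p).
Proof.
apply: leq_trans (count_size _ _) _; apply: leq_trans (size_undup _) _.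
rewrite size_map flatten_indices size_map -(size_map (fun x => pos Q x.1 x.2)).
rewrite -(size_iota 0 (size (enc_inst Q p))); apply: uniq_leq_size.
  by rewrite map_inj_in_uniq ?uniq_indices //; apply: pos_inj.
move=> _ /mapP[x xI ->]; rewrite mem_iota /=; apply: pos_lt_size.
by move: xI; rewrite mem_indices => /andP[].
Qed.

Lemma stackup_prog_complete Q p B : size (enc_inst Q p) < B -> valid_instance Q ->
  0 < p -> processable Q p ->
  exists v, rsem (enc_inst Q p) B (stackup_prog (size Q)) (fun=> 0) v.
Proof.
move=> size_w vQ p0 [cs /and3P[pc /eqP lc al]].
have pp : all (fun b => 0 < plt b) (flatten Q) by case/and3P: vQ.
set w := enc_inst Q p in size_w *; set k := size Q.
have bk : k < base k by rewrite /base; lia.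
have fb : rfree k < base k by apply: ltnSn.
have [v1 [s1 h1 h1']] := rparse_complete size_w pp (leqnn k).
have sk : v1 k <= size w by rewrite h1 // pos_size.
have dk : drop (v1 k) w = enc_nat p by rewrite h1 // drop_end.
have s2 := rparsepos_complete size_w bk sk p0 dk.
set v2 := upd v1 _ _ in s2.
have e2 x : x <= k -> v2 x = pos Q x 0 by move=> xk; rewrite /v2 upd_lt ?h1 // (leq_ltn_trans xk).
have sv2 : small w (base k) v2.
  move=> x xD; case: (leqP x k) => [xk|kx]; first by rewrite e2 // pos_size.
  by rewrite /v2 upd_lt // h1'.
have [_ t3 _] := decides_valid size_w bk.
have [|v3 s3] := (t3 v2 sv2).2; first by rewrite e2 // valid_atP.
have [_ ag3] := (t3 v2 sv2).1 _ s3.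
have e3 x : x <= k -> v3 x = pos Q x 0 by move=> xk; rewrite -ag3 ?e2 // (leq_ltn_trans xk).
have [||v4 s4] := rptrs_complete size_w (v := v3) _ (leqnSn k).
- by rewrite e3 // pos0 take0.
- by move=> j jk; rewrite (e3 j (ltnW jk)); apply: leq_ltn_trans size_w; exact: (@pos_size Q p j 0 (ltnW jk)).
have [e4 e4'] := rptrs_sound (leqnSn k) s4.
(* p may be too large for a register; capping at |w| loses nothing since no more than |w| pallets
   are ever open. *)
pose F := minn p (size w).
have F_le : F <= size w by apply: geq_minr.
pose v5 := upd v4 (rfree k) F.
have e5 x : x <= k -> v5 x = pos Q x 0.
  move=> xk; have xf : x < rfree k by rewrite /rfree; lia.
  by rewrite /v5 upd_lt // e4' ?ltnS ?xk // e3.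
have tr5 : tracks Q F v5 Q.
  apply: tracks_init => //; last by rewrite /v5 upd_same.
  move=> j jk; rewrite (e5 j (ltnW jk)) /v5 upd_lt; last by rewrite /rfree; lia.
  by rewrite e4 // (e3 j (ltnW jk)).
have sv5 := tracks_small F_le tr5.
have d5 : drop (v5 k) w = enc_nat p by rewrite e5 // drop_end.
have f5 : v5 (rfree k) <= p by rewrite /v5 upd_same geq_minl.
have [v6 s6] := rlenum_complete size_w bk fb sv5 d5 f5.
have [_ ag6] := rlenum_sound size_w bk fb sv5 d5 s6.
have tr6 := tracks_agree ag6 tr5.
have [|v7 s7 tr7] := rmain_complete F_le size_w pp tr6 pc.
  apply/allP=> C Ccs; rewrite leq_min num_open_size andbT.
  by apply: (allP al); rewrite inE Ccs orbT.
exists v7; exists v2; first by exists v1.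
exists v3 => //; exists v4 => //; exists v6.
  exists v5; first by exists F => //; apply: leq_ltn_trans size_w.
  by exists v5 => //; split=> //; rewrite /v5 upd_same.
by exists v7 => //; apply/(rfinalP _ _ _ tr7).
Qed.

Lemma stackup_prog_sound w B k v : size w < B ->
  rsem w B (stackup_prog k) (fun=> 0) v -> stackup_lang k w.
Proof.
move=> size_w [v2 [v1 /(rparse_sound size_w)[Q [sQ pp sub h1 h1']] s2] s].
subst k; set k := size Q in s2 s h1 h1'.
have bk : k < base k by rewrite /base; lia.
have fb : rfree k < base k by apply: ltnSn.
have [p [p0 dk e2']] := rparsepos_sound size_w bk s2.
(* The parsed sequences are a prefix of w, and what follows them was read as the number p. *)
have Ew : w = enc_inst Q p.
  case: sub => u; rewrite drop0 => E; rewrite E; congr cat.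
  by move: dk; rewrite h1 // take_size E drop_size_cat.
move: size_w s s2 dk e2' {sub}; rewrite {}Ew => size_w s s2 dk e2'.
have e2 x : x <= k -> v2 x = pos Q x 0.
  by move=> xk; rewrite e2' upd_lt ?h1 ?pos0 // (leq_ltn_trans xk).
have sv2 : small (enc_inst Q p) (base k) v2.
  move=> x xD; case: (leqP x k) => [xk|kx]; first by rewrite e2 // pos_size.
  by rewrite e2' upd_lt // h1'.
case: s => v3 s3 [v4 s4 [v6 [v5 [F FB e5'] [_ [/= F_le _ ->] s6]] [v7 s7 s8]]].
have [_ t3 _] := decides_valid size_w bk.
have [va ag3] := (t3 v2 sv2).1 _ s3; rewrite e2 // valid_atP // in va.
have e3 x : x <= k -> v3 x = pos Q x 0 by move=> xk; rewrite -ag3 ?e2 // (leq_ltn_trans xk).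
have [e4 e4'] := rptrs_sound (leqnSn k) s4.
rewrite e5' upd_same in F_le.
have e5 x : x <= k -> v5 x = pos Q x 0.
  move=> xk; have xf : x < rfree k by rewrite /rfree; lia.
  by rewrite e5' upd_lt // e4' ?ltnS ?xk // e3.
have tr5 : tracks Q F v5 Q.
  apply: tracks_init => //; last by rewrite e5' upd_same.
  move=> j jk; rewrite (e5 j (ltnW jk)) e5' upd_lt; last by rewrite /rfree; lia.
  by rewrite e4 // (e3 j (ltnW jk)).
have sv5 := tracks_small F_le tr5.
have d5 : drop (v5 k) (enc_inst Q p) = enc_nat p by rewrite e5 // drop_end.
have [Fp ag6] := rlenum_sound size_w bk fb sv5 d5 s6.
rewrite e5' upd_same in Fp.
have tr6 := tracks_agree ag6 tr5.
have [cs [pc tr7 al]] := rmain_sound F_le size_w tr6 s7.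
have [lc _] := (rfinalP _ _ _ tr7).1 s8.
exists Q, p; split=> //; exists cs; rewrite pc lc eqxx /=.
apply: sub_all al => C h; exact: leq_trans h Fp.
Qed.

Theorem theorem8 : forall k : nat, 0 < k -> in_NL (stackup_lang k).
Proof.
move=> k k0; apply: (@in_NL_rprog _ _ (stackup_prog k)) => w B size_w; split.
  case=> Q [p [sQ vQ p0 ew pr]]; subst k w.
  exact: stackup_prog_complete.
by case=> v; apply: stackup_prog_sound.
Qed.
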